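(* Let $q>4$ be a real number and suppose that the random-cluster model with cluster weight $q$ on the square lattice undergoes a continuous phase transition, i.e. $\theta^{\mathrm{w}}(p_c(q),q)=0$. Let $\lambda$ be the unique positive solution to the equation $e^{\lambda}+e^{-\lambda}=\sqrt q$. Then $\mu_{q,\lambda}=\mu_{q,-\lambda}$.
   Context: Lattices. $\mathbb{Z}^2$ denotes the square lattice with vertices at integer points. Its faces are the unit squares centered at $(a+\tfrac12,b+\tfrac12)$, $a,b\in\mathbb{Z}$. The primal lattice $\mathbb{L}$ has as vertices the faces with $a+b$ even, two such faces being adjacent in $\mathbb{L}$ iff they share exactly one corner; the dual lattice $\mathbb{L}^*$ is defined likewise from the faces with $a+b$ odd. Both are (rotated and rescaled) square lattices and are planar duals of each other. Each edge $e\in E(\mathbb{L})$ passes through a unique vertex of $\mathbb{Z}^2$, through which exactly one edge $e^*\in E(\mathbb{L}^* )$, the dual edge of $e$, passes. Thus $\mathbb{Z}^2$ is the medial lattice of $\mathbb{L}$: its vertices correspond to the edges of $\mathbb{L}$, and each edge of $\mathbb{Z}^2$ separates one vertex of $\mathbb{L}$ from one vertex of $\mathbb{L}^*$. For $\omega\in\{0,1\}^{E(\mathbb{L})}$ the dual configuration $\omega^*\in\{0,1\}^{E(\mathbb{L}^* )}$ is given by $\omega^*_{e^*}=1-\omega_e$. Random-cluster measures. For finite $\Lambda\subset\mathbb{L}$, let $E(\Lambda)$ be the set of edges of $\mathbb{L}$ with both endpoints in $\Lambda$, and $\partial\Lambda$ the set of vertices of $\Lambda$ adjacent in $\mathbb{L}$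 to a vertex outside $\Lambda$. For $p\in(0,1)$, $q\ge1$, the free random-cluster measure on $\{0,1\}^{E(\Lambda)}$ gives $\omega$ probability proportional to $p^{o(\omega)}(1-p)^{c(\omega)}q^{k(\omega)}$, where $o(\omega)$, $c(\omega)$ are the numbers of open (value $1$) and closed (value $0$) edges and $k(\omega)$ is the number of clusters (connected components of the graph with vertex set $\Lambda$ and edge set the open edges). The wired measure is defined in the same way, with $k(\omega)$ replaced by the number of clusters not intersecting $\partial\Lambda$. Their weak limits as $\Lambda\uparrow\mathbb{L}$ exist and are denoted $\mathbb{P}^{\mathrm{f}}_{p,q}$ and $\mathbb{P}^{\mathrm{w}}_{p,q}$. Let $\theta^{\mathrm{w}}(p,q)$ be the $\mathbb{P}^{\mathrm{w}}_{p,q}$-probability that a fixed vertex of $\mathbb{L}$ lies in an infinite open cluster. The critical threshold is $p_c=p_c(q)=\sqrt q/(1+\sqrt q)$. It is standard that $\theta^{\mathrm{w}}(p_c,q)=0$ (which is equivalent to continuity of $p\mapsto\theta^{\mathrm{w}}(p,q)$) implies that $\mathbb{P}^{\mathrm{f}}_{p_c,q}=\mathbb{P}^{\mathrm{w}}_{p_c,q}$, and that under this common measure almost surely neither $\omega$ nor $\omega^*$ has an infinite cluster. Definition of $\mu_{q,\lambda}$ (for $q$ with $\theta^{\mathrm{w}}(p_c(q),q)=0$ and $\lambda\in\mathbb{R}$). Sample $\omega$ from $\mathbb{P}^{\mathrm{f}}_{p_c,q}=\mathbb{P}^{\mathrm{w}}_{p_c,q}$. Consider the loops in $\mathbb{Z}^2$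 which are the interfaces separating primal clusters (of $\omega$) from dual clusters (of $\omega^*$). Concretely, at each vertex of $\mathbb{Z}^2$, corresponding to an edge $e=\{u,v\}$ of $\mathbb{L}$ with dual edge $e^*=\{u',v'\}$, the four incident edges of $\mathbb{Z}^2$ are paired as follows: if $\omega_e=0$, the two edges bordering the face $u$ are paired, and the two edges bordering the face $v$ are paired; if $\omega_e=1$, the two edges bordering the face $u'$ are paired, and the two edges bordering the face $v'$ are paired. Following these pairings decomposes the edge set of $\mathbb{Z}^2$ into almost surely finite non-crossing loops. Given $\omega$, orient each loop independently, clockwise with probability $e^{-\lambda}/(e^{\lambda}+e^{-\lambda})$ and anticlockwise with probability $e^{\lambda}/(e^{\lambda}+e^{-\lambda})$. Every edge of $\mathbb{Z}^2$ lies in exactly one loop, so this gives an orientation of every edge of $\mathbb{Z}^2$ (at each vertex there are two incoming and two outgoing edges). Forgetting the loops and keeping only the orientations of the edges of $\mathbb{Z}^2$, one obtains a random orientation of the edges of $\mathbb{Z}^2$; $\mu_{q,\lambda}$ denotes its law. *)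

(* Defs.v *)
From HB Require Import structures.
From mathcomp Require Import all_boot all_order all_algebra finmap.
From mathcomp Require Import all_classical all_reals all_analysis.
From mathcomp.analysis.showcase Require Import summability.

Set Implicit Arguments.
Unset Strict Implicit.
Unset Printing Implicit Defensive.

Import Order.TTheory GRing.Theory Num.Theory.
Import numFieldNormedType.Exports.

Local Open Scope fset_scope.
Local Open Scope ring_scope.

(** * The lattices *)

(* Each vertex of Z^2 is crossed by exactly one edge of the primal lattice L,
   so that vertices of Z^2 also serve as names for the edges of L. *)
Definition vertex : Type := (int * int)%type.

(* (a, b) stands for the unit square centred at (a + 1/2, b + 1/2). *)
Definition face : Type := (int * int)%type.

Definition is_primal (f : face) : bool := (2 %| f.1 + f.2)%Z.

(* The vertices of L. *)
Definition primal : Type := {f : face | is_primal f}.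

Definition origin : primal := exist _ ((0, 0) : face) isT.

Definition corners (f : face) : {fset vertex} :=
  [fset (f.1, f.2); (f.1 + 1, f.2); (f.1, f.2 + 1); (f.1 + 1, f.2 + 1)].

Definition adj (f g : primal) : bool :=
  #|` corners (val f) `&` corners (val g)| == 1%N.

(* The only common corner of two adjacent vertices of L is the name of the edge
   joining them.  The relation may hold of f and f, which is harmless since
   only its reflexive transitive closure is used. *)
Definition open_adj (w : vertex -> bool) (f g : primal) : bool :=
  has w (corners (val f) `&` corners (val g)).

(** * Finite volumes *)

(* The endpoints of the edge of L named z are the two primal faces having z as
   a corner. *)
Definition fin_edges (V : {fset primal}) : {fset vertex} :=
  [fset z in \bigcup_(f <- V) corners (val f) |
    `[< forall f : primal, z \in corners (val f) -> f \in V >]].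

Definition boundary (V : {fset primal}) : {set V} :=
  [set u : V | `[< exists v : primal, v \notin V /\ adj (val u) v >]].

(* A configuration in V is given by the set S of its open edges. *)
Definition fin_clusters (V : {fset primal}) (S : {fset vertex}) :
    {set {set V}} :=
  [set [set v : V |
        connect (fun x y : V => open_adj (fun z => z \in S) (val x) (val y)) u v]
  | u : V].

Definition k_wired (V : {fset primal}) (S : {fset vertex}) : nat :=
  #|[set C in fin_clusters V S | [disjoint C & boundary V]]|.

Definition rc_weight (R : realType) (p q : R) (V : {fset primal})
    (S : {fset vertex}) : R :=
  p ^+ #|` S| * (1 - p) ^+ #|` fin_edges V `\` S| * q ^+ k_wired V S.

Local Open Scope classical_set_scope.

(** * Percolation configurations *)

(* {0,1}^I with the product sigma-algebra. *)
Definition coord_events (I : Type) : set (set (I -> bool)) :=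
  [set A | exists i : I, A = [set w : I -> bool | w i = true]].

Definition bfield (I : Type) := g_sigma_algebraType (@coord_events I).

(* {0,1}^{E(L)}: w z says that the edge of L through z is open. *)
Definition config := bfield vertex.

Definition open_cluster (w : config) (f : primal) : set primal :=
  [set g | exists s : seq primal, path (open_adj w) f s /\ last f s = g].

Definition percolates (f : primal) : set config :=
  [set w | infinite_set (open_cluster w f)].

(** * The wired random-cluster measure *)

(* A configuration in V is extended to E(L) by closed edges; the choice of
   extension has no influence on weak limits. *)
Definition wired_expectation (R : realType) (p q : R) (V : {fset primal})
    (f : config -> R) : R :=
  (\sum_(S <- fpowerset (fin_edges V))
      rc_weight p q V S * f (fun z => z \in S)) /
  (\sum_(S <- fpowerset (fin_edges V)) rc_weight p q V S).

(* The weak limit as V increases to L is taken along the finite sets of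
   vertices of L directed by inclusion; {0,1}^{E(L)} has the product topology,
   so that continuous functions are bounded. *)
Definition is_wired_measure (R : realType) (p q : R) (P : probability config R)
    : Prop :=
  forall f : {ptws vertex -> bool} -> R, continuous f ->
    wired_expectation p q V f @[V --> totally] --> \int[P]_w f w.

Definition p_c (R : realType) (q : R) : R := Num.sqrt q / (1 + Num.sqrt q).

(** * Loops *)

(* (z, false) joins z to z + (1, 0) and (z, true) joins z to z + (0, 1). *)
Definition edge : Type := (vertex * bool)%type.

Inductive dir := East | North | West | South.

Definition left_of (d : dir) : dir :=
  match d with
  | East => North | North => West | West => South | South => East
  end.

Definition right_of (d : dir) : dir :=
  match d with
  | East => South | South => West | West => North | North => East
  end.

(* (z, d) is the edge of Z^2 leaving z in direction d, directed away from z. *)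
Definition dart : Type := (vertex * dir)%type.

Definition target (a : dart) : vertex :=
  let: ((x, y), d) := a in
  match d with
  | East => (x + 1, y) | North => (x, y + 1)
  | West => (x - 1, y) | South => (x, y - 1)
  end.

Definition edge_of (a : dart) : edge :=
  let: ((x, y), d) := a in
  match d with
  | East => ((x, y), false) | North => ((x, y), true)
  | West => ((x - 1, y), false) | South => ((x, y - 1), true)
  end.

Definition forward (e : edge) : dart := (e.1, if e.2 then North else East).

Definition backward (e : edge) : dart :=
  (target (forward e), if e.2 then South else West).

Definition left_face (a : dart) : face :=
  let: ((x, y), d) := a in
  match d with
  | East => (x, y) | North => (x - 1, y)
  | West => (x - 1, y - 1) | South => (x, y - 1)
  end.

(* The dart following a on its loop.  Turning left (resp. right) at the target
   of a means continuing along the face to the left (resp. right) of a.  The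
   loop continues along the primal one of these two faces if the edge of L
   through the target is closed, and along the dual one if it is open. *)
Definition next_dart (w : config) (a : dart) : dart :=
  (target a,
   if is_primal (left_face a) == ~~ w (target a) then left_of a.2
   else right_of a.2).

Definition finite_loop (w : config) (e : edge) : Prop :=
  exists n : nat, (0 < n)%N /\ iter n (next_dart w) (forward e) = forward e.

(* The edges of the loop through e, when that loop is finite. *)
Definition loop (w : config) (e : edge) : set edge :=
  [set edge_of (iter n (next_dart w) (forward e)) | n in [set: nat]].

(* The area enclosed by a closed curve is the integral of x dy; it is counted
   positively if and only if the curve runs anticlockwise. *)
Definition x_dy (a : dart) : int :=
  match a.2 with North => a.1.1 | South => - a.1.1 | _ => 0 end.

Definition signed_area (w : config) (a : dart) (n : nat) : int :=
  \sum_(i < n) x_dy (iter i (next_dart w) a).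

Definition anticlockwise (w : config) (a : dart) : Prop :=
  exists n : nat,
    [/\ (0 < n)%N, iter n (next_dart w) a = a & 0 < signed_area w a n].

Definition clockwise (w : config) (a : dart) : Prop :=
  exists n : nat,
    [/\ (0 < n)%N, iter n (next_dart w) a = a & signed_area w a n < 0].

(** * Random orientations *)

(* s e says that e is oriented towards increasing coordinates. *)
Definition orientation := bfield edge.

Definition oriented (s : orientation) (e : edge) : dart :=
  if s e then forward e else backward e.

(* The orientation s comes from an orientation of each loop of w. *)
Definition coherent (w : config) (s : orientation) : Prop :=
  forall e, let a := next_dart w (oriented s e) in oriented s (edge_of a) = a.

(* The loop through e is oriented by s anticlockwise (b = true) or clockwise
   (b = false). *)
Definition loop_oriented (w : config) (s : orientation) (e : edge) (b : bool)
    : Prop :=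
  if b then anticlockwise w (oriented s e) else clockwise w (oriented s e).

Definition orientation_prob (R : realType) (lam : R) (b : bool) : R :=
  expR (if b then lam else - lam) / (expR lam + expR (- lam)).

(* J is the joint law of a configuration w sampled from P and of the orientation
   of the edges of Z^2 obtained by orienting each loop of w independently.  The
   last clause expresses conditional independence given w: the joint law of the
   orientations of the loops through e_0, ..., e_(n-1) is prescribed on any event
   A of w on which these loops are (finite and) distinct. *)
Definition is_loop_coupling (R : realType) (lam : R) (P : probability config R)
    (J : probability (config * orientation)%type R) : Prop :=
  [/\ forall A : set config, measurable A -> J (fst @^-1` A) = P A,
      {ae J, forall x, coherent x.1 x.2}
    & forall (n : nat) (e : 'I_n -> edge) (b : 'I_n -> bool) (A : set config),
        measurable A ->
        (forall w, A w -> forall i, finite_loop w (e i)) ->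
        (forall w, A w -> forall i j, i != j -> ~ loop w (e i) (e j)) ->
        J [set x | A x.1 /\ forall i, loop_oriented x.1 x.2 (e i) (b i)] =
        (P A * (\prod_(i < n) orientation_prob lam (b i))%:E)%E].

(* mu is the measure mu_{q,lam}, where P is the random-cluster measure at
   p_c(q) and cluster weight q. *)
Definition is_orientation_law (R : realType) (lam : R)
    (P : probability config R) (mu : probability orientation R) : Prop :=
  exists2 J : probability (config * orientation)%type R,
    is_loop_coupling lam P J &
    forall B : set orientation, measurable B -> mu B = J (snd @^-1` B).

(* Main.v *)
Require Import Defs.
From HB Require Import structures.
From mathcomp Require Import all_boot all_order all_algebra fingroup perm finmap zify ring lra.
From mathcomp Require Import all_classical all_reals all_analysis.
From mathcomp.analysis.showcase Require Import summability.
Set Implicit Arguments.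
Unset Strict Implicit.
Unset Printing Implicit Defensive.
Import Order.TTheory GRing.Theory Num.Theory.
Import numFieldNormedType.Exports.
Local Open Scope classical_set_scope.
Local Open Scope ring_scope.

(* In the box of faces of sup-norm at most n, put on pairs (S, t) of a set S of
   open edges and an orientation t of its loops, those touching the boundary of
   the box being anticlockwise, the weight
   exp (lam / 4 * (number of left turns - number of right turns along t)).
   By Hopf's Umlaufsatz a loop contributes exp (lam) if it is anticlockwise and
   exp (- lam) if not; so the orientations of the inner loops are independent
   given S and, by Euler's formula, the marginal law of S is a random-cluster
   measure whose clusters touching the boundary have weight
   k = sqrt q * exp (lam) instead of 1 or q.  Given t, on the other hand, S is
   only constrained at the vertices where t does not determine the pairing:
   toggling S at all the others exchanges left and right turns there, so that
   the marginal law of t is the same for lam and - lam.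
   Both values of k lie in [1, q], so that this measure is compared with the
   wired one by Holley's inequality on one side and by exploring the boundary
   clusters on the other.  As no cluster percolates, it converges to P, and the
   law of t converges to mu on cylinders, because most loops are short and the
   orientation probabilities of short loops depend on a finite window of S. *)

(** * Loops *)

(** The weight is that of the Baxter-Kelland-Wu correspondence between random-cluster and six-vertex
    models. The symmetry in finite volume is exact because [t] is kept while [S] is toggled. This is
    why the boundary loops are frozen: boundary darts turn left for every [S], and with a prescribed
    value of [t] they contribute a constant to the rotation, which the normalisation removes. The
    price is the boundary weight k = 1 + exp (2 lam), which takes different values for lam and -
    lam. So one and the same law of [t] arises from two different random-cluster measures, and only
    the absence of percolation shows that these have the same limit. The inside of a loop is not
    described by a Jordan curve theorem but by an integer winding number, which takes only two
    consecutive values. It links the three descriptions of a loop that occur: the sign of its area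
    (in the definition of the orientations), its total rotation (in the weight) and its position
    around a cluster (in Euler's formula). Loops are always run with primal faces on their left, so
    that their orientations become boolean functions constant on the orbits of a permutation. *)

Definition dir_code (d : dir) : bool * bool :=
  match d with
  | East => (false, false) | North => (false, true)
  | West => (true, false) | South => (true, true)
  end.

Definition dir_decode (c : bool * bool) : dir :=
  match c with
  | (false, false) => East | (false, true) => North
  | (true, false) => West | (true, true) => South
  end.

Lemma dir_codeK : cancel dir_code dir_decode.
Proof. by case. Qed.

HB.instance Definition _ := Equality.copy dir (can_type dir_codeK).
HB.instance Definition _ := Choice.copy dir (can_type dir_codeK).
HB.instance Definition _ := Countable.copy dir (can_type dir_codeK).
HB.instance Definition _ := Finite.copy dir (can_type dir_codeK).

Definition opp_dir (d : dir) : dir :=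
  match d with East => West | North => South | West => East | South => North end.

Definition rev_dart (a : dart) : dart := (target a, opp_dir a.2).

Definition right_face (a : dart) : face := left_face (rev_dart a).

Lemma primalS (x y x' y' : int) : `|x - x'| + `|y - y'| = 1 ->
  is_primal (x, y) = ~~ is_primal (x', y').
Proof. rewrite /is_primal /=; lia. Qed.

Lemma rev_dartK : involutive rev_dart.
Proof.
case=> [[x y] []]; rewrite /rev_dart /=; congr pair; congr pair; lia.
Qed.

Lemma primal_right (a : dart) :
  is_primal (right_face a) = ~~ is_primal (left_face a).
Proof.
by case: a => [[x y] []]; rewrite /right_face /=; apply: primalS; lia.
Qed.

Definition turns_left (w : config) (a : dart) : bool :=
  is_primal (left_face a) == ~~ w (target a).

Lemma next_dartE (w : config) (a : dart) : next_dart w a =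
  (target a, if turns_left w a then left_of a.2 else right_of a.2).
Proof. by []. Qed.

Lemma left_face_turn_left (a : dart) :
  left_face (target a, left_of a.2) = left_face a.
Proof. by case: a => [[x y] []] /=; congr pair; lia. Qed.

Lemma right_face_turn_right (a : dart) :
  right_face (target a, right_of a.2) = right_face a.
Proof. by case: a => [[x y] []] /=; rewrite /right_face /=; congr pair; lia. Qed.

Lemma primal_turn_right (a : dart) :
  is_primal (left_face (target a, right_of a.2)) = is_primal (left_face a).
Proof. case: a => [[x y] []]; rewrite /is_primal /=; lia. Qed.

Lemma primal_next (w : config) (a : dart) :
  is_primal (left_face (next_dart w a)) = is_primal (left_face a).
Proof.
rewrite next_dartE; case: ifP => _; last exact: primal_turn_right.
by rewrite left_face_turn_left.
Qed.

Lemma primal_iter (w : config) (a : dart) (n : nat) :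
  is_primal (left_face (iter n (next_dart w) a)) = is_primal (left_face a).
Proof. by elim: n => //= n IHn; rewrite primal_next. Qed.

Lemma target_inj (a b : dart) : target a = target b -> a.2 = b.2 -> a = b.
Proof.
case: a b => [[x y] d] [[x' y'] d'] /= + Ed; subst d'.
by case: d => /= -[? ?]; congr pair; congr pair; lia.
Qed.

(** The colour of the left face is kept along a loop, so that two darts with the same successor turn
    the same way at the same vertex. *)
Lemma next_dart_inj (w : config) : injective (next_dart w).
Proof.
move=> a b Eab; have Ep : is_primal (left_face a) = is_primal (left_face b).
  by rewrite -(primal_next w a) Eab primal_next.
move: Eab; rewrite !next_dartE /turns_left Ep => -[Et].
rewrite Et => Ed; apply: target_inj => //; move: Ed.
by case: ifP => _; case: (a.2); case: (b.2).
Qed.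

Lemma opp_dir_neq (d : dir) : opp_dir d != d.
Proof. by case: d. Qed.

(** * Winding numbers *)

Definition dart_row (a : dart) : int :=
  match a.2 with South => a.1.2 - 1 | _ => a.1.2 end.

Definition vert (a : dart) : int :=
  match a.2 with North => 1 | South => - 1 | _ => 0 end.

Lemma iter_next_inj (w : config) (i : nat) :
  injective (iter i (next_dart w)).
Proof. by elim: i => [|i IHi] b c //= /next_dart_inj /IHi. Qed.

(** Each step to a neighbouring face leads from the left to the right of some dart, and such steps
    connect all faces. *)
Lemma face_ind (Q : face -> Prop) (f0 : face) :
  Q f0 -> (forall b, Q (left_face b) -> Q (right_face b)) -> forall f, Q f.
Proof.
move=> Q0' step.
have rgt x y : Q (x, y) -> Q (x + 1, y).
  move=> H; have := step ((x + 1, y), North).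
  rewrite /right_face /= addrK; have -> : y + 1 - 1 = y by lia.
  exact.
have lft x y : Q (x, y) -> Q (x - 1, y).
  by move=> H; have := step ((x, y + 1), South); rewrite /right_face /= addrK; exact.
have up x y : Q (x, y) -> Q (x, y + 1).
  move=> H; have := step ((x + 1, y + 1), West).
  by rewrite /right_face /= !addrK; exact.
have dn x y : Q (x, y) -> Q (x, y - 1).
  by move=> H; have := step ((x, y), East); rewrite /right_face /= addrK; exact.
have mv1 (k : nat) x y : Q (x, y) -> Q (x + k%:Z, y) /\ Q (x - k%:Z, y).
  elim: k => [|k IHk] H.
    by rewrite !addr0.
  have [H1 H2] := IHk H; split.
    by rewrite (_ : x + k.+1%:Z = x + k%:Z + 1); [exact: rgt | lia].
  by rewrite (_ : x - k.+1%:Z = x - k%:Z - 1); [exact: lft | lia].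
have mv2 (k : nat) x y : Q (x, y) -> Q (x, y + k%:Z) /\ Q (x, y - k%:Z).
  elim: k => [|k IHk] H.
    by rewrite !addr0.
  have [H1 H2] := IHk H; split.
    by rewrite (_ : y + k.+1%:Z = y + k%:Z + 1); [exact: up | lia].
  by rewrite (_ : y - k.+1%:Z = y - k%:Z - 1); [exact: dn | lia].
case: f0 Q0' => x0 y0 Q0 [x y].
have Q1 : Q (x, y0).
  have [le|le] := lerP x0 x.
    by rewrite (_ : x = x0 + `|x - x0|%N%:Z); [exact: (mv1 `|x - x0|%N _ _ Q0).1 | lia].
  by rewrite (_ : x = x0 - `|x - x0|%N%:Z); [exact: (mv1 `|x - x0|%N _ _ Q0).2 | lia].
have [le|le] := lerP y0 y.
  by rewrite (_ : y = y0 + `|y - y0|%N%:Z); [exact: (mv2 `|y - y0|%N _ _ Q1).1 | lia].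
by rewrite (_ : y = y0 - `|y - y0|%N%:Z); [exact: (mv2 `|y - y0|%N _ _ Q1).2 | lia].
Qed.

Section Orbit.
Variables (w : config) (a : dart) (n : nat).
Local Notation d i := (iter i (next_dart w) a).

Definition visits (b : dart) : int := \sum_(i < n) (d i == b)%:R.

(** The winding number around the centre of [f], as the signed number of crossings of the ray that
    leaves this centre towards the East. *)
Definition wind (f : face) : int :=
  \sum_(i < n) vert (d i) * ((f.1 < (d i).1.1) && (dart_row (d i) == f.2))%:R.

Hypothesis per : iter n (next_dart w) a = a.

Lemma iter_add_period (i : nat) : d (i + n) = d i.
Proof. by rewrite iterD per. Qed.

Lemma sum_cycle (F : dart -> int) :
  \sum_(i < n) F (d i.+1) = \sum_(i < n) F (d i).
Proof.
rewrite -(big_mkord xpredT (fun i => F (d i.+1))).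
rewrite -(big_mkord xpredT (fun i => F (d i))).
case: n per => [_|m pm]; first by rewrite !big_geq.
rewrite big_nat_recr //= big_nat_recl //= addrC.
by congr (F _ + _); exact: pm.
Qed.

Lemma sum_vertex_cycle (F : vertex -> int) :
  \sum_(i < n) (F (target (d i)) - F (d i).1) = 0.
Proof. by rewrite sumrB (sum_cycle (fun b => F b.1)) subrr. Qed.

Lemma wind_hstep (x y : int) : wind (x - 1, y) - wind (x, y) =
  visits ((x, y), North) - visits (rev_dart ((x, y), North)).
Proof.
rewrite /wind /visits -!sumrB; apply: eq_bigr => i _.
case: (d i) => [[u v] e]; rewrite /vert /dart_row /rev_dart /=.
rewrite !xpair_eqE /=; case: e; rewrite /= ?andbF ?andbT ?mul0r ?subr0 //; lia.
Qed.

Lemma wind_vstep (x y : int) : wind (x, y) - wind (x, y - 1) =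
  visits ((x, y), East) - visits (rev_dart ((x, y), East)).
Proof.
(* [G] marks the vertices between the two rays. A closed loop enters and leaves this set equally
   often, and it can do so only across one of the rays or through the edge at the end of the set. *)
pose G (z : vertex) : int := ((x < z.1) && (z.2 == y))%:R.
rewrite -[LHS]addr0 -(sum_vertex_cycle G).
rewrite /wind /visits -!sumrB -big_split; apply: eq_bigr => i _ /=.
case: (d i) => [[u v] e]; rewrite /vert /dart_row /rev_dart /G /=.
rewrite !xpair_eqE /=; case: e; rewrite /= ?andbF ?andbT ?mul0r ?subr0 //; lia.
Qed.

Lemma wind_step (b : dart) : wind (left_face b) - wind (right_face b) =
  visits b - visits (rev_dart b).
Proof.
case: b => [[x y] []]; rewrite /right_face /=.
- have -> : ((x + 1 - 1, y - 1) : face) = (x, y - 1) by congr pair; lia.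
  exact: wind_vstep.
- have -> : ((x, y + 1 - 1) : face) = (x, y) by congr pair; lia.
  exact: wind_hstep.
- have Eb : ((x, y), West) = rev_dart ((x - 1, y), East).
    by rewrite /rev_dart /=; congr pair; congr pair; lia.
  by rewrite Eb rev_dartK -opprB -(opprB (visits _)) -wind_vstep.
- have Eb : ((x, y), South) = rev_dart ((x, y - 1), North).
    by rewrite /rev_dart /=; congr pair; congr pair; lia.
  by rewrite Eb rev_dartK -opprB -(opprB (visits _)) -wind_hstep.
Qed.

(** On the right of the box, above it and below it the ray meets no dart. On its left the ray meets
    all vertical darts of its row, and their signs cancel since the loop returns to its height. *)
Lemma wind_out (lo1 hi1 lo2 hi2 : int) (f : face) :
  (forall i, (i < n)%N -> let g := left_face (d i) in
     [/\ lo1 <= g.1, g.1 <= hi1, lo2 <= g.2 & g.2 <= hi2]) ->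
  ~~ [&& lo1 <= f.1, f.1 <= hi1, lo2 <= f.2 & f.2 <= hi2] -> wind f = 0.
Proof.
move=> box; rewrite !negb_and => fout.
have [lf|lf] := ltrP f.1 lo1.
  suff -> : wind f = \sum_(i < n) vert (d i) * (dart_row (d i) == f.2)%:R.
    rewrite -[RHS](sum_vertex_cycle (fun z : vertex => (f.2 < z.2 :> int)%R%:R)).
    apply: eq_bigr => i _; case: (d i) => [[u v] e].
    by rewrite /vert /dart_row /=; case: e => /=; lia.
  apply: eq_bigr => i _; have /= := box i (ltn_ord i).
  case: (d i) => [[u v] e]; rewrite /vert /dart_row /=; case: e => /=; rewrite ?mul0r //.
    by move=> [*]; congr (_ * (nat_of_bool _)%:R); lia.
  by move=> [*]; congr (_ * (nat_of_bool _)%:R); lia.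
apply: big1 => i _; have /= := box i (ltn_ord i).
move: fout lf; case: (d i) => [[u v] e]; rewrite /vert /dart_row /=.
by case: e => /=; rewrite ?mul0r // => fout lf [*]; lia.
Qed.

Hypothesis n_gt0 : (0 < n)%N.
Hypothesis nmin : forall m, (0 < m < n)%N -> d m != a.

Lemma iter_period_inj (i j : nat) : (i < n)%N -> (j < n)%N -> d i = d j -> i = j.
Proof.
wlog ij : i j / (i <= j)%N.
  move=> H li lj E; have [|/ltnW] := leqP i j => l; first exact: H.
  by apply/esym/H => //.
move=> li lj E; apply/eqP; rewrite eqn_leq ij leqNgt /=; apply/negP => lt_ij.
have /negP[] := nmin (m := j - i) ltac:(lia).
apply/eqP; have : iter i (next_dart w) (d (j - i)) = iter i (next_dart w) a.
  by rewrite -iterD subnKC.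
exact: iter_next_inj.
Qed.

Lemma visits_in (i : nat) : visits (d i) = 1.
Proof.
wlog li : i / (i < n)%N.
  move=> H; have Ed (k : nat) : d (i %% n + k * n)%N = d (i %% n)%N.
    by elim: k => [|k IHk]; rewrite ?addn0 // mulSn addnCA addnC iter_add_period.
  by have := H _ (ltn_pmod i n_gt0); rewrite  -(Ed (i %/ n)%N) addnC -divn_eq.
rewrite /visits (bigD1 (Ordinal li)) //= eqxx big1 ?addr0 // => j.
move=> nij; case: eqP => // E; case/eqP: nij; apply: val_inj => /=.
exact: iter_period_inj.
Qed.

Lemma visits_out (b : dart) : (forall i, (i < n)%N -> d i != b) -> visits b = 0.
Proof. by move=> nb; apply: big1 => i _; rewrite (negPf (nb i _)). Qed.

Lemma visitsP (b : dart) :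
  (exists2 i, (i < n)%N & b = d i) \/ visits b = 0.
Proof.
have [/existsP[i /eqP E]|/existsPn nb] := boolP [exists i : 'I_n, d i == b].
  by left; exists i.
by right; apply: visits_out => i li; apply: (nb (Ordinal li)).
Qed.

(** A loop never runs along an edge in both directions, as the reverse of a dart has the other
    colour on its left. *)
Lemma visits_rev (i : nat) : visits (rev_dart (d i)) = 0.
Proof.
apply: visits_out => j _; apply/eqP => E.
have := primal_right (d i); rewrite /right_face -E !primal_iter.
by case: is_primal.
Qed.

Lemma wind_left_right (i : nat) :
  wind (left_face (d i)) = wind (right_face (d i)) + 1.
Proof.
by have := wind_step (d i); rewrite visits_in visits_rev subr0 => <-; ring.
Qed.

(** Successive darts share their left face after a left turn and their right face after a right
    turn, and the two values at a dart always differ by 1. *)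
Lemma wind_left (i : nat) : wind (left_face (d i)) = wind (left_face a).
Proof.
elim: i => // i <-; have := wind_left_right i.+1.
rewrite iterS next_dartE; case: ifP => _; first by rewrite left_face_turn_left.
by rewrite right_face_turn_right -wind_left_right.
Qed.

(** The substitute for the Jordan curve theorem: crossing an edge off the loop changes nothing, and
    crossing an edge of the loop exchanges the values on its two sides. *)
Lemma wind_values (f : face) :
  wind f = wind (left_face a) \/ wind f = wind (left_face a) - 1.
Proof.
set c := wind (left_face a).
have step b : (wind (left_face b) = c \/ wind (left_face b) = c - 1) ->
              (wind (right_face b) = c \/ wind (right_face b) = c - 1).
  have := wind_step b.
  have [[i li Eb]|->] := visitsP b.
    have := wind_left_right i; rewrite wind_left Eb -/c; lia.
  have [[i li Eb]|->] := visitsP (rev_dart b); last by lia.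
  by move=> _ _; left; rewrite /right_face Eb wind_left.
by apply: (@face_ind (fun f => wind f = c \/ wind f = c - 1) (left_face a)) => //; left.
Qed.

End Orbit.

(** * Hopf's Umlaufsatz for loops *)

Definition delta (d : dir) : int * int :=
  match d with
  | East => (1, 0) | North => (0, 1) | West => (- 1, 0) | South => (0, - 1)
  end.

(** Coordinates are doubled to remain integers. A loop may pass twice through a vertex but not
    through a midpoint, so that the midpoints form the simple polygon needed in Hopf's argument. *)
Definition midpoint (a : dart) : int * int :=
  (2 * a.1.1 + (delta a.2).1, 2 * a.1.2 + (delta a.2).2).

Definition turn (w : config) (a : dart) : int :=
  if turns_left w a then 1 else - 1.

(* The signed number of crossings of the positive half of the first axis by a
   diagonal step from v to v'. *)
Definition crossing (v v' : int * int) : int :=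
  [&& v.2 == - 1, v'.2 == 0 & 0 < v'.1]%:R
  - [&& v.2 == 0, v'.2 == - 1 & 0 < v.1]%:R.

Definition diagonal (u : int * int) : Prop :=
  (u.1 = 1 \/ u.1 = - 1) /\ (u.2 = 1 \/ u.2 = - 1).

Definition nonzero (v : int * int) : bool := (v.1 != 0) || (v.2 != 0).

Lemma crossing_up (p q p' : int) :
  crossing (p, q) (p', q + 1) = ((q == - 1) && (0 < p'))%:R.
Proof. by rewrite /crossing /=; lia. Qed.

Lemma crossing_down (p q p' : int) :
  crossing (p, q) (p', q - 1) = - ((q == 0) && (0 < p))%:R.
Proof. by rewrite /crossing /=; lia. Qed.

Lemma crossing_up' (p q p' : int) :
  crossing (p, q - 1) (p', q) = ((q == 0) && (0 < p'))%:R.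
Proof. by rewrite /crossing /=; lia. Qed.

Lemma crossing_down' (p q p' : int) :
  crossing (p, q + 1) (p', q) = - ((q == - 1) && (0 < p))%:R.
Proof. by rewrite /crossing /=; lia. Qed.

(** Unless it degenerates, the square with these corners has a centre with odd coordinate sum. As no
    corner is the origin either, the origin is not enclosed, and both ways from [v] to the opposite
    corner cross the half-axis equally often. *)
Lemma crossing_square (v s t : int * int) (k : int) :
  diagonal s -> diagonal t -> v.1 + v.2 = 2 * k ->
  nonzero v -> nonzero (v + s) -> nonzero (v + t) -> nonzero (v + s + t) ->
  crossing v (v + s) + crossing (v + s) (v + s + t) =
  crossing v (v + t) + crossing (v + t) (v + s + t).
Proof.
case: v s t => [v1 v2] [s1 s2] [t1 t2] [/= hs1 hs2] [/= ht1 ht2] /=.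
have addE (x y x' y' : int) : (x, y) + (x', y') = (x + x', y + y') by [].
rewrite !addE /nonzero /= => E n1 n2 n3 n4; move: n1 n2 n3 n4.
case: hs2 => ->; case: ht2 => ->; rewrite ?[v2 + 1 - 1]addrK ?[v2 - 1 + 1]subrK.
- rewrite !crossing_up (addrAC v1 s1) => n1 n2 n3 n4; congr (_ + _).
  have [Ev|//] := eqVneq v2 (- 1); rewrite /=.
  by case: hs1 n2 => ->; case: ht1 n3 => -> n2 n3; congr (nat_of_bool _)%:R; lia.
- rewrite crossing_up crossing_down' crossing_down crossing_up' subrr.
  move=> n1 n2 n3 n4; have [Ev|] := eqVneq v2 0; last by rewrite subr0.
  apply/esym/eqP; rewrite addrC subr_eq0 /=; apply/eqP; congr (nat_of_bool _)%:R.
  by case: hs1 n4 => ->; case: ht1 => -> n4; lia.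
- rewrite crossing_up crossing_down' crossing_down crossing_up' subrr.
  move=> n1 n2 n3 n4; have [Ev|] := eqVneq v2 0; last by rewrite subr0.
  apply/eqP; rewrite addrC subr_eq0 /=; apply/eqP; congr (nat_of_bool _)%:R.
  by case: hs1 n4 => ->; case: ht1 => -> n4; lia.
- rewrite !crossing_down => n1 n2 n3 n4; congr (- _ + - _).
  have [Ev|//] := eqVneq (v2 - 1) 0; rewrite /=.
  by case: hs1 n2 => ->; case: ht1 n3 => -> n2 n3; congr (nat_of_bool _)%:R; lia.
Qed.

Lemma neq_mid_nonzero (v v' : int * int) : v != v' -> nonzero (v - v').
Proof. by case: v v' => [p q] [p' q']; rewrite /nonzero /= xpair_eqE; lia. Qed.

Lemma diagonalN (u : int * int) : diagonal u -> diagonal (- u).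
Proof.
case: u => p q [/= [] -> [] ->]; split; rewrite /= ?opprK; tauto.
Qed.

Lemma crossing_nneg (v v' : int * int) :
  0 <= v.2 -> 0 <= v'.2 -> crossing v v' = 0.
Proof. rewrite /crossing; lia. Qed.

Lemma crossing_npos (v v' : int * int) :
  v.2 < 0 \/ (v.2 = 0 /\ v.1 < 0) -> v'.2 < 0 \/ (v'.2 = 0 /\ v'.1 < 0) ->
  crossing v v' = 0.
Proof. rewrite /crossing; lia. Qed.

(* The discrete Hopf argument: the total rotation of the edge vectors of a
   closed path with distinct vertices is computed by deforming the diagonal
   j = i + 1 of the triangle of chords m j - m i to its two other sides, which
   contribute nothing when m 0 is an extreme point. *)
Lemma hopf_sum (m : nat -> int * int) (n : nat) :
  (forall i, diagonal (m i.+1 - m i)) ->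
  (forall i, exists k, (m i).1 + (m i).2 = 2 * k + 1) ->
  (forall i j, (i < j < n)%N -> m i != m j) ->
  m n = m 0%N -> m n.+1 = m 1%N -> (2 < n)%N ->
  (forall i, (0 < i < n)%N -> (m 0%N).2 < (m i).2 \/
     ((m 0%N).2 = (m i).2 /\ (m 0%N).1 < (m i).1)) ->
  let c (i i' j j' : nat) := crossing (m j - m i) (m j' - m i') in
  \sum_(i < n) (c i i i.+1 i.+2 + c i i.+1 i.+2 i.+2) =
  c 0%N 1%N n.-1 n.-1 + c 1%N 1%N n.-1 n +
  (c n.-1 n.-1 n n.+1 + c n.-1 n n.+1 n.+1).
Proof.
case: n => [|[|[|k]]] // diag par dist m0 m1 _ low c.
(* Chords form a grid: [h] moves the end of a chord by one vertex, [g] moves its start. *)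
pose h i j := c i i j j.+1; pose g i j := c i i.+1 j j.
have nz i j : (i < j <= k.+3)%N -> (0 < i)%N || (j < k.+3)%N ->
    nonzero (m j - m i).
  move=> lij nij; apply: neq_mid_nonzero; rewrite eq_sym.
  have [Ej|nj] := eqVneq j k.+3; last by apply: dist; lia.
  by rewrite Ej m0 eq_sym; apply: dist; lia.
(* The deformation across one square of the grid. The square with corner (0, n) is excluded because
   the chord from [m 0] to [m n] is zero; hence the detour over 1 and n - 1 in the statement. *)
have sq i j : (i.+1 < j)%N -> (j < k.+3)%N -> (0 < i)%N || (j.+1 < k.+3)%N ->
    h i j + g i j.+1 = g i j + h i.+1 j.
  move=> lij lj nij; rewrite /h /g /c.
  have Es : m j.+1 - m i = (m j - m i) + (m j.+1 - m j) by ring.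
  have Et : m j - m i.+1 = (m j - m i) + - (m i.+1 - m i) by ring.
  have Est : m j.+1 - m i.+1 =
    (m j - m i) + (m j.+1 - m j) + - (m i.+1 - m i) by ring.
  have [ki Ei] := par i; have [kj Ej] := par j.
  have N1 := nz i j ltac:(lia) ltac:(lia).
  have N2 := nz i j.+1 ltac:(lia) ltac:(lia).
  have N3 := nz i.+1 j ltac:(lia) ltac:(lia).
  have N4 := nz i.+1 j.+1 ltac:(lia) ltac:(lia).
  move: N2 N3 N4; rewrite Es Et Est => N2 N3 N4.
  apply: (@crossing_square _ _ _ (kj - ki)) => //; last first.
    rewrite /=; lia.
  exact: diagonalN.
have strip i0 l j : (i0 + l < j)%N -> (j < k.+3)%N ->
    (0 < i0)%N || (j.+1 < k.+3)%N ->
    \sum_(i < l) (g (i0 + i)%N j - g (i0 + i)%N j.+1) = h i0 j - h (i0 + l)%N j.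
  elim: l => [|l IHl] lj jn nij; first by rewrite big_ord0 addn0 subrr.
  rewrite big_ord_recr /= IHl //; last by lia.
  have := sq (i0 + l)%N j ltac:(lia) jn ltac:(lia).
  by rewrite addnS => E; lia.
have stair l : (l <= k.+1)%N ->
    \sum_(i < l) (h i i.+1 + g i i.+2) =
    \sum_(j < l) h 0%N j.+1 + \sum_(i < l) g i l.+1.
  elim: l => [|l IHl] lk; first by rewrite !big_ord0.
  rewrite !big_ord_recr /= IHl; last by lia.
  have := strip 0%N l l.+1 ltac:(lia) ltac:(lia) ltac:(lia).
  rewrite sumrB /= add0n => E.
  have {}E : \sum_(i < l) g i l.+1 =
      h 0%N l.+1 - h l l.+1 + \sum_(i < l) g i l.+2 by rewrite -E; ring.
  by rewrite E; ring.
rewrite 2!big_ord_recr [LHS]/= -/(h _ _) -/(g _ _) -/(h _ _) -/(g _ _).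
rewrite (stair k.+1) // (big_ord_recl k (fun i : 'I_k.+1 => g i k.+2)) /=.
have := strip 1%N k k.+2 ltac:(lia) ltac:(lia) ltac:(lia).
rewrite sumrB /= => E.
have -> : \sum_(i < k) g (bump 0 i) k.+2 = \sum_(i < k) g (1 + i)%N k.+2 by [].
have {}E : \sum_(i < k) g (1 + i)%N k.+2 = h 1%N k.+2 - h (1 + k)%N k.+2 +
      \sum_(i < k) g (1 + i)%N k.+3 by rewrite -E; ring.
(* Chords from the extreme point [m 0] stay in the closed upper half-plane, and chords to it point
   downwards or to the left, so that no step between two of them crosses the half-axis. *)
have h0 : \sum_(j < k.+1) h 0%N j.+1 = 0.
  apply: big1 => j _; have lj := ltn_ord j; apply: crossing_nneg => /=.
    have := low j.+1 ltac:(lia); lia.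
  have := low j.+2 ltac:(lia). lia.
have g0 : \sum_(i < k) g (1 + i)%N k.+3 + g k.+1 k.+3 = 0.
  rewrite -(big_ord_recr k (fun i : 'I_k.+1 => g (1 + i)%N k.+3)).
  apply: big1 => j _; have lj := ltn_ord j; rewrite /g /c m0.
  have := low (1 + j)%N (ltnW lj); have := low (1 + j).+1 lj => l1 l2.
  by apply: crossing_npos => /=; lia.
rewrite h0 E add1n -[c 0%N _ _ _]/(g 0%N k.+2) -[c 1%N _ _ _]/(h 1%N k.+2).
apply/eqP; rewrite -subr_eq0 -[X in _ == X]g0; apply/eqP; ring.
Qed.

Section Umlaufsatz.
Variables (w : config) (a : dart) (n : nat).
Local Notation d i := (iter i (next_dart w) a).
Hypothesis per : d n = a.
Hypothesis n_gt0 : (0 < n)%N.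
Hypothesis nmin : forall m, (0 < m < n)%N -> d m != a.

Lemma midpoint_step (i : nat) : midpoint (d i.+1) - midpoint (d i) =
  delta (d i).2 + delta (d i.+1).2.
Proof.
rewrite iterS next_dartE; case: (d i) => [[x y] e]; rewrite /midpoint /=.
by case: ifP => _; case: e => /=; congr pair; rewrite /=; ring.
Qed.

Lemma midpoint_diagonal (i : nat) : diagonal (midpoint (d i.+1) - midpoint (d i)).
Proof.
rewrite midpoint_step iterS next_dartE; case: (d i) => [[x y] e] /=.
by rewrite /diagonal; case: ifP => _; case: e => /=; lia.
Qed.

Lemma midpoint_odd (i : nat) :
  exists k, (midpoint (d i)).1 + (midpoint (d i)).2 = 2 * k + 1.
Proof.
case: (d i) => [[x y] e]; rewrite /midpoint; case: e => /=.
- by exists (x + y); ring.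
- by exists (x + y); ring.
- by exists (x + y - 1); ring.
- by exists (x + y - 1); ring.
Qed.

(** The midpoint determines the edge, and the colour of the left face its direction. *)
Lemma midpoint_inj (b c : dart) : midpoint b = midpoint c ->
  is_primal (left_face b) = is_primal (left_face c) -> b = c.
Proof.
move: b c => [[x y] e] [[x' y'] e']; rewrite /midpoint /is_primal.
case: e; case: e' => /= -[E1 E2] Ep; try (exfalso; lia);
  by congr pair; congr pair; lia.
Qed.

Lemma midpoint_neq (i j : nat) : (i < j < n)%N -> midpoint (d i) != midpoint (d j).
Proof.
move=> /andP[lij ljn]; apply/eqP => /midpoint_inj; rewrite !primal_iter => /(_ erefl).
move=> /(iter_period_inj n_gt0 nmin (ltn_trans lij ljn) ljn) E.
by rewrite E ltnn in lij.
Qed.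

Lemma period_gt2 : (2 < n)%N.
Proof.
have nz i : midpoint (d i.+1) != midpoint (d i).
  apply/eqP => E; have := midpoint_diagonal i; rewrite E /diagonal /=; lia.
move: n per n_gt0 => [|[|[|m]]] // p _; first by have := nz 0%N; rewrite p eqxx.
have := midpoint_diagonal 0%N.
have := midpoint_step 0%N; have := midpoint_step 1%N; rewrite p /= => E1 E0.
have : midpoint (next_dart w a) - midpoint a = - (midpoint (next_dart w a) - midpoint a).
  by rewrite opprB E1 E0 addrC.
case: (_ - _) => u v; rewrite /diagonal /= => -[Eu Ev]; lia.
Qed.

Definition lowest : Prop := forall i, (0 < i < n)%N ->
  (midpoint a).2 < (midpoint (d i)).2 \/
  ((midpoint a).2 = (midpoint (d i)).2 /\ (midpoint a).1 < (midpoint (d i)).1).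

(* The direction of a diagonal step, in eighths of a turn. *)
Definition octant (u : int * int) : int :=
  if u.2 == 1 then (if u.1 == 1 then 0 else 2) else (if u.1 == 1 then 6 else 4).

(** The diagonal [u] bisects two successive darts, so that passing from [u] to [u'] rotates by half
    the sum of two quarter turns, which is that sum counted in eighths. The crossing term makes up
    for the jump of [octant] between 6 and 0. *)
Lemma turn_octant (b : dart) :
  let b' := next_dart w b in let b'' := next_dart w b' in
  let u := delta b.2 + delta b'.2 in let u' := delta b'.2 + delta b''.2 in
  turn w b + turn w b' = octant u' - octant u +
    8 * (crossing u (u + u') + crossing (u + u') u').
Proof.
rewrite /turn !next_dartE [in X in X.2]/=.
set b' := (target b, _); move: (turns_left w b') => t2; rewrite {}/b' /=.
by case: (turns_left w b); case: t2; case: (b.2).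
Qed.

(** Each turn is counted twice by [turn_octant], and the octants cancel around the loop. *)
Lemma sum_turns : 2 * \sum_(i < n) turn w (d i) = 8 * \sum_(i < n)
  (crossing (midpoint (d i.+1) - midpoint (d i)) (midpoint (d i.+2) - midpoint (d i))
   + crossing (midpoint (d i.+2) - midpoint (d i))
       (midpoint (d i.+2) - midpoint (d i.+1))).
Proof.
pose u i := delta (d i).2 + delta (d i.+1).2.
have -> : 2 * \sum_(i < n) turn w (d i) =
    \sum_(i < n) (turn w (d i) + turn w (d i.+1)).
  by rewrite big_split /= (sum_cycle per) mulr_natl mulr2n.
have -> : \sum_(i < n) (turn w (d i) + turn w (d i.+1)) =
  \sum_(i < n) (octant (u i.+1) - octant (u i) +
    8 * (crossing (u i) (u i + u i.+1) + crossing (u i + u i.+1) (u i.+1))).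
  by apply: eq_bigr => i _; exact: turn_octant.
rewrite big_split /= sumrB.
have := sum_cycle per (fun b => octant (delta b.2 + delta (next_dart w b).2)).
rewrite /u /= => ->; rewrite subrr add0r mulr_sumr; apply: eq_bigr => i _.
rewrite !midpoint_step; congr (8 * _).
have -> : midpoint (d i.+2) - midpoint (d i) =
  (midpoint (d i.+1) - midpoint (d i)) + (midpoint (d i.+2) - midpoint (d i.+1)).
  by ring.
by rewrite !midpoint_step.
Qed.

(** Midpoint steps being diagonal, both neighbours of the extreme midpoint lie strictly above it,
    which leaves only a horizontal dart between a descent and an ascent. *)
Lemma lowest_next : lowest ->
  ((d n.-1).2 = South /\ (d 1).2 = North) /\ (a.2 = East \/ a.2 = West).
Proof.
have n2 := period_gt2; move=> low.
have := low 1%N ltac:(lia); have := low n.-1 ltac:(lia).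
have Ep : next_dart w (d n.-1) = a by rewrite -iterS prednK.
have := midpoint_step n.-1; have := midpoint_step 0%N.
rewrite [d n.-1.+1]Ep [d 1]/= [d 0]/=.
have : (next_dart w a).2 = left_of a.2 \/ (next_dart w a).2 = right_of a.2.
  by rewrite next_dartE /=; case: ifP; [left|right].
have : a.2 = left_of (d n.-1).2 \/ a.2 = right_of (d n.-1).2.
  by rewrite -{1 3}Ep next_dartE /=; case: ifP; [left|right].
case: (midpoint a) (midpoint (next_dart w a)) (midpoint (d n.-1)) => [p q] [p' q'] [p'' q''].
case: (a.2); case: ((d n.-1).2) => -[] // _; case: ((next_dart w a).2) => -[] // _ /=;
  move=> [E1 E2] [E3 E4] L1 L2; try (exfalso; lia); auto.
Qed.

Lemma lowest_sum_turns : lowest ->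
  (a.2 = East /\ \sum_(i < n) turn w (d i) = 4) \/
  (a.2 = West /\ \sum_(i < n) turn w (d i) = - 4).
Proof.
move=> low; have [[Sp Nn] Ea] := lowest_next low.
have n2 := period_gt2; have Ep : d n.-1.+1 = a by rewrite prednK.
have per1 : d n.+1 = d 1 by rewrite iterS per.
have := @hopf_sum (fun i => midpoint (d i)) n midpoint_diagonal midpoint_odd
  midpoint_neq (congr1 midpoint per) (congr1 midpoint per1) n2 low.
cbv beta zeta => H; have := sum_turns; rewrite {}H.
have U0 : midpoint (d 1) - midpoint (d 0) = delta a.2 + delta North.
  by rewrite midpoint_step Nn.
have U1 : midpoint (d n) - midpoint (d n.-1) = delta South + delta a.2.
  by have := midpoint_step n.-1; rewrite prednK // per Sp.
have -> : midpoint (d n.+1) - midpoint (d n.-1) =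
    (delta South + delta a.2) + (delta a.2 + delta North).
  by rewrite -U0 -U1 per1 [d 0]/= per; ring.
have -> : midpoint (d n.+1) - midpoint (d n) = delta a.2 + delta North.
  by rewrite -U0 per1 per.
have -> : midpoint (d n.-1) - midpoint (d 1) =
    - (delta South + delta a.2) - (delta a.2 + delta North).
  by rewrite -U0 -U1 [d 0]/= per; ring.
have -> : midpoint (d n.-1) - midpoint (d 0) = - (delta South + delta a.2).
  by rewrite -U1 [d 0]/= per; ring.
have -> : midpoint (d n) - midpoint (d 1) = - (delta a.2 + delta North).
  by rewrite -U0 [d 0]/= per; ring.
(* All remaining chords are combinations of South, the direction of [a] and North, so that the
   crossings can be computed for each of the two directions. *)
rewrite U1; move: (\sum_(i < n) _) => T.
case: Ea => ->; rewrite /crossing /= => E; [left|right]; split=> //.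
  apply: (@mulfI _ 2) => //; rewrite E; reflexivity.
apply: (@mulfI _ 2) => //; rewrite E; reflexivity.
Qed.

End Umlaufsatz.

(** * Area, winding numbers and total rotation of a loop *)

Lemma box_sum_ge (F : face -> int) (M : nat) (f : face) :
  (forall g, 0 <= F g) -> `|f.1| < M%:Z -> `|f.2| < M%:Z ->
  F f <= \sum_(i < 2 * M) \sum_(j < 2 * M) F (i%:Z - M%:Z, j%:Z - M%:Z).
Proof.
case: f => x y /= pos lx ly.
have li : (absz (x + M%:Z)%R < 2 * M)%N by lia.
have lj : (absz (y + M%:Z)%R < 2 * M)%N by lia.
have term_le (m i : nat) (G : nat -> int) : (i < m)%N -> (forall k, 0 <= G k) ->
    G i <= \sum_(k < m) G k.
  move=> lim G0; rewrite (bigD1 (Ordinal lim)) //=.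
  by apply: ler_wpDr => //; apply: sumr_ge0.
have Ex : (absz (x + M%:Z))%:Z - M%:Z = x by lia.
have Ey : (absz (y + M%:Z))%:Z - M%:Z = y by lia.
apply: le_trans (term_le _ _ (fun i => \sum_(j < 2 * M) F (i%:Z - M%:Z, j%:Z - M%:Z))
  li _); last by move=> k; apply: sumr_ge0.
rewrite Ex; apply: le_trans (term_le _ _ (fun j => F (x, j%:Z - M%:Z)) lj _) => //.
by rewrite Ey.
Qed.

Section LoopSign.
Variables (w : config) (a : dart) (n : nat).
Local Notation d i := (iter i (next_dart w) a).
Hypothesis per : d n = a.
Hypothesis n_gt0 : (0 < n)%N.
Hypothesis nmin : forall m, (0 < m < n)%N -> d m != a.

Lemma sum_shift (F : dart -> int) (k : nat) :
  \sum_(i < n) F (iter i (next_dart w) (d k)) = \sum_(i < n) F (d i).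
Proof.
have perV (b : dart) : iter n (next_dart w) b = b ->
    \sum_(i < n) F (iter i.+1 (next_dart w) b) =
    \sum_(i < n) F (iter i (next_dart w) b).
  move=> pb; rewrite -(big_mkord xpredT (fun i => F (iter i.+1 (next_dart w) b))).
  rewrite -(big_mkord xpredT (fun i => F (iter i (next_dart w) b))).
  case: n pb => [_|m pm]; first by rewrite !big_geq.
  rewrite big_nat_recr //= big_nat_recl //= addrC.
  by congr (F _ + _); exact: pm.
elim: k => // k <-; rewrite -[RHS]perV; last by rewrite -iterD addnC iterD per.
by apply: eq_bigr => i _; rewrite -!iterD addnS.
Qed.

Lemma wind_shift (k : nat) (f : face) : wind w (d k) n f = wind w a n f.
Proof.
rewrite /wind; exact: (@sum_shift (fun b : dart => vert b * ((f.1 < b.1.1) && (dart_row b == f.2))%:R) k).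
Qed.

Lemma period_shift (k : nat) : iter n (next_dart w) (d k) = d k.
Proof. by rewrite -iterD addnC iterD per. Qed.

Lemma min_shift (k m : nat) : (0 < m < n)%N ->
  iter m (next_dart w) (d k) != d k.
Proof.
move=> lm; apply/eqP; rewrite -iterD addnC iterD => /iter_next_inj E.
by have /eqP := nmin lm.
Qed.

Lemma exists_lowest : exists k, lowest w (d k) n.
Proof.
pose le (u v : int * int) := (u.2 < v.2) || ((u.2 == v.2) && (u.1 <= v.1)).
have [k low] : exists k, forall i, (i < n)%N -> le (midpoint (d k)) (midpoint (d i)).
  elim: n => [|m [k IHk]]; first by exists 0%N.
  have [lk|lk] := boolP (le (midpoint (d k)) (midpoint (d m))).
    by exists k => i; rewrite ltnS leq_eqVlt => /orP[/eqP->|/IHk].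
  exists m => i; rewrite ltnS leq_eqVlt => /orP[/eqP->|/IHk].
    by rewrite /le eqxx lexx orbT.
  by move: lk; rewrite /le; lia.
exists k => i lin.
have := @midpoint_neq w (d k) n n_gt0 (@min_shift k) 0 i ltac:(lia).
have := low ((i + k) %% n)%N (ltn_pmod _ n_gt0).
have -> : d ((i + k) %% n)%N = d (i + k).
  have Ed (j r : nat) : d (r + j * n)%N = d r.
    by elim: j => [|j IHj]; rewrite ?addn0 // mulSn addnCA addnC iterD per.
  by rewrite -(Ed ((i + k) %/ n)%N) [((i + k) %% n + _)%N]addnC -divn_eq.
rewrite -!iterD add0n /le; case: (midpoint (d k)) (midpoint (d (i + k))) => [p q] [p' q'].
rewrite xpair_eqE /=; lia.
Qed.

(** The face below a lowest dart has winding number 0. It is on the right if the dart points East,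
    when the total rotation is 4, and on the left if it points West. *)
Lemma wind_turns :
  (wind w a n (left_face a) = 1 /\ \sum_(i < n) turn w (d i) = 4) \/
  (wind w a n (left_face a) = 0 /\ \sum_(i < n) turn w (d i) = - 4).
Proof.
have [k low] := exists_lowest.
have below (x y : int) : (midpoint (d k)).2 = 2 * y -> wind w (d k) n (x, y - 1) = 0.
  move=> Ey; apply: big1 => i _; have li := ltn_ord i.
  have : (midpoint (d k)).2 <= (midpoint (iter i (next_dart w) (d k))).2.
    case: (posnP i) => [->//|i0]; have := low i ltac:(lia); lia.
  rewrite Ey; case: (iter i _ _) => [[u v] e]; rewrite /vert /dart_row /midpoint.
  by case: e => /=; rewrite ?mul0r // => lq; lia.
have := lowest_sum_turns (period_shift k) n_gt0 (@min_shift k) low.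
rewrite (sum_shift (turn w)) -(wind_left per n_gt0 nmin k).
have := wind_left_right per n_gt0 nmin k.
rewrite -!(wind_shift k) => Ewind [] [Ed ->]; [left|right]; split=> //.
  rewrite Ewind; move: below; case: (d k) Ed => [[x y] e] /= -> below.
  by rewrite /right_face /= below ?add0r // /midpoint /= addr0.
move: below; case: (d k) Ed => [[x y] e] /= -> below.
by rewrite below // /midpoint /= addr0.
Qed.

(** A discrete form of Green's theorem: x + M columns of the box lie to the left of a vertical dart
    at abscissa x, and the M cancels because the loop returns to its height. *)
Lemma signed_area_wind (M : nat) :
  (forall i, (i < n)%N -> (`|(d i).1.1| < M)%N /\ (`|dart_row (d i)| < M)%N) ->
  signed_area w a n = \sum_(i < 2 * M) \sum_(j < 2 * M)
    wind w a n (i%:Z - M%:Z, j%:Z - M%:Z).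
Proof.
move=> bnd; rewrite (eq_bigr (fun i : 'I_(2 * M) => \sum_(k < n) \sum_(j < 2 * M)
  vert (d k) * ((i%:Z - M%:Z < (d k).1.1) && (dart_row (d k) == j%:Z - M%:Z))%:R)); last first.
  by move=> i _; rewrite exchange_big.
rewrite exchange_big /=.
have count (m : nat) (z : int) : \sum_(i < m) (i%:Z - M%:Z < z)%R%:R =
    (if z + M%:Z <= 0 then 0 else if z + M%:Z <= m%:Z then z + M%:Z else m%:Z).
  elim: m => [|m IHm]; first by rewrite big_ord0; case: ifP => // H1; case: ifP => // H2; lia.
  by rewrite big_ord_recr /= IHm; do !case: ifP; lia.
have count1 (m : nat) (z : int) : \sum_(j < m) (z == j%:Z - M%:Z)%R%:R =
    ((0 <= z + M%:Z) && (z + M%:Z < m%:Z))%:R :> int.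
  elim: m => [|m IHm]; first by rewrite big_ord0; lia.
  by rewrite big_ord_recr /= IHm; lia.
transitivity (\sum_(k < n) vert (d k) * ((d k).1.1 + M%:Z)).
  have /= := sum_vertex_cycle per (fun z : vertex => z.2 * M%:Z) => V0.
  rewrite /signed_area -[LHS]addr0 -[X in _ + X = _]V0 -big_split; apply: eq_bigr => k _ /=.
  case: (d k) => [[x y] e]; rewrite /x_dy /vert /=; case: e => /=; ring.
apply: eq_bigr => k _; have [bx br] := bnd k (ltn_ord k).
transitivity (\sum_(i < 2 * M) vert (d k) * (i%:Z - M%:Z < (d k).1.1)%R%:R); last first.
  apply: eq_bigr => i _.
  have E1 : \sum_(j < 2 * M) (dart_row (d k) == j%:Z - M%:Z)%R%:R = 1 :> int.
    by rewrite count1 (_ : _ && _ = true) //; lia.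
  rewrite -[LHS]mulr1 -[X in _ * X = _]E1 mulr_sumr; apply: eq_bigr => j _.
  by rewrite -mulrA; congr (_ * _); case: (_ < _); case: (_ == _).
rewrite -mulr_sumr count; congr (_ * _); case: ifP => [|_]; last case: ifP; lia.
Qed.

(** The area is the sum of the winding numbers. These are all 0 or 1 in the first case, all 0 or - 1
    in the second, and the nonzero value occurs on one side of [a]. *)
Lemma loop_sign :
  [/\ wind w a n (left_face a) = 1, \sum_(i < n) turn w (d i) = 4 &
      0 < signed_area w a n] \/
  [/\ wind w a n (left_face a) = 0, \sum_(i < n) turn w (d i) = - 4 &
      signed_area w a n < 0].
Proof.
pose M := (\sum_(i < n) (`|(d i).1.1| + `|(d i).1.2| + 2))%N.
have bM (i : nat) : (i < n)%N -> (`|(d i).1.1| + `|(d i).1.2| + 2 <= M)%N.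
  by move=> li; rewrite /M (bigD1 (Ordinal li)) //= leq_addr.
have area := @signed_area_wind M _.
have {}area : signed_area w a n = \sum_(i < 2 * M) \sum_(j < 2 * M)
    wind w a n (i%:Z - M%:Z, j%:Z - M%:Z).
  apply: area => i li; have := bM i li; case: (d i) => [[x y] e].
  by rewrite /dart_row; case: e => /=; lia.
have := bM 0 n_gt0; rewrite /= => b0.
have ca := wind_left_right per n_gt0 nmin 0; rewrite /= in ca.
have vals := wind_values per n_gt0 nmin.
have [[c T]|[c T]] := wind_turns; [left|right]; split=> //.
  rewrite area; apply: lt_le_trans (box_sum_ge (f := left_face a) _ _ _) => //=.
  - by rewrite c.
  - by move=> g; have := vals g; rewrite c => -[] ->.
  - by move: b0; case: (a) => [[x y] []] /=; lia.
  - by move: b0; case: (a) => [[x y] []] /=; lia.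
have cr : wind w a n (right_face a) = - 1 by lia.
rewrite -oppr_gt0 area -sumrN; under eq_bigr do rewrite -sumrN.
apply: lt_le_trans (box_sum_ge (F := fun g => - wind w a n g)
  (f := right_face a) _ _ _) => //=.
- by rewrite cr.
- by move=> g; have := vals g; rewrite c => -[] ->.
- by move: b0; case: (a) => [[x y] []] /=; lia.
- by move: b0; case: (a) => [[x y] []] /=; lia.
Qed.

End LoopSign.

(** * The sense of a loop, and its reversal *)

Definition periodic (w : config) (a : dart) : Prop :=
  exists n, (0 < n)%N /\ iter n (next_dart w) a = a.

Lemma min_period (w : config) (a : dart) : periodic w a -> exists n,
  [/\ (0 < n)%N, iter n (next_dart w) a = a &
      forall m, (0 < m < n)%N -> iter m (next_dart w) a != a].
Proof.
case=> n0 [n0_gt0 per0].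
have ex : exists n, (0 < n)%N && (iter n (next_dart w) a == a).
  by exists n0; rewrite n0_gt0 per0 eqxx.
case: (ex_minnP ex) => n /andP[n_gt0 /eqP per] nmin; exists n; split=> // m.
case/andP=> m_gt0 lmn; apply/negP => Em; have := nmin m.
by rewrite m_gt0 Em /= => /(_ isT); rewrite leqNgt lmn.
Qed.

Lemma signed_area_cat (w : config) (a : dart) (m n : nat) :
  iter m (next_dart w) a = a ->
  signed_area w a (m + n) = signed_area w a m + signed_area w a n.
Proof.
move=> per; rewrite /signed_area big_split_ord /=; congr (_ + _).
by apply: eq_bigr => i _; rewrite addnC iterD per.
Qed.

Lemma signed_area_mul (w : config) (a : dart) (m k : nat) :
  iter m (next_dart w) a = a -> signed_area w a (k * m) = signed_area w a m *+ k.
Proof.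
move=> per; elim: k => [|k IHk].
  by rewrite mul0n mulr0n /signed_area big_ord0.
by rewrite mulSn signed_area_cat // IHk mulrS.
Qed.

Lemma period_dvd (w : config) (a : dart) (n m : nat) :
  (0 < n)%N -> iter n (next_dart w) a = a ->
  (forall m, (0 < m < n)%N -> iter m (next_dart w) a != a) ->
  iter m (next_dart w) a = a -> m = (m %/ n * n)%N.
Proof.
move=> n_gt0 per nmin perm; have := divn_eq m n.
have Ek k : iter (k * n) (next_dart w) a = a.
  by elim: k => // k IHk; rewrite mulSn iterD IHk.
case: (posnP (m %% n)) => [->|r_gt0 E]; first by rewrite addn0.
have /eqP[] := nmin (m %% n)%N ltac:(by rewrite r_gt0 ltn_pmod).
by rewrite -[in RHS]perm [in RHS]E addnC iterD Ek.
Qed.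

Section Acw.
Variables (w : config) (a : dart) (n : nat).
Hypothesis per : iter n (next_dart w) a = a.
Hypothesis n_gt0 : (0 < n)%N.
Hypothesis nmin : forall m, (0 < m < n)%N -> iter m (next_dart w) a != a.

Lemma anticlockwiseE : anticlockwise w a <-> wind w a n (left_face a) = 1.
Proof.
split=> [[m [m_gt0 perm]]|c1].
  have Em := period_dvd n_gt0 per nmin perm.
  rewrite Em signed_area_mul //; have [[]//|[_ _ neg]] := loop_sign per n_gt0 nmin.
  by rewrite ltNge mulrn_wle0 // ltW.
exists n; split=> //; have [[]//|[c0]] := loop_sign per n_gt0 nmin.
by rewrite c1 in c0.
Qed.

Lemma clockwiseE : clockwise w a <-> wind w a n (left_face a) <> 1.
Proof.
split=> [[m [m_gt0 perm]]|c1].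
  have Em := period_dvd n_gt0 per nmin perm.
  rewrite Em signed_area_mul //; have [[_ _ pos]|[-> //]] := loop_sign per n_gt0 nmin.
  by rewrite ltNge mulrn_wge0 // ltW.
by exists n; split=> //; have [[]//|[]] := loop_sign per n_gt0 nmin.
Qed.

End Acw.

Lemma next_rev (w : config) (a : dart) :
  next_dart w (rev_dart (next_dart w a)) = rev_dart a.
Proof.
set b := rev_dart (next_dart w a).
have Et : target b = target a.
  by rewrite /b next_dartE; case: a {b} => [[x y] e]; case: ifP => _; case: e => /=;
  congr pair; lia.
have Ep : is_primal (left_face b) = ~~ is_primal (left_face a).
  by rewrite -[left_face b]/(right_face _) primal_right primal_next.
rewrite next_dartE Et; rewrite /turns_left Ep Et /rev_dart; congr pair.
rewrite /b next_dartE /turns_left; case: (is_primal _); case: (w _) => /=; by case: (a.2).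
Qed.

Lemma iter_rev (w : config) (a : dart) (k : nat) :
  iter k (next_dart w) (rev_dart (iter k (next_dart w) a)) = rev_dart a.
Proof. by elim: k a => //= k IHk a; rewrite -iterS iterSr next_rev IHk. Qed.

Lemma periodic_rev (w : config) (a : dart) : periodic w a -> periodic w (rev_dart a).
Proof.
by case=> n [n_gt0 per]; exists n; split=> //; rewrite -{1}per iter_rev.
Qed.

Lemma signed_area_rev (w : config) (a : dart) (n : nat) :
  iter n (next_dart w) a = a ->
  signed_area w (rev_dart a) n = - signed_area w a n.
Proof.
move=> per; rewrite /signed_area -(sum_cycle per) -sumrN (reindex_inj rev_ord_inj).
apply: eq_bigr => i _ /=; set j := (n - i.+1)%N.
have -> : iter j (next_dart w) (rev_dart a) = rev_dart (iter i.+1 (next_dart w) a).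
  have Ej : (j + i.+1 = n)%N by rewrite subnK.
  by rewrite -{1}per -[in X in rev_dart X]Ej iterD iter_rev.
by rewrite /=; case: (next_dart _ _) => [[x y] []]; rewrite /x_dy //= ?oppr0 ?opprK.
Qed.

Lemma clockwise_rev (w : config) (a : dart) :
  clockwise w (rev_dart a) <-> anticlockwise w a.
Proof.
split=> -[n [n_gt0 per area]]; exists n; split=> //.
- by have := iter_rev w (rev_dart a) n; rewrite per rev_dartK.
- rewrite -(rev_dartK a) signed_area_rev ?oppr_gt0 //.
- by rewrite -{1}per iter_rev.
- by rewrite signed_area_rev // oppr_lt0.
Qed.

Lemma anticlockwise_rev (w : config) (a : dart) :
  anticlockwise w (rev_dart a) <-> clockwise w a.
Proof. by rewrite -(clockwise_rev w (rev_dart a)) rev_dartK. Qed.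

Definition acw (w : config) (a : dart) : bool := `[< anticlockwise w a >].

Lemma acwE (w : config) (a : dart) (n : nat) : iter n (next_dart w) a = a ->
  (0 < n)%N -> (forall m, (0 < m < n)%N -> iter m (next_dart w) a != a) ->
  acw w a = (wind w a n (left_face a) == 1).
Proof.
by move=> per n0 nmin; apply/asboolP/eqP => /(anticlockwiseE per n0 nmin).
Qed.

Lemma clockwise_acw (w : config) (a : dart) : periodic w a ->
  clockwise w a <-> ~~ acw w a.
Proof.
move=> /min_period[n [n_gt0 per nmin]].
rewrite (acwE per n_gt0 nmin) (clockwiseE per n_gt0 nmin).
by split=> [/eqP|/eqP].
Qed.

Lemma backwardE (e : edge) : backward e = rev_dart (forward e).
Proof. by case: e => [[x y] []]. Qed.

(** Of the two darts of an edge exactly one has a primal face on its left. These darts are preserved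
    by [next_dart], run along each loop in a single direction, and serve as the reference for
    orientations. *)
Definition primal_dart (e : edge) : dart :=
  if is_primal (left_face (forward e)) then forward e else backward e.

Lemma primal_primal_dart (e : edge) : is_primal (left_face (primal_dart e)).
Proof.
rewrite /primal_dart; case: ifP => // np.
by rewrite backwardE -[left_face _]/(right_face _) primal_right np.
Qed.

Lemma edge_of_forward (e : edge) : edge_of (forward e) = e.
Proof. by case: e => [[x y] []]. Qed.

Lemma edge_of_rev (a : dart) : edge_of (rev_dart a) = edge_of a.
Proof. by case: a => [[x y] []] /=; congr pair; congr pair; lia. Qed.

Lemma edge_of_primal_dart (e : edge) : edge_of (primal_dart e) = e.
Proof.
by rewrite /primal_dart backwardE; case: ifP; rewrite ?edge_of_rev edge_of_forward.
Qed.

Lemma forward_edge_of (a : dart) :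
  forward (edge_of a) = a \/ forward (edge_of a) = rev_dart a.
Proof.
by case: a => [[x y] []]; [left|left|right|right]; rewrite /forward /rev_dart //=;
  congr pair; congr pair; lia.
Qed.

Lemma primal_dart_edge_of (a : dart) : is_primal (left_face a) ->
  primal_dart (edge_of a) = a.
Proof.
move=> pa; rewrite /primal_dart backwardE.
have [->|->] := forward_edge_of a; first by rewrite pa.
by rewrite -[left_face (rev_dart a)]/(right_face a) primal_right pa rev_dartK.
Qed.

Lemma rev_dart_neq (a : dart) : rev_dart a != a.
Proof.
by apply/eqP => /(congr1 snd) /= /eqP; rewrite (negPf (opp_dir_neq _)).
Qed.

Definition along (s : orientation) (a : dart) : bool := oriented s (edge_of a) == a.

Lemma orientedE (s : orientation) (e : edge) : oriented s e =
  if along s (primal_dart e) then primal_dart e else rev_dart (primal_dart e).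
Proof.
rewrite /along edge_of_primal_dart /primal_dart /oriented backwardE.
case: (s e); case: (is_primal _); rewrite ?eqxx ?rev_dartK //.
  by rewrite eq_sym (negPf (rev_dart_neq _)).
by rewrite (negPf (rev_dart_neq _)).
Qed.

Lemma alongE (s : orientation) (e : edge) :
  along s (primal_dart e) = (s e == is_primal (left_face (forward e))).
Proof.
rewrite /along edge_of_primal_dart /primal_dart /oriented backwardE.
case: (s e); case: (is_primal _); rewrite ?eqxx //.
  by rewrite eq_sym (negPf (rev_dart_neq _)).
by rewrite (negPf (rev_dart_neq _)).
Qed.

(** Coherence transports [along] forwards only; for the converse, the loop is followed further up to
    a multiple of its period. *)
Lemma along_iter (w : config) (s : orientation) (a : dart) (k : nat) :
  coherent w s -> is_primal (left_face a) -> periodic w a ->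
  along s (iter k (next_dart w) a) = along s a.
Proof.
move=> coh pa [n [n_gt0 per]].
have step b : is_primal (left_face b) -> along s b -> along s (next_dart w b).
  move=> pb; rewrite /along => /eqP Eb; have := coh (edge_of b).
  by rewrite Eb /= => ->.
have steps b j : is_primal (left_face b) -> along s b ->
    along s (iter j (next_dart w) b).
  by move=> pb ab; elim: j => //= j IHj; apply: step => //; rewrite primal_iter.
apply/idP/idP => [|/steps -> //].
have perk : iter (n * k - k + k) (next_dart w) a = a.
  rewrite subnK ?leq_pmull //; elim: k => [|k IHk]; first by rewrite muln0.
  by rewrite mulnS iterD IHk.
by rewrite -{2}perk iterD; apply: steps; rewrite primal_iter.
Qed.

Lemma loop_orientedE (w : config) (s : orientation) (e : edge) (b : bool) :
  periodic w (primal_dart e) ->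
  loop_oriented w s e b <-> along s (primal_dart e) = (b == acw w (primal_dart e)).
Proof.
move=> per; have cw := clockwise_acw per; rewrite /loop_oriented orientedE.
have aw : anticlockwise w (primal_dart e) <-> acw w (primal_dart e).
  by split=> /asboolP.
by case: b; case: (along _ _); rewrite ?anticlockwise_rev ?clockwise_rev ?cw ?aw;
  case: (acw _ _); split.
Qed.

Lemma finite_loopE (w : config) (e : edge) :
  finite_loop w e <-> periodic w (primal_dart e).
Proof.
rewrite /primal_dart backwardE; case: ifP => _ //; split; first exact: periodic_rev.
by move=> /periodic_rev; rewrite rev_dartK.
Qed.

(** [loop] follows the forward dart of [e], which may be the reverse of [primal_dart e]. The loop is
    then run backwards, and k steps back are n * k - k steps ahead, n being a period. *)
Lemma loopP (w : config) (e e' : edge) : periodic w (primal_dart e) ->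
  loop w e e' <-> exists k, iter k (next_dart w) (primal_dart e) = primal_dart e'.
Proof.
move=> per; rewrite /loop /=; split.
  case=> k _ Ek; have [p|np] := boolP (is_primal (left_face (forward e))).
    exists k; rewrite -Ek primal_dart_edge_of ?primal_iter // /primal_dart p //.
  have Ep : primal_dart e = rev_dart (forward e).
    by rewrite /primal_dart (negPf np) backwardE.
  have [n [n_gt0 pern]] := per.
  have perk : iter (n * k - k + k) (next_dart w) (forward e) = forward e.
    have per1 : iter n (next_dart w) (forward e) = forward e.
      have := iter_rev w (primal_dart e) n.
      by rewrite pern Ep rev_dartK.
    rewrite subnK ?leq_pmull //; elim: k {Ek} => [|k IHk]; first by rewrite muln0.
    by rewrite mulnS iterD IHk.
  exists (n * k - k)%N; rewrite Ep -{1}perk iterD iter_rev -Ek -edge_of_rev.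
  rewrite primal_dart_edge_of //.
  by rewrite -[left_face _]/(right_face _) primal_right primal_iter.
case=> k Ek; have [p|np] := boolP (is_primal (left_face (forward e))).
  by exists k => //; rewrite -{1}(edge_of_primal_dart e') -Ek /primal_dart p.
have Ep : primal_dart e = rev_dart (forward e).
  by rewrite /primal_dart (negPf np) backwardE.
have [n [n_gt0 pern]] := per.
have perk : iter (n * k - k + k) (next_dart w) (primal_dart e) = primal_dart e.
  rewrite subnK ?leq_pmull //; elim: k {Ek} => [|k IHk]; first by rewrite muln0.
  by rewrite mulnS iterD IHk.
exists (n * k - k)%N => //; have -> : forward e = rev_dart (primal_dart e).
  by rewrite Ep rev_dartK.
by rewrite -{1}perk iterD iter_rev edge_of_rev Ek edge_of_primal_dart.
Qed.

(** * Clusters of finite graphs *)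

Local Open Scope fset_scope.
Local Open Scope ring_scope.

Section AddEdge.
Variables (T : finType) (bd : {set T}) (e e' : rel T) (u v : T).
Hypothesis esym : symmetric e.
Hypothesis e'E : forall x y, e' x y = e x y || ((x \in [:: u; v]) && (y \in [:: u; v])).

Definition conn_class (r : rel T) (x : T) : {set T} := [set y | connect r x y].

Definition conn_classes (r : rel T) : {set {set T}} := [set conn_class r x | x : T].

Let csym : connect_sym e.
Proof. exact/sym_connect_sym. Qed.

Lemma connect_add (x y : T) : connect e' x y =
  [|| connect e x y, connect e x u && connect e v y
    | connect e x v && connect e u y].
Proof.
have sub : subrel (connect e) (connect e').
  by apply: connect_sub => a b ab; apply: connect1; rewrite e'E ab.
have uv a b : a \in [:: u; v] -> b \in [:: u; v] -> connect e' a b.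
  by move=> au bu; apply: connect1; rewrite e'E au bu orbT.
apply/idP/idP; last first.
  case/or3P => [/sub //|/andP[/sub xu /sub vy]|/andP[/sub xu /sub vy]];
    apply: connect_trans xu (connect_trans (uv _ _ _ _) vy);
    by rewrite !inE eqxx ?orbT.
case/connectP => p ep ->; elim: p x ep => [|z p IHp] x /=.
  by rewrite connect0.
case/andP; rewrite e'E => /orP[xz|/andP[xu zu]] /IHp.
  have cxz := connect1 xz.
  case/or3P => [zy|/andP[zu vy]|/andP[zv uy]]; apply/or3P.
  - by apply: Or31; apply: connect_trans zy.
  - by apply: Or32; rewrite vy (connect_trans cxz zu).
  - by apply: Or33; rewrite uy (connect_trans cxz zv).
move: (last z p) => t.
move: xu zu; rewrite !inE => /orP[]/eqP-> /orP[]/eqP->; rewrite ?connect0 /=;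
  by case: (connect e u t); case: (connect e v t); rewrite ?andbT ?andbF ?orbT.
Qed.

Lemma conn_class_eq (x y : T) : (conn_class e x == conn_class e y) = connect e x y.
Proof.
apply/eqP/idP => [E|xy].
  have : y \in conn_class e y by rewrite inE connect0.
  by rewrite -E inE.
by apply/setP => z; rewrite !inE (same_connect csym xy).
Qed.

Lemma clusters_add_connected : connect e u v -> conn_classes e' = conn_classes e.
Proof.
move=> uv; apply: eq_imset => x; apply/setP => y; rewrite !inE connect_add.
apply/or3P/idP => [[//|/andP[xu vy]|/andP[xv uy]]|]; last by constructor.
  exact: connect_trans xu (connect_trans uv vy).
by apply: connect_trans xv (connect_trans _ uy); rewrite csym.
Qed.

Lemma clusters_add_merge : ~~ connect e u v ->
  conn_classes e' = (conn_class e u :|: conn_class e v) |: (conn_classes e :\ conn_class e u :\ conn_class e v).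
Proof.
move=> nuv.
have clusterE x : conn_class e' x = if connect e x u || connect e x v
    then conn_class e u :|: conn_class e v else conn_class e x.
  apply/setP => y; rewrite inE connect_add.
  case: ifP => [/orP[xu|xv]|/norP[nxu nxv]].
  - have xv : connect e x v = false.
      by apply/negP => xv; case/negP: nuv; rewrite csym in xu; exact: connect_trans xu xv.
    by rewrite !inE xu xv orbF (same_connect csym xu).
  - have xu : connect e x u = false.
      by apply/negP => xu; case/negP: nuv; rewrite csym in xu; exact: connect_trans xu xv.
    by rewrite !inE xu xv /= (same_connect csym xv) orbC.
  - by rewrite inE (negPf nxu) (negPf nxv) !orbF.
apply/setP => C; apply/imsetP/idP.
  case=> x _ ->; rewrite clusterE; case: ifP => [_|/norP[nxu nxv]].
    by rewrite !inE eqxx.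
  rewrite !inE !conn_class_eq nxu nxv /=; apply/orP; right; exact: imset_f.
rewrite !inE => /orP[/eqP->|/and3P[nv nu /imsetP[x _ Cx]]].
  by exists u => //; rewrite clusterE connect0.
by exists x => //; rewrite clusterE -!conn_class_eq -Cx (negPf nu) (negPf nv).
Qed.

Definition n_clusters (r : rel T) (P : pred {set T}) : nat :=
  #|[set C in conn_classes r | P C]|.

Lemma n_clusters_connected (P : pred {set T}) : connect e u v -> n_clusters e' P = n_clusters e P.
Proof. by move=> uv; rewrite /n_clusters clusters_add_connected. Qed.

(** [m] counts the clusters with property [P] other than those of [u] and [v]. *)
Lemma n_clusters_merge (P : pred {set T}) : ~~ connect e u v -> exists m,
  n_clusters e P = (m + P (conn_class e u) + P (conn_class e v))%N /\
  n_clusters e' P = (m + P (conn_class e u :|: conn_class e v))%N.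
Proof.
move=> nuv; pose D := conn_classes e :\ conn_class e u :\ conn_class e v.
exists #|[set C in D | P C]|.
have nm C (A : {set {set T}}) : C \notin A ->
    #|[set B in C |: A | P B]| = (#|[set B in A | P B]| + P C)%N.
  move=> nC; case PC : (P C).
    rewrite addn1 (_ : [set B in C |: A | P B] = C |: [set B in A | P B]).
      by rewrite cardsU1 finset.in_set (negPf nC) add1n.
    by apply/setP => B; rewrite !inE; case: eqP => // ->; rewrite PC.
  rewrite addn0; apply: eq_card => B; rewrite !inE.
  by case: eqP => // ->; rewrite PC !andbF.
split; last first.
  rewrite /n_clusters clusters_add_merge // nm //; apply/negP.
  rewrite !inE => /and3P[_ _ /imsetP[x _ Ex]]; case/negP: nuv.
  have : (u \in conn_class e x) && (v \in conn_class e x) by rewrite -Ex !inE !connect0 orbT.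
  by rewrite !inE => /andP[xu xv]; rewrite csym in xu; exact: connect_trans xu xv.
have E1 : conn_classes e = conn_class e u |: (conn_class e v |: D).
  rewrite /D finset.setD1K; last by rewrite !inE conn_class_eq csym nuv imset_f.
  by rewrite finset.setD1K // imset_f.
rewrite /n_clusters E1.
have nvD : conn_class e v \notin D by rewrite !inE eqxx.
have nuD : conn_class e u \notin conn_class e v |: D.
  by rewrite !inE eqxx andbF /= orbF conn_class_eq nuv.
by rewrite nm // nm // addnAC.
Qed.

End AddEdge.

(** Of the four faces around [z] two diagonally opposite ones are primal, and the parity of [z]
    tells which. *)
Definition end1 (z : vertex) : face :=
  if (2 %| z.1 + z.2)%Z then z else (z.1 - 1, z.2).

Definition end2 (z : vertex) : face :=
  if (2 %| z.1 + z.2)%Z then (z.1 - 1, z.2 - 1) else (z.1, z.2 - 1).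

Lemma end1_primal (z : vertex) : is_primal (end1 z).
Proof. by case: z => x y; rewrite /end1 /is_primal; case: ifP => //=; lia. Qed.

Lemma end2_primal (z : vertex) : is_primal (end2 z).
Proof. by case: z => x y; rewrite /end2 /is_primal; case: ifP => /=; lia. Qed.

Definition pend1 (z : vertex) : primal := exist _ (end1 z) (end1_primal z).
Definition pend2 (z : vertex) : primal := exist _ (end2 z) (end2_primal z).

Lemma in_corners (z : vertex) (f : face) : (z \in corners f) =
  ((z.1 == f.1) || (z.1 == f.1 + 1)) && ((z.2 == f.2) || (z.2 == f.2 + 1)).
Proof.
case: z f => x y [a b]; rewrite /corners !inE !xpair_eqE /=.
by case: (x == a); case: (x == a + 1); case: (y == b); case: (y == b + 1).
Qed.

Lemma corner_ends (z : vertex) (f : primal) :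
  (z \in corners (val f)) = (f == pend1 z) || (f == pend2 z).
Proof.
rewrite -!val_eqE /= in_corners; case: f => [[a b] /= p]; case: z => x y.
by rewrite /end1 /end2 /= ; move: p; rewrite /is_primal /=; case: ifP => /= h p;
  rewrite !xpair_eqE; lia.
Qed.

Lemma fin_edgesP (V : {fset primal}) (z : vertex) :
  (z \in fin_edges V) = (pend1 z \in V) && (pend2 z \in V).
Proof.
rewrite /fin_edges !inE /=; apply/andP/andP.
  by case=> _ /asboolP H; split; apply: H; rewrite corner_ends eqxx ?orbT.
case=> h1 h2; split.
  apply/bigfcupP; exists (pend1 z); first by rewrite h1.
  by rewrite corner_ends eqxx.
by apply/asboolP => f; rewrite corner_ends => /orP[]/eqP->.
Qed.

Lemma open_adjP (w : vertex -> bool) (f g : primal) :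
  reflect (exists z, [/\ z \in corners (val f), z \in corners (val g) & w z])
          (open_adj w f g).
Proof.
apply: (iffP hasP) => [[z]|[z [zf zg wz]]]; last by exists z => //; rewrite inE zf.
by rewrite inE => /andP[zf zg] wz; exists z.
Qed.

Lemma open_adj_sym (w : vertex -> bool) : symmetric (open_adj w).
Proof. by move=> f g; rewrite /open_adj fsetIC. Qed.

Definition vadj (V : {fset primal}) (S : {fset vertex}) : rel V :=
  fun x y => open_adj (fun z => z \in S) (val x) (val y).

Lemma vadj_sym (V : {fset primal}) (S : {fset vertex}) : symmetric (@vadj V S).
Proof. by move=> x y; exact: open_adj_sym. Qed.

Lemma vadj_add (V : {fset primal}) (S : {fset vertex}) (z : vertex) (u v : V) :
  val u = pend1 z -> val v = pend2 z -> forall x y : V,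
  vadj (z |` S) x y = vadj S x y || ((x \in [:: u; v]) && (y \in [:: u; v])).
Proof.
move=> Eu Ev x y.
have E (x0 : V) : (z \in corners (val (val x0))) = (x0 \in [:: u; v]).
  by rewrite corner_ends !inE -Eu -Ev !val_eqE.
apply/open_adjP/orP.
  case=> t [tx ty]; rewrite in_fset1U => /orP[/eqP Et|tS].
    by right; rewrite -!E -Et tx ty.
  by left; apply/open_adjP; exists t.
case=> [/open_adjP[t [tx ty tS]]|].
  by exists t; split=> //; rewrite in_fset1U tS orbT.
by rewrite -!E => /andP[zx zy]; exists z; rewrite in_fset1U eqxx.
Qed.

(** * Positive association *)

Section FourFunctions.
Variables (K : choiceType) (R : realFieldType).
Implicit Types (A B E S : {fset K}) (x : K).

Lemma sum_fpowersetU1 (F : {fset K} -> R) (x : K) (E : {fset K}) : x \notin E ->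
  \sum_(S <- fpowerset (x |` E)) F S = \sum_(S <- fpowerset E) (F S + F (x |` S)).
Proof.
move=> xE; rewrite big_split /= -(big_map (fun S => x |` S) xpredT F) -big_cat /=.
apply: perm_big; apply: uniq_perm; rewrite ?fset_uniq //.
  rewrite cat_uniq fset_uniq map_inj_in_uniq ?fset_uniq /= ?andbT.
    apply/hasPn => _ /mapP[S SE ->]; apply/negP; rewrite /= fpowersetE => /fsubsetP/(_ x).
    by rewrite in_fset1U eqxx => /(_ isT); apply/negP.
  move=> S S'; rewrite !fpowersetE => SE SE' /(congr1 (fun A => A `\ x)).
  by rewrite !fsetU1K //; apply: contra xE; apply/fsubsetP.
move=> S; rewrite mem_cat fpowersetE; apply/idP/orP.
  move=> SE; have [xS|xS] := boolP (x \in S).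
    right; apply/mapP; exists (S `\ x); last by rewrite fsetD1K.
    rewrite fpowersetE; apply/fsubsetP => y; rewrite !inE => /andP[nyx yS].
    by have := fsubsetP SE y yS; rewrite !inE (negPf nyx).
  left; rewrite fpowersetE; apply/fsubsetP => y yS.
  have := fsubsetP SE y yS; rewrite !inE => /orP[/eqP yx|//].
  by rewrite -yx yS in xS.
case=> [|/mapP[S' + ->]]; rewrite fpowersetE => SE.
  by apply: fsubset_trans SE _; exact: fsubsetU1.
exact: fsetUS.
Qed.

(** The case of a single element. With [m] the common bound of the mixed terms [a0 * b1] and
    [a1 * b0], the product of their distances to [m] is nonnegative, and their own product is at
    most [m * c1 * d0]; together this bounds their sum. *)
Lemma four_numbers (a0 a1 b0 b1 c0 c1 d0 d1 : R) :
  0 <= a0 -> 0 <= a1 -> 0 <= b0 -> 0 <= b1 ->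
  0 <= c0 -> 0 <= c1 -> 0 <= d0 -> 0 <= d1 ->
  a0 * b0 <= c0 * d0 -> a0 * b1 <= c0 * d1 ->
  a1 * b0 <= c0 * d1 -> a1 * b1 <= c1 * d1 ->
  (a0 + a1) * (b0 + b1) <= (c0 + c1) * (d0 + d1).
Proof.
move=> a0p a1p b0p b1p c0p c1p d0p d1p h00 h01 h10 h11.
have [m Em] : exists m, m = c0 * d1 by eexists.
rewrite -Em in h01 h10.
have m0 : 0 <= m by rewrite Em; exact: mulr_ge0.
suff key : a0 * b1 + a1 * b0 <= m + c1 * d0.
  have := lerD (lerD h00 key) h11; rewrite Em.
  by congr (_ <= _); ring.
have c1d0 : 0 <= c1 * d0 by exact: mulr_ge0.
have [mE|mN] := eqVneq m 0; first by rewrite mE in h01 h10 *; apply: le_trans (lerD h01 h10) _; rewrite addr0 add0r.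
have mp : 0 < m by rewrite lt_neqAle eq_sym mN.
have prod : (a0 * b1) * (a1 * b0) <= m * (c1 * d0).
  have -> : (a0 * b1) * (a1 * b0) = (a0 * b0) * (a1 * b1) by ring.
  have -> : m * (c1 * d0) = (c0 * d0) * (c1 * d1) by rewrite Em; ring.
  by apply: ler_pM => //; exact: mulr_ge0.
rewrite -(ler_pM2l mp).
have : 0 <= (m - a0 * b1) * (m - a1 * b0) by apply: mulr_ge0; rewrite subr_ge0.
move=> pos; rewrite -subr_ge0; apply: le_trans (_ : 0 <= _ + (m * (c1 * d0) - _)) _.
  by apply: addr_ge0 pos _; rewrite subr_ge0; exact: prod.
by rewrite le_eqVlt; apply/orP; left; apply/eqP; ring.
Qed.

(** The Ahlswede-Daykin theorem. The induction removes an element and replaces each function by its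
    sum over both states of this element, which preserves the hypothesis by [four_numbers]. *)
Lemma four_functions (E : {fset K}) (al be ga de : {fset K} -> R) :
  (forall S, 0 <= al S) -> (forall S, 0 <= be S) ->
  (forall S, 0 <= ga S) -> (forall S, 0 <= de S) ->
  (forall A B, A `<=` E -> B `<=` E ->
     al A * be B <= ga (A `&` B) * de (A `|` B)) ->
  (\sum_(S <- fpowerset E) al S) * (\sum_(S <- fpowerset E) be S) <=
  (\sum_(S <- fpowerset E) ga S) * (\sum_(S <- fpowerset E) de S).
Proof.
have [n] := ubnP #|` E|; elim: n E al be ga de => // n IHn E al be ga de.
move=> ltE ap bp gp dp H.
have [->|[x xE]] := fset_0Vmem E.
  by rewrite fpowerset0 !big_seq_fset1; have := H fset0 fset0;
    rewrite fsetI0 fsetU0; apply; exact: fsub0set.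
pose E' := E `\ x; have EE : E = x |` E' by rewrite fsetD1K.
have xE' : x \notin E' by rewrite !inE eqxx.
rewrite EE !sum_fpowersetU1 //; apply: IHn.
- by move: ltE; rewrite (cardfsD1 x E) xE.
- by move=> S; rewrite addr_ge0.
- by move=> S; rewrite addr_ge0.
- by move=> S; rewrite addr_ge0.
- by move=> S; rewrite addr_ge0.
move=> A B AE BE.
have sub S : S `<=` E' -> S `<=` E /\ x |` S `<=` E.
  move=> SE; rewrite EE; split; last exact: fsetUS.
  by apply: fsubset_trans SE _; exact: fsubsetU1.
have [[A1 A2] [B1 B2]] := (sub A AE, sub B BE).
have xA : x \notin A by apply: contra xE'; apply/fsubsetP.
have xB : x \notin B by apply: contra xE'; apply/fsubsetP.
apply: four_numbers => //.
- exact: H.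
- have := H _ _ A1 B2; rewrite fsetUCA (_ : A `&` (x |` B) = A `&` B); first exact.
  by apply/fsetP => y; rewrite !inE; case: eqP => // ->; rewrite (negPf xA).
- have := H _ _ A2 B1; rewrite -fsetUA (_ : (x |` A) `&` B = A `&` B); first exact.
  by apply/fsetP => y; rewrite !inE; case: eqP => // ->; rewrite (negPf xB) !andbF.
- have := H _ _ A2 B2; rewrite -fsetUIr (_ : (x |` A) `|` (x |` B) = x |` (A `|` B)); first exact.
  by apply/fsetP => y; rewrite !inE; case: eqP.
Qed.

(** Holley's inequality is the four functions theorem for [w1 * f], [w2], [w1] and [w2 * f]. The
    weight [w1] may vanish, which allows for weights restricted to the unexplored edges. *)
Lemma holley (E : {fset K}) (w1 w2 f : {fset K} -> R) :
  (forall S, 0 <= w1 S) -> (forall S, 0 < w2 S) -> (forall S, 0 <= f S) ->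
  (forall A B, A `<=` B -> f A <= f B) ->
  (forall A B x, A `<=` B -> B `<=` E -> x \in E -> x \notin B ->
     w1 (x |` A) * w2 B <= w1 A * w2 (x |` B)) ->
  (\sum_(S <- fpowerset E) w1 S * f S) * (\sum_(S <- fpowerset E) w2 S) <=
  (\sum_(S <- fpowerset E) w1 S) * (\sum_(S <- fpowerset E) w2 S * f S).
Proof.
move=> w1p w2p fp fmono step; apply: four_functions => //.
- by move=> S; exact: mulr_ge0.
- by move=> S; exact: ltW.
- by move=> S; apply: mulr_ge0 => //; exact: ltW.
(* The condition on single elements is iterated over [D], which will be the difference of [A] and
   [B]; the positive weight [w2] of the intermediate set is cancelled each time. *)
have key D X B : X `<=` B -> B `<=` E -> D `<=` E -> [disjoint D & B] ->
    w1 (X `|` D) * w2 B <= w1 X * w2 (B `|` D).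
  have [n] := ubnP #|` D|; elim: n D => // n IHn D ltD XB BE DE dis.
  have [->|[x xD]] := fset_0Vmem D; first by rewrite !fsetU0.
  pose D' := D `\ x; have DD : D = x |` D' by rewrite fsetD1K.
  have D'D : D' `<=` D by rewrite DD fsubsetU1.
  have xB : x \notin B by move/fdisjointP: dis; apply.
  have xU : x \notin B `|` D' by rewrite !inE eqxx (negPf xB).
  have D'E := fsubset_trans D'D DE.
  have := IHn D' _ XB BE D'E (fdisjointWl D'D dis).
  move=> /(_ _) IH; have {}IH : w1 (X `|` D') * w2 B <= w1 X * w2 (B `|` D').
    by apply: IH; move: ltD; rewrite (cardfsD1 x D) xD.
  have := step (X `|` D') (B `|` D') x (fsetSU _ XB) _ (fsubsetP DE _ xD) xU.
  rewrite fsubUset BE D'E => /(_ isT).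
  rewrite DD !(fsetUCA _ [fset x]) => st.
  rewrite -(ler_pM2r (w2p (B `|` D'))).
  have -> : w1 (x |` (X `|` D')) * w2 B * w2 (B `|` D') =
      (w1 (x |` (X `|` D')) * w2 (B `|` D')) * w2 B by ring.
  apply: le_trans (ler_wpM2r (ltW (w2p B)) st) _.
  have -> : w1 (X `|` D') * w2 (x |` (B `|` D')) * w2 B =
      (w1 (X `|` D') * w2 B) * w2 (x |` (B `|` D')) by ring.
  apply: le_trans (ler_wpM2r (ltW (w2p _)) IH) _.
  by rewrite le_eqVlt; apply/orP; left; apply/eqP; ring.
move=> A B AE BE.
have := key (A `\` B) (A `&` B) B (fsubsetIr _ _) BE
  (fsubset_trans (fsubsetDl _ _) AE) _.
have -> : (A `&` B) `|` (A `\` B) = A.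
  by apply/fsetP => y; rewrite !inE; case: (y \in A); case: (y \in B).
have -> : B `|` (A `\` B) = A `|` B.
  by apply/fsetP => y; rewrite !inE; case: (y \in A); case: (y \in B).
have dis : [disjoint A `\` B & B].
  by apply/fdisjointP => y; rewrite !inE => /andP[].
move=> /(_ dis) H; rewrite mulrAC mulrA.
apply: ler_pM => //; last by apply: fmono; exact: fsubsetUl.
by apply: mulr_ge0 => //; exact: ltW.
Qed.

End FourFunctions.

(** * Finite-volume random-cluster measures *)

Lemma disjoint_memP (T : finType) (A B : {set T}) :
  reflect (forall y, y \in A -> y \notin B) (disjoint (mem A) (mem B)).
Proof.
by rewrite disjoint_subset; apply: (iffP fintype.subsetP) => H y /H; rewrite inE.
Qed.

Section RandomCluster.
Variables (R : realType) (x q : R) (V : {fset primal}).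
Hypotheses (x_gt0 : 0 < x) (q_ge1 : 1 <= q).
Implicit Types (S A B : {fset vertex}) (z : vertex) (u v : V) (k : R).

Let q_gt0 : 0 < q := lt_le_trans ltr01 q_ge1.

Lemma inv_le1 (y : R) : 1 <= y -> y^-1 <= 1.
Proof. by move=> y1; rewrite invf_le1 // (lt_le_trans ltr01). Qed.

Definition inner : pred {set V} := fun C => disjoint (mem C) (mem (boundary V)).

Definition touches S : pred V := fun u => ~~ inner (conn_class (vadj S) u).

Definition k_bd S : nat := n_clusters (@vadj V S) (predC inner).

Lemma k_wiredE S : k_wired V S = n_clusters (@vadj V S) inner.
Proof. by []. Qed.

(* The clusters touching the boundary have weight k instead of 1 (wired) or q
   (free); x stands for p / (1 - p). *)
Definition fk_weight k S : R := x ^+ #|` S| * q ^+ k_wired V S * k ^+ k_bd S.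

Lemma fk_weight_gt0 k S : 0 < k -> 0 < fk_weight k S.
Proof. by move=> kp; rewrite /fk_weight !mulr_gt0 // exprn_gt0. Qed.

(** The effect on the cluster weights of opening an edge: unless its ends are connected already, one
    cluster disappears, and it has weight [k] only if both clusters touch the boundary. *)
Definition fk_ratio k S u v : R :=
  if connect (vadj S) u v then 1
  else if touches S u && touches S v then k^-1 else q^-1.

Lemma fk_weight_add k S z u v : 0 < k -> z \notin S ->
  val u = pend1 z -> val v = pend2 z ->
  fk_weight k (z |` S) = fk_weight k S * (x * fk_ratio k S u v).
Proof.
move=> kp zS Eu Ev; have adj := vadj_add S Eu Ev.
have sym := @vadj_sym V S.
have disU : inner (conn_class (vadj S) u :|: conn_class (vadj S) v) =
    inner (conn_class (vadj S) u) && inner (conn_class (vadj S) v).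
  rewrite /inner; apply/disjoint_memP/andP => [H|[/disjoint_memP Hu /disjoint_memP Hv] y].
    by split; apply/disjoint_memP => y yu; apply: H; rewrite inE yu ?orbT.
  by rewrite inE => /orP[/Hu|/Hv].
have card1 : #|` z |` S| = #|` S|.+1 by rewrite cardfsU1 zS.
have pow n : x ^+ n.+1 = x ^+ n * x by rewrite exprSr.
rewrite /fk_weight /fk_ratio !k_wiredE /k_bd card1 pow.
case: ifP => [uv|/negbT nuv].
  have E1 := n_clusters_connected sym adj inner uv.
  have E2 := n_clusters_connected sym adj (predC inner) uv.
  by rewrite E1 E2; move: (x ^+ _) (q ^+ _) (k ^+ _) => a b c; ring.
have [m [E1 E2]] := n_clusters_merge sym adj inner nuv.
have [m' [E3 E4]] := n_clusters_merge sym adj (predC inner) nuv.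
rewrite E1 E2 E3 E4 /= disU /touches !exprD.
move: (x ^+ _) (q ^+ m) (k ^+ m') => a b c.
case: (inner _); case: (inner _) => /=; rewrite ?expr0 ?expr1;
  by field; rewrite ?gt_eqF.
Qed.

Lemma vadj_mono A B : A `<=` B -> subrel (@vadj V A) (@vadj V B).
Proof.
move=> AB u v /open_adjP[z [zu zv zA]]; apply/open_adjP; exists z; split=> //.
exact: (fsubsetP AB).
Qed.

Lemma connect_mono A B : A `<=` B -> subrel (connect (@vadj V A)) (connect (@vadj V B)).
Proof.
by move=> AB; apply: connect_sub => u v uv; apply: connect1; exact: vadj_mono uv.
Qed.

Lemma touchesP S u :
  reflect (exists2 v, v \in boundary V & connect (vadj S) u v) (touches S u).
Proof.
apply: (iffP idP) => [|[v vb uv]].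
  have [/existsP[v /andP[uv vb]] _|/existsPn nb] :=
      boolP [exists v, connect (vadj S) u v && (v \in boundary V)]; first by exists v.
  by case/negP; apply/disjoint_memP => v; rewrite inE => uv; have := nb v; rewrite uv.
by apply/negP => /disjoint_memP/(_ v); rewrite inE => /(_ uv); rewrite vb.
Qed.

Lemma touches_mono A B u : A `<=` B -> touches A u -> touches B u.
Proof.
move=> AB /touchesP[v vb uv]; apply/touchesP; exists v => //; exact: connect_mono uv.
Qed.

Lemma ends_in z : z \in fin_edges V ->
  exists u v, val u = pend1 z /\ val v = pend2 z.
Proof.
by rewrite fin_edgesP => /andP[h1 h2]; exists [` h1], [` h2].
Qed.

Lemma fk_step k1 k2 (w1 w2 : {fset vertex} -> R) A A' B z : 0 < k1 -> 0 < k2 ->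
  z \in fin_edges V -> z \notin A -> z \notin B ->
  (forall u v, val u = pend1 z -> val v = pend2 z ->
     fk_ratio k1 A u v <= fk_ratio k2 B u v) ->
  fk_weight k1 (z |` A) * fk_weight k2 B <= fk_weight k1 A * fk_weight k2 (z |` B).
Proof.
move=> k1p k2p zE zA zB; have [u [v [Eu Ev]]] := ends_in zE => /(_ u v Eu Ev) le.
rewrite (fk_weight_add k1p zA Eu Ev) (fk_weight_add k2p zB Eu Ev).
rewrite mulrAC mulrA ler_wpM2l //; last by rewrite ler_wpM2l // ltW.
by rewrite mulr_ge0 // ltW // fk_weight_gt0.
Qed.

Lemma fk_ratio_le1 k S u v : 1 <= k -> fk_ratio k S u v <= 1.
Proof.
move=> k1; rewrite /fk_ratio; case: ifP => // _; case: ifP => _; exact: inv_le1.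
Qed.

Lemma fk_ratio_ge k S u v : 0 < k -> k <= q -> q^-1 <= fk_ratio k S u v.
Proof.
move=> k0 kq; rewrite /fk_ratio; case: ifP => _; first exact: inv_le1.
by case: ifP => _ //; rewrite lef_pV2.
Qed.

Definition fk_sum k (f : {fset vertex} -> R) : R :=
  \sum_(S <- fpowerset (fin_edges V)) fk_weight k S * f S.

(** For [k = 1] an edge between two boundary clusters has ratio 1, the largest possible one, and
    both connections and contacts with the boundary persist when edges are added. *)
Lemma fk_wired_ge k (U : {fset vertex}) : 1 <= k -> k <= q ->
  fk_sum k (fun S => (U `<=` S)%:R) * fk_sum 1 (fun=> 1) <=
  fk_sum k (fun=> 1) * fk_sum 1 (fun S => (U `<=` S)%:R).
Proof.
move=> k1 kq; have k0 : 0 < k := lt_le_trans ltr01 k1.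
rewrite /fk_sum; under [X in _ * X <= _]eq_bigr do rewrite mulr1.
under [X in _ <= X * _]eq_bigr do rewrite mulr1.
apply: holley => //.
- by move=> S; apply/ltW/fk_weight_gt0.
- by move=> S; apply/fk_weight_gt0.
- by move=> A B AB; rewrite ler_nat; case: (boolP (U `<=` A)) => // UA;
    rewrite (fsubset_trans UA AB).
move=> A B z AB BE zE zB.
have zA : z \notin A by apply: contra zB; apply/fsubsetP.
apply: fk_step => // u v Eu Ev.
have [cB|nB] := boolP (connect (vadj B) u v).
  by rewrite {2}/fk_ratio cB; exact: fk_ratio_le1.
have nA : ~~ connect (vadj A) u v by apply: contra nB; exact: connect_mono.
rewrite /fk_ratio (negPf nA) (negPf nB) invr1.
case: ifP => [/andP[tu tv]|_].
  by rewrite !(touches_mono AB) //; exact: inv_le1.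
by case: ifP => _ //; exact: inv_le1.
Qed.

(** * Exploration of the clusters touching the boundary *)

Definition edge_touches S z : bool :=
  [exists u : V, (z \in corners (val (val u))) && touches S u].

Definition explored S : {fset vertex} := [fset z in S | edge_touches S z].

(** The other edges of the box are revealed when the boundary clusters are explored: each of them is
    closed or belongs to [explored S]. *)
Definition unexplored S : {fset vertex} :=
  [fset z in fin_edges V | ~~ edge_touches S z].

Lemma in_unexplored S z :
  (z \in unexplored S) = (z \in fin_edges V) && ~~ edge_touches S z.
Proof. by rewrite /unexplored; move: (fin_edges V) => E; rewrite !inE. Qed.

Lemma in_explored S z : (z \in explored S) = (z \in S) && edge_touches S z.
Proof. by rewrite !inE. Qed.

Lemma explored_sub S : explored S `<=` S.
Proof. by apply/fsubsetP => z; rewrite !inE => /andP[]. Qed.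

Lemma touches_explored S : touches (explored S) =1 touches S.
Proof.
move=> u; apply/idP/idP; first exact/touches_mono/explored_sub.
case/touchesP => v vb /connectP[p]; elim: p u => [|t p IHp] u /=.
  by move=> _ Ev; apply/touchesP; exists v => //; rewrite Ev.
case/andP => /open_adjP[z [zu zt zS]] pth Ev.
have /touchesP[v' vb' tv'] := IHp _ pth Ev; apply/touchesP; exists v' => //.
apply: connect_trans tv'; apply: connect1; apply/open_adjP; exists z; split=> //.
rewrite !inE zS /=; apply/existsP; exists u; rewrite zu.
apply/touchesP; exists v => //; apply/connectP; exists (t :: p) => //=.
by rewrite pth andbT; apply/open_adjP; exists z.
Qed.

Lemma edge_touches_explored S : edge_touches (explored S) =1 edge_touches S.
Proof.
by move=> z; apply/eq_existsb => u; rewrite touches_explored.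
Qed.

Lemma exploredK S : explored (explored S) = explored S.
Proof.
by apply/fsetP => z; rewrite !inE edge_touches_explored; case: (_ \in _); case: edge_touches.
Qed.

(** The first edge of [A] met when a path is followed back from the boundary would have an end in a
    boundary cluster of [S], so that it would not be unexplored. *)
Lemma touches_unexplored S A : explored S = S -> A `<=` unexplored S ->
  touches (S `|` A) =1 touches S.
Proof.
move=> ES AU u; apply/idP/idP; last exact/touches_mono/fsubsetUl.
case/touchesP => v vb /connectP[p]; elim: p u => [|t p IHp] u /=.
  by move=> _ Ev; apply/touchesP; exists v => //; rewrite Ev.
case/andP => /open_adjP[z [zu zt zS]] pth Ev.
have tt := IHp _ pth Ev; have /touchesP[v' vb' tv'] := tt.
apply/touchesP; exists v' => //.
apply: connect_trans tv'; apply: connect1; apply/open_adjP; exists z; split=> //.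
move: zS; rewrite in_fsetU => /orP[//|/(fsubsetP AU)].
rewrite in_unexplored => /andP[_ /negP[]]; apply/existsP; exists t; by rewrite zt.
Qed.

Lemma explored_unexplored S A : explored S = S -> A `<=` unexplored S ->
  explored (S `|` A) = S.
Proof.
move=> ES AU; apply/fsetP => z; rewrite !inE.
have -> : edge_touches (S `|` A) z = edge_touches S z.
  by apply/eq_existsb => u; rewrite touches_unexplored.
apply/andP/idP => [[/orP[//|/(fsubsetP AU)]]|zS].
  by rewrite in_unexplored => /andP[_ /negPf->].
by move: (zS); rewrite -{1}ES !inE => /andP[_ ->]; rewrite zS.
Qed.

Lemma connect_unexplored S A u v : explored S = S -> A `<=` unexplored S ->
  ~~ touches S u -> connect (vadj (S `|` A)) u v -> connect (vadj A) u v.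
Proof.
move=> ES AU nu /connectP[p]; elim: p u nu => [|t p IHp] u nu /=.
  by move=> _ ->.
case/andP => ut pth Ev; have /open_adjP[z [zu zt zSA]] := ut.
have nt : ~~ touches S t.
  rewrite -(touches_unexplored ES AU); apply: contra nu.
  rewrite -(touches_unexplored ES AU) => /touchesP[b bb tb]; apply/touchesP.
  by exists b => //; apply: connect_trans tb; exact: connect1.
apply: connect_trans (IHp t nt pth Ev); apply: connect1.
apply/open_adjP; exists z; split=> //.
move: zSA; rewrite in_fsetU => /orP[|//].
rewrite -{1}ES !inE => /andP[zS /existsP[y /andP[zy ty]]]; case/negP: nu.
move: ty => /touchesP[b bb yb]; apply/touchesP; exists b => //.
by apply: connect_trans yb; apply: connect1; apply/open_adjP; exists z.
Qed.

(** The combinatorial part of the domain Markov property: the configurations with explored part [S1]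
    are the unions of [S1] with arbitrary sets of unexplored edges. *)
Lemma sum_explored (F : {fset vertex} -> R) S1 : S1 `<=` fin_edges V ->
  explored S1 = S1 ->
  \sum_(S <- fpowerset (fin_edges V) | explored S == S1) F S =
  \sum_(A <- fpowerset (unexplored S1)) F (S1 `|` A).
Proof.
move=> S1E ES; have UE : unexplored S1 `<=` fin_edges V.
  by apply/fsubsetP => z; rewrite in_unexplored => /andP[].
rewrite -big_filter -(big_map (fun A => S1 `|` A) xpredT F) /=.
have S1U : [disjoint S1 & unexplored S1].
  apply/fdisjointP => z; rewrite in_unexplored -{1}ES in_explored => /andP[_ ->].
  by rewrite andbF.
apply: perm_big; apply: uniq_perm; first by rewrite filter_uniq // fset_uniq.
  rewrite map_inj_in_uniq ?fset_uniq // => A B; rewrite !fpowersetE => AU BU EAB.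
  apply/fsetP => z; have := congr1 (fun X => z \in X) EAB; rewrite !inE /=.
  have [zS|//] := boolP (z \in S1).
  have nU := fdisjointP S1U _ zS.
  by rewrite (negPf (contra (fsubsetP AU z) nU)) (negPf (contra (fsubsetP BU z) nU)).
move=> S; rewrite mem_filter fpowersetE; apply/andP/mapP.
  case=> /eqP E1 SE; exists (S `&` unexplored S1).
    by rewrite fpowersetE fsubsetIr.
  apply/fsetP => z; rewrite in_fsetU in_fsetI in_unexplored.
  have [zS|zS] /= := boolP (z \in S); last first.
    by rewrite orbF; apply/esym/negP; rewrite -E1 => /(fsubsetP (explored_sub S)); apply/negP.
  rewrite (fsubsetP SE _ zS) -E1 edge_touches_explored in_explored zS /=.
  by case: edge_touches.
case=> A; rewrite fpowersetE => AU ->; split; first by rewrite explored_unexplored.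
by rewrite fsubUset S1E (fsubset_trans AU UE).
Qed.

(* Given the edges S1 of the wired clusters touching the boundary, the remaining
   edges form no such cluster, so that their law is dominated by the measure
   with weight k. *)
Lemma fk_wired_le k (U : {fset vertex}) : 0 < k -> k <= q ->
  fk_sum 1 (fun S => (U `<=` S)%:R * (all (fun z => ~~ edge_touches S z) U)%:R)
    * fk_sum k (fun=> 1) <=
  fk_sum 1 (fun=> 1) * fk_sum k (fun S => (U `<=` S)%:R).
Proof.
move=> k0 kq.
pose E := fin_edges V; pose fU S : R := (U `<=` S)%:R.
have split (F : {fset vertex} -> R) : \sum_(S <- fpowerset E) F S =
    \sum_(S1 <- fpowerset E) \sum_(S <- fpowerset E | explored S == S1) F S.
  rewrite (exchange_big_dep xpredT) //=; rewrite big_seq [RHS]big_seq.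
  apply: eq_bigr => S; rewrite fpowersetE => SE.
  rewrite (eq_bigl (pred1 (explored S))) => [|S1]; last by rewrite /= eq_sym.
  rewrite -big_filter filter_pred1_uniq ?fset_uniq ?big_seq1 //.
  by rewrite fpowersetE (fsubset_trans (explored_sub S)).
have pos : 0 <= fk_sum k fU.
  by apply: sumr_ge0 => S _; rewrite mulr_ge0 ?ler0n // ltW // fk_weight_gt0.
have posk : 0 <= fk_sum k (fun=> 1).
  by apply: sumr_ge0 => S _; rewrite mulr1 ltW // fk_weight_gt0.
rewrite /(fk_sum 1) [X in X * _ <= _]split [X in _ <= X * _]split.
rewrite !mulr_suml big_seq [leRHS]big_seq; apply: ler_sum => S1; rewrite fpowersetE => S1E.
have [ES|nES] := eqVneq (explored S1) S1; last first.
  rewrite big1 ?mul0r; last first.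
    by move=> S /eqP Ex; case/eqP: nES; rewrite -Ex exploredK.
  rewrite mulr_ge0 //; apply: sumr_ge0 => S _.
  by rewrite mulr1 ltW // fk_weight_gt0.
rewrite !sum_explored //.
have eT A : A `<=` unexplored S1 -> edge_touches (S1 `|` A) =1 edge_touches S1.
  by move=> AU z; apply/eq_existsb => u; rewrite touches_unexplored.
(* If an edge of [U] meets a boundary cluster, the left-hand event has no mass for this explored
   part. *)
have [good|bad] := boolP (all (fun z => ~~ edge_touches S1 z) U); last first.
  rewrite big_seq big1 ?mul0r; last first.
    move=> A; rewrite fpowersetE => AU.
    by rewrite (eq_all (a2 := fun z => ~~ edge_touches S1 z)) ?(negPf bad) ?mulr0 // => z;
       rewrite eT.
  rewrite mulr_ge0 //; apply: sumr_ge0 => S _.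
  by rewrite mulr1 ltW // fk_weight_gt0.
have UE : unexplored S1 `<=` E by apply/fsubsetP => z; rewrite in_unexplored => /andP[].
(* Extended by zero, the conditional weight is defined on all sets of edges of the box, so that
   Holley's inequality can compare it with the weight for [k]. *)
pose w1 A : R := if A `<=` unexplored S1 then fk_weight 1 (S1 `|` A) else 0.
have toE (F : {fset vertex} -> R) :
    \sum_(A <- fpowerset (unexplored S1)) fk_weight 1 (S1 `|` A) * F A =
    \sum_(A <- fpowerset E) w1 A * F A.
  transitivity (\sum_(A <- fpowerset E | A `<=` unexplored S1)
      fk_weight 1 (S1 `|` A) * F A); last first.
    rewrite big_mkcond; apply: eq_bigr => A _.
    by rewrite /w1; case: ifP => //; rewrite mul0r.
  rewrite -[RHS]big_filter; apply: perm_big; apply: uniq_perm.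
  - exact: fset_uniq.
  - by rewrite filter_uniq // fset_uniq.
  move=> A; rewrite mem_filter !fpowersetE; case: (boolP (A `<=` _)) => //= AU.
  by rewrite (fsubset_trans AU UE).
rewrite (eq_big_seq (fun A => fk_weight 1 (S1 `|` A) * fU A)); last first.
  move=> A; rewrite fpowersetE => AU; rewrite /fU; congr (_ * _).
  rewrite (eq_all (a2 := fun z => ~~ edge_touches S1 z)) ?good ?mulr1; last first.
    by move=> z; rewrite eT.
  congr (nat_of_bool _)%:R; apply/fsubsetP/fsubsetP => H z zU; last first.
    by rewrite inE H ?orbT.
  have := H z zU; rewrite inE => /orP[|//]; rewrite -{1}ES !inE.
  by rewrite (negPf (allP good z zU)) andbF.
rewrite !toE /fk_sum; under [X in _ * X <= _]eq_bigr do rewrite mulr1.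
under [X in _ <= X * _]eq_bigr do rewrite mulr1.
apply: holley => //.
- by move=> S; rewrite /w1; case: ifP => // _; apply/ltW/fk_weight_gt0.
- by move=> S; apply/fk_weight_gt0.
- by move=> A B AB; rewrite ler_nat; case: (boolP (U `<=` A)) => // UA;
    rewrite (fsubset_trans UA AB).
move=> A B z AB BE zE zB; rewrite /w1.
case: ifP => [|_]; last first.
  rewrite mul0r mulr_ge0 //; last by apply/ltW/fk_weight_gt0.
  by case: ifP => // _; apply/ltW/fk_weight_gt0.
rewrite fsubUset fsub1set => /andP[zU AU]; rewrite AU fsetUCA.
have zA : z \notin A by apply: contra zB; apply/fsubsetP.
have nz : ~~ edge_touches S1 z by move: zU; rewrite in_unexplored => /andP[].
have zS : z \notin S1 `|` A.
  rewrite inE negb_or zA andbT; apply/negP; rewrite -{1}ES !inE.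
  by rewrite (negPf nz) andbF.
apply: fk_step => // u v Eu Ev.
have nt y : (z \in corners (val (val y))) -> ~~ touches S1 y.
  by move=> zy; apply: contra nz => ty; apply/existsP; exists y; rewrite zy.
have nu : ~~ touches S1 u by apply: nt; rewrite corner_ends Eu eqxx.
(* An unexplored edge never meets a boundary cluster, so that its ratio is 1 if its ends are
   connected and otherwise the smallest possible value, the inverse of [q]. *)
rewrite {1}/fk_ratio !touches_unexplored // (negPf nu) /=.
case: ifP => [|_]; last exact: fk_ratio_ge.
move=> /(connect_unexplored ES AU nu)/(connect_mono AB) cB.
by rewrite /fk_ratio cB.
Qed.

End RandomCluster.

(** * Loops in a box *)

Definition face_dart (f : face) (d : dir) : dart :=
  (match d with
   | East => f | North => (f.1 + 1, f.2)
   | West => (f.1 + 1, f.2 + 1) | South => (f.1, f.2 + 1)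
   end, d).

Lemma left_face_dart (f : face) (d : dir) : left_face (face_dart f d) = f.
Proof. by case: f d => x y [] /=; congr pair; lia. Qed.

Lemma face_dartK (a : dart) : face_dart (left_face a) a.2 = a.
Proof. by case: a => [[x y] []] /=; congr pair; congr pair => /=; lia. Qed.

Definition in_box (n : nat) (f : face) : bool :=
  (`|f.1| <= n%:Z) && (`|f.2| <= n%:Z).

Definition box_face (n : nat) (p : 'I_(2 * n).+1 * 'I_(2 * n).+1) : primal :=
  insubd origin (p.1%:Z - n%:Z, p.2%:Z - n%:Z).

Definition box (n : nat) : {fset primal} :=
  [fset box_face p | p in [set: 'I_(2 * n).+1 * 'I_(2 * n).+1]%SET].

Lemma in_boxE (n : nat) (f : primal) : (f \in box n) = in_box n (val f).
Proof.
apply/imfsetP/idP => [[p _ ->]|].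
  rewrite /box_face val_insubd; case: ifP => _; last by rewrite /in_box /=; lia.
  have := ltn_ord p.1; have := ltn_ord p.2; case: p => [[i li] [j lj]] /= _ _.
  rewrite /in_box /=; lia.
case: f => [[x y] p]; rewrite /in_box /= => /andP[hx hy].
have lx : (absz (x + n%:Z)%R < (2 * n).+1)%N by lia.
have ly : (absz (y + n%:Z)%R < (2 * n).+1)%N by lia.
exists (Ordinal lx, Ordinal ly); first by rewrite /= finset.in_setT.
apply: val_inj; rewrite /box_face /=.
have -> : (absz (x + n%:Z))%:Z - n%:Z = x by lia.
have -> : (absz (y + n%:Z))%:Z - n%:Z = y by lia.
by rewrite val_insubd p.
Qed.

Lemma corner_start (a : dart) : a.1 \in corners (left_face a).
Proof. by case: a => [[x y] []]; rewrite in_corners /=; lia. Qed.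

Lemma corner_target (a : dart) : target a \in corners (left_face a).
Proof. by case: a => [[x y] []]; rewrite in_corners /=; lia. Qed.

(** The dart arriving at the target of [a] from the opposite side. Among the four arriving darts
    these two have the same colour on their left. *)
Definition oppose (a : dart) : dart := rev_dart (target a, a.2).

Lemma target_oppose (a : dart) : target (oppose a) = target a.
Proof. by case: a => [[x y] []] /=; congr pair; lia. Qed.

Lemma oppose_dir (a : dart) : (oppose a).2 = opp_dir a.2.
Proof. by []. Qed.

Lemma oppose_neq (a : dart) : oppose a != a.
Proof.
by apply/eqP => /(congr1 snd) /= /eqP; rewrite (negPf (opp_dir_neq _)).
Qed.

Lemma primal_oppose (a : dart) : is_primal (left_face (oppose a)) = is_primal (left_face a).
Proof. by case: a => [[x y] []]; rewrite /is_primal /=; lia. Qed.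

Lemma same_target (a b : dart) : target a = target b ->
  is_primal (left_face a) = is_primal (left_face b) -> b = a \/ b = oppose a.
Proof.
move: a b => [[x y] d] [[x' y'] d'].
case: d; case: d' => /= -[E1 E2]; rewrite /is_primal /= => Ep;
  try (by left; congr pair; congr pair; lia);
  try (by right; rewrite /oppose /rev_dart /=; congr pair; congr pair; lia);
  exfalso; lia.
Qed.

(** The two states of a vertex differ by an exchange of the successors of its two opposite arriving
    darts. *)
Lemma oppose_next (w w' : config) (a : dart) : w' (target a) = ~~ w (target a) ->
  next_dart w' (oppose a) = next_dart w a.
Proof.
move=> flip; rewrite !next_dartE /turns_left target_oppose primal_oppose flip; congr pair.
by rewrite oppose_dir; case: (is_primal _); case: (w _) => /=; case: (a.2).
Qed.

Section Box.
Variable n : nat.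
Local Notation V := (box n).
Local Notation E := (fin_edges (box n)).

(** A dart is encoded by the primal face on its left and its direction, which gives a finite type
    for the box. *)
Definition bdart : Type := (V * dir)%type.
HB.instance Definition _ := Finite.on bdart.

Definition dart_of (x : bdart) : dart := face_dart (val (val x.1)) x.2.

Lemma left_dart_of (x : bdart) : left_face (dart_of x) = val (val x.1).
Proof. exact: left_face_dart. Qed.

Lemma dart_of_inj : injective dart_of.
Proof.
move=> [u d] [v d'] E; have := congr1 left_face E; rewrite !left_dart_of /=.
by move=> /val_inj /val_inj ->; have := congr1 snd E => /= ->.
Qed.

Lemma dart_of_primal (x : bdart) : is_primal (left_face (dart_of x)).
Proof. by rewrite left_dart_of; exact: valP. Qed.

Lemma dart_ofP (a : dart) : is_primal (left_face a) -> in_box n (left_face a) ->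
  exists x, dart_of x = a.
Proof.
move=> pa ba; pose f : primal := exist _ (left_face a) pa.
have fV : f \in V by rewrite in_boxE.
by exists ([` fV], a.2); rewrite /dart_of /= face_dartK.
Qed.

Opaque dart_of.

Definition conf (S : {fset vertex}) : config := fun z => z \in S.

Definition to_primal (f : face) (p : is_primal f) : primal := exist _ f p.

Lemma in_box_edge (z : vertex) (f : primal) : z \in E -> z \in corners (val f) ->
  in_box n (val f).
Proof.
rewrite fin_edgesP !in_boxE => /andP[h1 h2].
by rewrite corner_ends => /orP[]/eqP->.
Qed.

(** The left face changes only at a right turn, hence across an open edge, and open edges have both
    ends in the box. *)
Lemma next_in_box (S : {fset vertex}) (x : bdart) : S `<=` E ->
  exists y, dart_of y = next_dart (conf S) (dart_of x).
Proof.
move=> SE; have p := dart_of_primal x.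
apply: dart_ofP; first by rewrite primal_next.
rewrite next_dartE; case: ifP => [_|nl].
  rewrite left_face_turn_left left_dart_of -in_boxE; exact: valP.
set b := (_, _); have pb : is_primal (left_face b) by rewrite primal_turn_right.
have := @in_box_edge (target (dart_of x)) (to_primal pb); apply; last exact: (corner_start b).
by move: nl; rewrite /turns_left p /conf /=; case: (boolP (_ \in S)) => // /(fsubsetP SE).
Qed.

Definition next_bdart (S : {fset vertex}) (x : bdart) : bdart :=
  odflt x [pick y | dart_of y == next_dart (conf S) (dart_of x)].

Lemma next_bdartE (S : {fset vertex}) (x : bdart) : S `<=` E ->
  dart_of (next_bdart S x) = next_dart (conf S) (dart_of x).
Proof.
move=> SE; rewrite /next_bdart; case: pickP => [y /eqP -> //|no].
by have [y /eqP] := next_in_box x SE; rewrite no.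
Qed.

Lemma next_bdart_inj (S : {fset vertex}) : S `<=` E -> injective (next_bdart S).
Proof.
move=> SE x y Exy; apply: dart_of_inj; apply: (@next_dart_inj (conf S)).
by rewrite -!next_bdartE // Exy.
Qed.

Lemma iter_bdart (S : {fset vertex}) (x : bdart) (k : nat) : S `<=` E ->
  dart_of (iter k (next_bdart S) x) = iter k (next_dart (conf S)) (dart_of x).
Proof. by move=> SE; elim: k => //= k IHk; rewrite next_bdartE // IHk. Qed.

Definition bturn (S : {fset vertex}) (x : bdart) : int := turn (conf S) (dart_of x).

Lemma bturnE S x : bturn S x = if target (dart_of x) \in S then - 1 else 1.
Proof.
rewrite /bturn /turn /turns_left dart_of_primal /conf.
by case: (_ \in S).
Qed.

Definition sgb (b : bool) : int := if b then 1 else - 1.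

Definition coh (S : {fset vertex}) (t : {ffun bdart -> bool}) : bool :=
  [forall x, t (next_bdart S x) == t x].

(** No edge is open at such a target, so that loops turn left there for every [S] contained in
    [E]. *)
Definition bd_dart (x : bdart) : bool := target (dart_of x) \notin E.

Definition bd_ok (t : {ffun bdart -> bool}) : bool := [forall x, bd_dart x ==> t x].

(** Backwards, a loop makes the opposite turn at each vertex; for a coherent [t] this is the number
    of left turns minus the number of right turns along [t]. *)
Definition rotation (S : {fset vertex}) (t : {ffun bdart -> bool}) : int :=
  \sum_x bturn S x * sgb (t x).

Lemma oppose_in_box (x : bdart) : ~~ bd_dart x ->
  exists y, dart_of y = oppose (dart_of x).
Proof.
rewrite negbK => zE; have po : is_primal (left_face (oppose (dart_of x))).
  by rewrite primal_oppose dart_of_primal.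
apply: dart_ofP => //; apply: (@in_box_edge (target (dart_of x)) (to_primal po)) => //.
by rewrite -target_oppose; exact: corner_target.
Qed.

(** Boundary darts are fixed, since their opposites have a left face outside the box; this gives an
    involution of the whole type. *)
Definition opp_bdart (x : bdart) : bdart :=
  if bd_dart x then x else odflt x [pick y | dart_of y == oppose (dart_of x)].

Lemma opp_bdartE (x : bdart) : ~~ bd_dart x ->
  dart_of (opp_bdart x) = oppose (dart_of x).
Proof.
move=> zE; rewrite /opp_bdart (negPf zE); case: pickP => [y /eqP -> //|no].
by have [y /eqP] := oppose_in_box zE; rewrite no.
Qed.

Lemma opposeK (a : dart) : oppose (oppose a) = a.
Proof.
by case: a => [[x y] []]; rewrite /oppose /rev_dart /=; congr pair; congr pair; lia.
Qed.

Lemma target_opp_bdart x : target (dart_of (opp_bdart x)) = target (dart_of x).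
Proof.
have [bx|nx] := boolP (bd_dart x); first by rewrite /opp_bdart bx.
by rewrite opp_bdartE // target_oppose.
Qed.

Lemma bd_opp_bdart x : bd_dart (opp_bdart x) = bd_dart x.
Proof. by rewrite /bd_dart target_opp_bdart. Qed.

Lemma opp_bdartK : involutive opp_bdart.
Proof.
move=> x; have [bx|nx] := boolP (bd_dart x); first by rewrite /opp_bdart bx bx.
by apply: dart_of_inj; rewrite !opp_bdartE ?opposeK // bd_opp_bdart.
Qed.

(* The vertices at which the orientation t is compatible with both states. *)
Definition flippable (t : {ffun bdart -> bool}) : {fset vertex} :=
  [fset z in E | [forall x, (target (dart_of x) == z) ==> (t (opp_bdart x) == t x)]].

Lemma in_flippableE t z : (z \in flippable t) = (z \in E) &&
  [forall x, (target (dart_of x) == z) ==> (t (opp_bdart x) == t x)].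
Proof. by rewrite /flippable; move: (E) => F; rewrite !inE. Qed.

Lemma in_flippable t x : (target (dart_of x) \in flippable t) =
  ~~ bd_dart x && (t (opp_bdart x) == t x).
Proof.
rewrite in_flippableE /bd_dart negbK; have [zE /=|//] := boolP (_ \in E).
apply/forallP/idP => [/(_ x)/implyP|tx y]; first by apply; rewrite eqxx.
apply/implyP => /eqP Et; have [] := same_target (esym Et).
- by rewrite !dart_of_primal.
- by move=> /dart_of_inj ->.
by rewrite -opp_bdartE ?negbK // => /dart_of_inj ->; rewrite opp_bdartK eq_sym.
Qed.

Definition symdiff (A B : {fset vertex}) : {fset vertex} := (A `\` B) `|` (B `\` A).

Lemma in_symdiff A B z : (z \in symdiff A B) = (z \in A) (+) (z \in B).
Proof. by rewrite !inE; case: (z \in A); case: (z \in B). Qed.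

Lemma symdiffK B : involutive (symdiff^~ B).
Proof. by move=> A; apply/fsetP => z; rewrite !in_symdiff -addbA addbb addbF. Qed.

Lemma flippable_sub t : flippable t `<=` E.
Proof.
apply/fsubsetP => z; by rewrite in_flippableE => /andP[].
Qed.

Lemma symdiff_sub S t : S `<=` E -> symdiff S (flippable t) `<=` E.
Proof.
move=> SE; apply/fsubsetP => z; rewrite in_symdiff.
have [zS _|_ /= zF] := boolP (z \in S); first exact: (fsubsetP SE).
exact: (fsubsetP (flippable_sub t)).
Qed.

(** Toggling exchanges the successors of two opposite darts, and at a flippable vertex [t] has the
    same value on both. *)
Lemma coh_flip S t : S `<=` E -> coh S t -> coh (symdiff S (flippable t)) t.
Proof.
move=> SE /forallP C; apply/forallP => x.
have S'E := symdiff_sub t SE.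
have [zF|zF] := boolP (target (dart_of x) \in flippable t).
  have := zF; rewrite in_flippable => /andP[nb /eqP to].
  have -> : next_bdart (symdiff S (flippable t)) x = next_bdart S (opp_bdart x).
    apply: dart_of_inj; rewrite !next_bdartE // opp_bdartE //.
    symmetry; apply: oppose_next; rewrite /conf in_symdiff zF addbT negbK //.
  by rewrite (eqP (C _)) to.
have -> : next_bdart (symdiff S (flippable t)) x = next_bdart S x; last exact: C.
apply: dart_of_inj; rewrite !next_bdartE // !next_dartE; congr pair.
by rewrite /turns_left /conf in_symdiff (negPf zF) addbF.
Qed.

Definition n_bd : nat := #|bd_dart|.

(** Toggling reverses both turns at a flippable vertex. At any other vertex of [E] the two opposite
    darts turn alike and have opposite values of [t], so that they cancel. Each boundary dart turns
    left and is run forwards, adding 1 to both rotations. *)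
Lemma rotation_flip S t : S `<=` E -> bd_ok t ->
  rotation (symdiff S (flippable t)) t = 2 * n_bd%:Z - rotation S t.
Proof.
move=> SE /forallP Bt; apply/eqP; rewrite eq_sym subr_eq eq_sym; apply/eqP.
rewrite /rotation -big_split /=.
pose G x : int := if bd_dart x then 2 else if t (opp_bdart x) == t x then 0
  else 2 * bturn S x * sgb (t x).
rewrite (eq_bigr G) => [|x _]; last first.
  rewrite /G !bturnE in_symdiff in_flippable; have := Bt x.
  have [bx /= tx|nb _ /=] := boolP (bd_dart x).
    rewrite addbF (negPf (contra (fsubsetP SE _) bx)) tx /=; lia.
  by case: (t _ == t _); case: (_ \in S) => /=; case: (t x); rewrite /sgb /=; lia.
rewrite (bigID bd_dart) /= (eq_bigr (fun=> 2)) => [|x bx]; last by rewrite /G bx.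
rewrite [X in _ + X](_ : _ = 0); last first.
  have [s Es] : exists s, s = \sum_(x | ~~ bd_dart x) G x by eexists.
  rewrite -Es; suff : s = - s by lia.
  rewrite {1}Es Es -sumrN (reindex_inj (inv_inj opp_bdartK)) /=.
  apply: eq_big => x; first by rewrite bd_opp_bdart.
  rewrite bd_opp_bdart => nb; rewrite /G bd_opp_bdart (negPf nb) opp_bdartK.
  rewrite /bturn /turn /turns_left !dart_of_primal target_opp_bdart.
  by case: (t x); case: (t _); rewrite /sgb //=; case: (conf _ _) => /=; lia.
rewrite addr0 sumr_const -[LHS]mulr_natr -[n_bd%:Z]natz; congr (_ * _%:R).
Qed.

End Box.

Lemma card_imset_eq (T T1 T2 : finType) (A : {set T}) (f : T -> T1) (g : T -> T2) :
  (forall x y, x \in A -> y \in A -> (f x == f y) = (g x == g y)) ->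
  #|f @: A| = #|g @: A|.
Proof.
move=> fg; have [->|[x0 x0A]] := finset.set_0Vmem A; first by rewrite !imset0 !cards0.
pose h v := g (odflt x0 [pick x in A | f x == v]).
have hf x : x \in A -> h (f x) = g x.
  move=> xA; rewrite /h; case: pickP => [y /andP[yA /eqP E]|/(_ x)].
    by apply/eqP; rewrite -fg // E.
  by rewrite xA eqxx.
have -> : g @: A = h @: (f @: A).
  apply/setP => v; apply/imsetP/imsetP => [[x xA ->]|[_ /imsetP[x xA ->] ->]].
    by exists (f x); rewrite ?hf // imset_f.
  by exists x; rewrite ?hf.
rewrite [in RHS]card_in_imset // => _ _ /imsetP[x xA ->] /imsetP[y yA ->].
by rewrite !hf // => /eqP; rewrite -fg // => /eqP.
Qed.

Lemma card_dir : #|{: dir}| = 4%N.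
Proof.
have bij : bijective dir_code by exists dir_decode; [exact: dir_codeK | by case=> [[] []]].
by rewrite (bij_eq_card bij) card_prod card_bool.
Qed.

Lemma visits_next (w : config) (a b : dart) (n : nat) :
  iter n (next_dart w) a = a -> visits w a n (next_dart w b) = visits w a n b.
Proof.
move=> per; have := sum_cycle per (fun c : dart => (c == next_dart w b)%:R).
rewrite /visits => <-; apply: eq_bigr => i _ /=.
by rewrite (inj_eq (@next_dart_inj w)).
Qed.

Lemma corner_dart (f : face) (z : vertex) : z \in corners f ->
  exists d, target (face_dart f d) = z.
Proof.
rewrite in_corners; case: f z => x y [u v] /= /andP[/orP[]/eqP-> /orP[]/eqP->].
- by exists South; rewrite /=; congr pair; lia.
- by exists West; rewrite /=; congr pair; lia.
- by exists East.
- by exists North.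
Qed.

Lemma adj_corner (f g : primal) (z : vertex) : f != g ->
  z \in corners (val f) -> z \in corners (val g) -> adj f g.
Proof.
move=> nfg zf zg; rewrite /adj.
suff -> : corners (val f) `&` corners (val g) = [fset z] by rewrite cardfs1.
apply/fsetP => t; rewrite in_fsetI in_fset1; apply/andP/eqP => [[tf tg]|-> //].
have : val f != val g by rewrite val_eqE.
move: (valP f) (valP g) zf zg tf tg; rewrite !in_corners /is_primal.
case: (val f) (val g) z t => [a b] [c d] [x y] [u v] /=; rewrite xpair_eqE => p1 p2 h1 h2 h3 h4 h5.
suff : u = x /\ v = y by case=> -> ->.
lia.
Qed.

Lemma left_face_oppose_neq (a : dart) : left_face a != left_face (oppose a).
Proof.
by case: a => [[x y] []]; rewrite /oppose /rev_dart /= xpair_eqE; lia.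
Qed.

(** * Loops of the box as orbits, and the clusters that they surround *)

Section Orbits.
Variables (n : nat) (S : {fset vertex}).
Local Notation V := (box n).
Local Notation E := (fin_edges (box n)).
Local Notation w := (conf S).
Hypothesis SE : S `<=` E.

Definition loop_perm : {perm bdart n} := perm (@next_bdart_inj n S SE).
Local Notation s := loop_perm.
Local Notation period x := #|porbit s x|.

Lemma dart_of_iter (x : bdart n) (k : nat) :
  dart_of ((s ^+ k)%g x) = iter k (next_dart w) (dart_of x).
Proof.
rewrite permX -iter_bdart //; congr dart_of; apply: eq_iter => y.
by rewrite permE.
Qed.

Lemma loop_period (x : bdart n) : iter (period x) (next_dart w) (dart_of x) = dart_of x.
Proof. by rewrite -dart_of_iter permX iter_porbit. Qed.

Lemma loop_period_gt0 (x : bdart n) : (0 < period x)%N.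
Proof. by apply/card_gt0P; exists x; exact: porbit_id. Qed.

Lemma loop_period_min (x : bdart n) (m : nat) : (0 < m < period x)%N ->
  iter m (next_dart w) (dart_of x) != dart_of x.
Proof.
case/andP=> m0 mp; rewrite -dart_of_iter (inj_eq (@dart_of_inj n)) permX.
have := uniq_traject_porbit s x; case Ep : (period x) mp => [|p] // mp /=.
case/andP => nx _; apply: contra nx => /eqP Ex.
apply/trajectP; exists m.-1; first by lia.
by rewrite -iterSr prednK // Ex.
Qed.

Lemma sum_porbit (F : bdart n -> int) (x : bdart n) :
  \sum_(y in porbit s x) F y = \sum_(i < period x) F ((s ^+ i)%g x).
Proof.
rewrite (eq_bigl (mem (traject s x (period x)))); last first.
  by move=> y; rewrite /= porbit_traject.
rewrite -big_uniq ?uniq_traject_porbit //= -[X in traject _ _ X]/(period x).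
rewrite (big_nth x) size_traject big_mkord; apply: eq_bigr => i _.
by rewrite nth_traject // permX.
Qed.

(** With the primal cluster on its left, a loop is anticlockwise if it is the outer boundary of the
    cluster and clockwise if it surrounds a hole of it. *)
Definition plus (x : bdart n) : bool := acw w (dart_of x).

Lemma plusE (x : bdart n) :
  plus x = (wind w (dart_of x) (period x) (left_face (dart_of x)) == 1).
Proof.
exact: acwE (loop_period x) (loop_period_gt0 x) (@loop_period_min x).
Qed.

Lemma loop_turn (x : bdart n) :
  \sum_(y in porbit s x) bturn S y = if plus x then 4 else - 4.
Proof.
rewrite sum_porbit plusE; under eq_bigr do rewrite /bturn dart_of_iter.
by have [[-> ->]|[-> ->]] :=
  wind_turns (loop_period x) (loop_period_gt0 x) (@loop_period_min x).
Qed.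

Local Notation W x := (wind w (dart_of x) (period x)).

Lemma plus_wind (x y : bdart n) : y \in porbit s x ->
  W x (left_face (dart_of y)) = (plus x)%:R.
Proof.
case/porbitP => i ->; rewrite dart_of_iter.
rewrite (wind_left (loop_period x) (loop_period_gt0 x) (@loop_period_min x)) plusE.
by have [[-> _]|[-> _]] :=
  wind_turns (loop_period x) (loop_period_gt0 x) (@loop_period_min x).
Qed.

Lemma plus_wind_right (x y : bdart n) : y \in porbit s x ->
  W x (right_face (dart_of y)) = (plus x)%:R - 1.
Proof.
move=> yx; rewrite -(plus_wind yx); case/porbitP: yx => i ->; rewrite dart_of_iter.
rewrite (wind_left_right (loop_period x) (loop_period_gt0 x) (@loop_period_min x)).
by rewrite addrK.
Qed.

Lemma plus_porbit (x y : bdart n) : y \in porbit s x -> plus y = plus x.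
Proof.
move=> yx; have := plus_wind yx; have := plus_wind (porbit_id s y).
have Ep : porbit s y = porbit s x by apply/eqP; rewrite eq_porbit_mem.
have -> : W y (left_face (dart_of y)) = W x (left_face (dart_of y)).
  rewrite Ep; move: (left_face _) => f; case/porbitP: yx => i ->.
  by rewrite dart_of_iter (wind_shift (loop_period x)).
by move=> -> /eqP; rewrite eqr_nat; case: (plus x); case: (plus y).
Qed.

Lemma wind_box (x : bdart n) (f : face) : ~~ in_box n f -> W x f = 0.
Proof.
move=> fout; apply: (@wind_out _ _ _ (loop_period x) (- n%:Z) n%:Z (- n%:Z) n%:Z).
  move=> i _; rewrite -dart_of_iter left_dart_of.
  have : val ((s ^+ i)%g x).1 \in V by exact: valP.
  by rewrite in_boxE /in_box => /andP[]; case: (val (val _)) => a b /=; split; lia.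
move: fout; rewrite /in_box; lia.
Qed.

Lemma bd_face (x : bdart n) : bd_dart x -> ~~ in_box n (left_face (oppose (dart_of x))).
Proof.
move=> bx; apply/negP => inb; case/negP: bx.
have po : is_primal (left_face (oppose (dart_of x))) by rewrite primal_oppose dart_of_primal.
have : (val x.1 \in V) && (to_primal po \in V) by rewrite (valP x.1) in_boxE.
have c1 : target (dart_of x) \in corners (val (val x.1)).
  by rewrite -left_dart_of corner_target.
have c2 : target (dart_of x) \in corners (val (to_primal po)).
  by rewrite -target_oppose corner_target.
have neq : val x.1 != to_primal po.
  by rewrite -val_eqE -left_dart_of; exact: left_face_oppose_neq.
rewrite fin_edgesP; move: c1 c2 neq; rewrite !corner_ends.
by case/orP => /eqP-> /orP[]/eqP->; rewrite ?eqxx // => _ /andP[-> ->].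
Qed.

(** The loop turns left at the target, and the right face of this dart or of the next one is outside
    the box. There the winding number is 0, so that it is 1 on the left. *)
Lemma bd_plus (x : bdart n) : bd_dart x -> plus x.
Proof.
move=> bx; have := bd_face bx.
have zS : target (dart_of x) \notin S by apply: contra bx; exact: (fsubsetP SE).
have Es : dart_of ((s ^+ 1)%g x) = (target (dart_of x), left_of (dart_of x).2).
  rewrite dart_of_iter /= next_dartE /turns_left dart_of_primal /conf.
  by rewrite (negPf zS).
have := plus_wind_right (porbit_id s x); have := plus_wind_right (mem_porbit s 1 x).
rewrite Es; have := wind_box x.
have : in_box n (left_face (dart_of x)) by rewrite left_dart_of -in_boxE; exact: valP.
move: (dart_of x) (wind _ _ _) => a Wx bin wout r1 r0 fout.
have [out|] := boolP (in_box n (right_face a)); last first.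
  by move=> /wout; rewrite r0; case: (plus x).
suff : ~~ in_box n (right_face (target a, left_of a.2)).
  by move=> /wout; rewrite r1; case: (plus x).
move: bin fout out; rewrite /in_box; case: a {r0 r1} => [[u v] []] /=; lia.
Qed.

(** Loops do not cross open edges: the dart arriving at an open edge turns right, so that it and its
    successor have the same right face, have the two ends of the edge on their left, and are visited
    equally often by any loop. *)
Lemma wind_connect (x : bdart n) (u v : V) : connect (vadj S) u v ->
  W x (val (val u)) = W x (val (val v)).
Proof.
suff step (u' v' : V) : vadj S u' v' -> W x (val (val u')) = W x (val (val v')).
  by case/connectP => p; elim: p u => [|t p IHp] u /=; [move=> _ ->|
    move=> /andP[/step -> /IHp]].
case/open_adjP => z [zu zv zS]; have [d Ez] := corner_dart zu.
have [->//|nuv] := eqVneq u' v'.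
pose a := face_dart (val (val u')) d.
have pa : is_primal (left_face a) by rewrite left_face_dart; exact: valP.
have Ea : next_dart w a = (target a, right_of a.2).
  by rewrite next_dartE /turns_left pa /conf Ez zS.
have Ev : left_face (next_dart w a) = val (val v').
  have p : is_primal (left_face (next_dart w a)) by rewrite primal_next.
  have c : z \in corners (val (to_primal p)).
    have : z \in corners (left_face (next_dart w a)).
      by rewrite -Ez Ea; exact: (corner_start (target a, right_of a.2)).
    exact.
  have nu : to_primal p != val u'.
    have : left_face (next_dart w a) != val (val u').
      rewrite Ea -(left_face_dart (val (val u')) d) -/a.
      by case: (a) => [[? ?] []] /=; rewrite xpair_eqE; lia.
    by rewrite -val_eqE.
  have nvu : val u' != val v' by rewrite val_eqE.
  suff : to_primal p = val v' by move/(congr1 val).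
  move: c zu zv nu nvu; rewrite !corner_ends.
  by case/orP=> /eqP-> /orP[]/eqP-> /orP[]/eqP->; rewrite ?eqxx.
have norev b : is_primal (left_face b) -> visits w (dart_of x) (period x) (rev_dart b) = 0.
  move=> pb; apply: visits_out => i _; apply/eqP => Eb.
  have := primal_right b; rewrite /right_face -Eb primal_iter dart_of_primal.
  by rewrite pb.
have h1 := wind_step (loop_period x) a; have h2 := wind_step (loop_period x) (next_dart w a).
rewrite -Ev -(left_face_dart (val (val u')) d) -/a.
have Er : right_face (next_dart w a) = right_face a.
  by rewrite Ea right_face_turn_right.
move: h1 h2; rewrite Er !norev ?primal_next // (visits_next _ (loop_period x)) => h1 h2.
by apply: (addIr (- W x (right_face a))); rewrite h1 h2.
Qed.

Lemma next_connect (x : bdart n) : connect (vadj S) x.1 (next_bdart S x).1.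
Proof.
have := next_bdartE x SE; move: (next_bdart S x) => y Ey.
have [tl|tr] := boolP (turns_left w (dart_of x)).
  suff -> : y.1 = x.1 by exact: connect0.
  apply: val_inj; apply: val_inj; rewrite -!left_dart_of Ey next_dartE tl.
  by rewrite left_face_turn_left.
apply: connect1; apply/open_adjP; exists (target (dart_of x)).
rewrite -!left_dart_of corner_target Ey next_dartE (negPf tr); split=> //.
  exact: (corner_start (target (dart_of x), right_of (dart_of x).2)).
by move: tr; rewrite /turns_left dart_of_primal /conf; case: (_ \in S).
Qed.

Lemma porbit_connect (x y : bdart n) : y \in porbit s x -> connect (vadj S) x.1 y.1.
Proof.
case/porbitP => i ->; elim: i => [|i IHi]; first by rewrite expg0 perm1 connect0.
by rewrite expgSr permM permE; apply: connect_trans IHi (next_connect _).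
Qed.

Lemma conn_sym (u v : V) : connect (vadj S) u v = connect (vadj S) v u.
Proof. by apply: sym_connect_sym; exact: vadj_sym. Qed.

Lemma visits_porbit (x : bdart n) (b : dart) :
  visits w (dart_of x) (period x) b =
  [exists y in porbit s x, dart_of y == b]%:R.
Proof.
have [[i li ->]|v0] := visitsP w (dart_of x) (period x) b.
  rewrite (visits_in (loop_period x) (loop_period_gt0 x) (@loop_period_min x)).
  case: existsP => // -[]; exists ((s ^+ i)%g x).
  by rewrite mem_porbit dart_of_iter eqxx.
rewrite v0; case: existsP => // -[y /andP[yx /eqP Eb]].
move: v0; rewrite -Eb; case/porbitP: yx => i ->; rewrite dart_of_iter.
by rewrite (visits_in (loop_period x) (loop_period_gt0 x) (@loop_period_min x)).
Qed.

(* If two distinct loops with sign plus had the same primal cluster on their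
   left, then crossing either of them would change only its own winding number,
   so that the sum of both winding numbers could not vanish far away. *)
Lemma plus_unique (x y : bdart n) : plus x -> plus y -> connect (vadj S) x.1 y.1 ->
  y \in porbit s x.
Proof.
move=> px py cxy; apply/negPn/negP => nyx.
have W1 (u : bdart n) : (u \in porbit s x) || (u \in porbit s y) ->
    W x (left_face (dart_of u)) = 1 /\ W y (left_face (dart_of u)) = 1.
  move=> uxy; have cxu : connect (vadj S) x.1 u.1.
    case/orP: uxy => [/porbit_connect //|/porbit_connect yu].
    exact: connect_trans cxy yu.
  have cyu : connect (vadj S) y.1 u.1.
    by apply: connect_trans cxu; rewrite conn_sym.
  rewrite left_dart_of -(wind_connect x cxu) -(wind_connect y cyu) -!left_dart_of.
  by rewrite !plus_wind ?porbit_id // px py.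
have disj (u : bdart n) : u \in porbit s x -> u \in porbit s y -> False.
  rewrite -!eq_porbit_mem => /eqP Eu /eqP Ev; case/negP: nyx.
  by rewrite -eq_porbit_mem -Ev Eu.
have vis1 (z : bdart n) b : visits w (dart_of z) (period z) b = 0 \/
    exists2 u, u \in porbit s z & b = dart_of u.
  rewrite visits_porbit; case: existsP => [[u /andP[uz /eqP Eu]]|_]; last by left.
  by right; exists u.
have visin (z u : bdart n) : visits w (dart_of z) (period z) (dart_of u) = (u \in porbit s z)%:R.
  rewrite visits_porbit; congr (nat_of_bool _)%:R; apply/existsP/idP.
    by case=> u' /andP[uz /eqP/dart_of_inj <-].
  by exists u; rewrite eqxx andbT.
have norev (z u : bdart n) : visits w (dart_of z) (period z) (rev_dart (dart_of u)) = 0.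
  have [//|[u' _ Eu]] := vis1 z (rev_dart (dart_of u)).
  have := primal_right (dart_of u); rewrite /right_face Eu !dart_of_primal.
  by [].
pose Q f := (1 <= W x f + W y f).
have Qf : forall f, Q f.
  apply: (@face_ind Q (left_face (dart_of x))).
    by have [] := W1 x (introT orP (or_introl (porbit_id s x))); rewrite /Q => -> ->.
  move=> b Qb; have sx := wind_step (loop_period x) b; have sy := wind_step (loop_period y) b.
  have case_in (u : bdart n) : (u \in porbit s x) || (u \in porbit s y) -> b = dart_of u ->
      Q (right_face b).
    move=> uxy Eb; have [l1 l2] := W1 u uxy; move: sx sy.
    rewrite Eb l1 l2 !visin !norev /Q.
    by case: (boolP (u \in porbit s x)) (@disj u) => ux; case: (boolP (u \in porbit s y)) => uy;
      rewrite /= => D; first (by case: D); lia.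
  have case_rev (u : bdart n) : (u \in porbit s x) || (u \in porbit s y) -> rev_dart b = dart_of u ->
      Q (right_face b).
    by move=> uxy Eb; have [l1 l2] := W1 u uxy; rewrite /Q /right_face Eb l1 l2.
  have [vx|[u ux /case_in]] := vis1 x b; last by rewrite ux; apply.
  have [vy|[u ux /case_in]] := vis1 y b; last by rewrite ux orbT; apply.
  have [vx'|[u ux /case_rev]] := vis1 x (rev_dart b); last by rewrite ux; apply.
  have [vy'|[u ux /case_rev]] := vis1 y (rev_dart b); last by rewrite ux orbT; apply.
  move: sx sy Qb; rewrite vx vy vx' vy' /Q; lia.
have := Qf (n.+1%:Z, 0); rewrite /Q !wind_box //; rewrite /in_box /=; lia.
Qed.

Lemma plus_exists (u : V) : exists y : bdart n, connect (vadj S) u y.1 /\ plus y.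
Proof.
pose ht (v : V) : nat := absz ((val (val v)).2 + n%:Z).
case: (@arg_maxnP _ u (fun v => connect (vadj S) u v) ht (connect0 _ _)) => v uv vmax.
have htP (v' : V) : (ht v')%:Z = (val (val v')).2 + n%:Z.
  have : val v' \in V by exact: valP.
  by rewrite in_boxE /in_box /ht; case: (val (val v')) => a b /= /andP[_]; lia.
(* The upper side of a highest face of the cluster, run towards the West, has this face on its left.
   The loop has only faces of the cluster on its left, hence no vertical dart in the row above. *)
exists (v, West); split=> //; set y := (v, West).
suff above : W y (right_face (dart_of y)) = 0.
  by have := plus_wind_right (porbit_id s y); rewrite above; case: (plus y).
have Er : right_face (dart_of y) = ((val (val v)).1, (val (val v)).2 + 1).
  have -> : dart_of y = face_dart (val (val v)) West by rewrite -[LHS]face_dartK left_dart_of.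
  by rewrite /right_face /=; congr pair; lia.
rewrite Er; apply: big1 => i _; rewrite -dart_of_iter.
set y' := (s ^+ i)%g y; have yy : y' \in porbit s y by exact: mem_porbit.
have := vmax y'.1 (connect_trans uv (porbit_connect yy)) => le.
have : (val (val y'.1)).2 <= (val (val v)).2.
  by rewrite -(lerD2r n%:Z) -!htP lez_nat.
rewrite -left_dart_of; case: (val (val v)) => vx vy; case: (dart_of y') => [[a b] e].
by rewrite /vert /dart_row; case: e => /= le'; rewrite ?mul0r //; lia.
Qed.

Definition bd_loop (x : bdart n) : bool := [exists y in porbit s x, bd_dart y].

Lemma bd_loop_plus (x : bdart n) : bd_loop x -> plus x.
Proof.
by case/existsP => y /andP[yx /bd_plus py]; rewrite -(plus_porbit yx).
Qed.

Lemma bd_dart_boundary (y : bdart n) : bd_dart y -> y.1 \in boundary V.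
Proof.
move=> b; rewrite inE; apply/asboolP.
have po : is_primal (left_face (oppose (dart_of y))) by rewrite primal_oppose dart_of_primal.
exists (to_primal po); split; first by rewrite in_boxE bd_face.
apply: (@adj_corner _ _ (target (dart_of y))).
- by rewrite -val_eqE -left_dart_of; exact: left_face_oppose_neq.
- by rewrite -left_dart_of corner_target.
- by rewrite -target_oppose corner_target.
Qed.

Lemma boundary_bd_dart (u : V) : u \in boundary V -> exists d, bd_dart (u, d).
Proof.
rewrite inE => /asboolP[v [vV]]; rewrite /adj.
move=> /eqP h; have : corners (val (val u)) `&` corners (val v) != fset0.
  by rewrite -cardfs_gt0 h.
case/fset0Pn => z; rewrite in_fsetI => /andP[zu zv].
have [d Ed] := corner_dart zu; exists d; rewrite /bd_dart.
have -> : dart_of (u, d) = face_dart (val (val u)) d by rewrite -[LHS]face_dartK left_dart_of.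
rewrite Ed fin_edgesP; move: zv; rewrite corner_ends.
by case/orP=> /eqP E1; rewrite -E1 (negPf vV) ?andbF.
Qed.

Local Notation cl x := (conn_class (vadj S) x.1).

Lemma conn_class_eqE (u v : V) :
  (conn_class (vadj S) u == conn_class (vadj S) v) = connect (vadj S) u v.
Proof. by apply: conn_class_eq; exact: vadj_sym. Qed.

(** Every cluster has exactly one outer boundary, by [plus_exists] and [plus_unique]. *)
Lemma card_plus : #|porbit s @: [set x | plus x]%SET| = #|conn_classes (@vadj V S)|.
Proof.
rewrite (@card_imset_eq _ _ _ _ _ (fun x : bdart n => cl x)).
  congr #|pred_of_set _|; apply/setP => C; apply/imsetP/imsetP => [[x _ ->]|[u _ ->]].
    by exists x.1.
  have [y [uy py]] := plus_exists u; exists y; first by rewrite finset.in_set.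
  by apply/eqP; rewrite conn_class_eqE.
move=> x y; rewrite !finset.in_set => px py; rewrite conn_class_eqE eq_porbit_mem.
apply/idP/idP; last by move=> cxy; apply: plus_unique => //; rewrite conn_sym.
by rewrite conn_sym; exact: porbit_connect.
Qed.

(** Loops through boundary darts are outer boundaries, so that a cluster has at most one; it has one
    if it touches the boundary, as every boundary face has a boundary dart. *)
Lemma card_bd : #|porbit s @: [set x | bd_loop x]%SET| = k_bd V S.
Proof.
rewrite (@card_imset_eq _ _ _ _ _ (fun x : bdart n => cl x)); last first.
  move=> x y; rewrite !finset.in_set => /bd_loop_plus px /bd_loop_plus py.
  rewrite conn_class_eqE eq_porbit_mem; apply/idP/idP; last first.
    by move=> cxy; apply: plus_unique => //; rewrite conn_sym.
  by rewrite conn_sym; exact: porbit_connect.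
rewrite /k_bd /n_clusters; congr #|pred_of_set _|; apply/setP => C; rewrite !inE.
apply/imsetP/andP => [[x]|[/imsetP[u _ ->]]].
  rewrite inE => /existsP[y /andP[yx by_]] ->; split; first exact: imset_f.
  rewrite -/(touches S x.1).
  apply/touchesP; exists y.1; first exact: bd_dart_boundary.
  exact: porbit_connect.
rewrite -/(touches S u) => /touchesP[v /boundary_bd_dart[d bd] uv].
exists (v, d).
  by rewrite inE; apply/existsP; exists (v, d); rewrite porbit_id.
by apply/eqP; rewrite conn_class_eqE.
Qed.

End Orbits.

(** * The finite-volume orientation model *)

(** An invariant function is a free choice of one value per orbit; [h] and [h'] translate between
    the two descriptions. *)
Lemma sum_invariant (R : comNzRingType) (D : finType) (s : {perm D}) (phi : D -> bool -> R) :
  \sum_(t : {ffun D -> bool} | [forall x, t (s x) == t x]) \prod_x phi x (t x) =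
  \prod_(L in porbits s) \sum_(o : bool) \prod_(x in L) phi x o.
Proof.
rewrite (big_distr_big false (mem (porbits s)) predT (fun L o => \prod_(x in L) phi x o)).
pose h (f : {ffun {set D} -> bool}) : {ffun D -> bool} := [ffun x => f (porbit s x)].
pose h' (t : {ffun D -> bool}) : {ffun {set D} -> bool} :=
  [ffun L : {set D} => (L \in porbits s) && [exists x in L, t x]].
have inv (t : {ffun D -> bool}) x y : [forall x, t (s x) == t x] ->
    y \in porbit s x -> t y = t x.
  move=> /forallP ti /porbitP[i ->]; elim: i => [|i IHi]; first by rewrite expg0 perm1.
  by rewrite expgSr permM (eqP (ti _)).
have hx (t : {ffun D -> bool}) x : [forall x, t (s x) == t x] ->
    [exists y in porbit s x, t y] = t x.
  move=> ti; apply/existsP/idP => [[y /andP[yx ty]]|tx].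
    by rewrite -(inv t x y ti yx).
  by exists x; rewrite porbit_id.
rewrite (reindex_onto h h') => [|t ti]; last first.
  by apply/ffunP => x; rewrite !ffunE imset_f // hx.
have hinv f : [forall x, h f (s x) == h f x].
  apply/forallP => x; rewrite !ffunE; apply/eqP; congr (f _); apply/eqP.
  by rewrite eq_porbit_mem (mem_porbit s 1 x).
apply: eq_big => f.
  rewrite hinv /=; apply/eqP/pffun_onP => [<-|[supp _]].
    split; last by [].
    by apply/fintype.subsetP => L; rewrite inE /= ffunE; case: (L \in porbits s).
  apply/ffunP => L; rewrite ffunE; have [/imsetP[x _ ->]|nL] /= := boolP (L \in porbits s).
    by rewrite hx // ffunE.
  by apply/esym/negbTE/negP => fL; case/negP: nL; apply: (fintype.subsetP supp); rewrite inE /= fL.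
move=> _; rewrite (partition_big (porbit s) (mem (porbits s))) /=; last first.
  by move=> x _; exact: imset_f.
apply: eq_bigr => L /imsetP[x _ ->]; apply: eq_big => y; last first.
  by move=> /eqP E; rewrite ffunE E.
by rewrite eq_porbit_mem.
Qed.

Section PartitionFunction.
Variables (R : realType) (n : nat) (S : {fset vertex}).
Local Notation V := (box n).
Local Notation E := (fin_edges (box n)).
Hypothesis SE : S `<=` E.
Local Notation s := (loop_perm SE).
Implicit Types (lam : R) (t : {ffun bdart n -> bool}) (x : bdart n).

Definition rot_weight lam (A : {fset vertex}) t : R :=
  expR (lam / 4 * (rotation A t)%:~R).

Definition admissible (A : {fset vertex}) t : bool := coh A t && bd_ok t.

(** The darts of the box arriving at an edge of the box are two opposite ones. *)
Lemma card_targets : #|[pred x : bdart n | target (dart_of x) \in S]| = (2 * #|` S|)%N.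
Proof.
have two z : z \in E -> #|[pred x : bdart n | target (dart_of x) == z]| = 2%N.
  move=> zE; have : pend1 z \in V by move: zE; rewrite fin_edgesP => /andP[].
  move=> uV; pose u : V := [` uV].
  have [d Ed] : exists d, target (face_dart (val (val u)) d) = z.
    by apply: corner_dart; rewrite corner_ends eqxx.
  pose x : bdart n := (u, d).
  have Ex : target (dart_of x) = z.
    have -> : dart_of x = face_dart (val (val u)) d by rewrite -[LHS]face_dartK left_dart_of.
    by [].
  have nb : ~~ bd_dart x by rewrite /bd_dart Ex zE.
  have nx : opp_bdart x != x.
    by rewrite -(inj_eq (@dart_of_inj n)) opp_bdartE // oppose_neq.
  rewrite (_ : 2%N = #|[set opp_bdart x; x]%SET|); last by rewrite cards2 nx.
  apply: eq_card => y; rewrite !inE.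
  apply/eqP/orP => [Ey|[]/eqP->]; rewrite ?target_opp_bdart //.
  have [] := @same_target (dart_of x) (dart_of y); rewrite ?Ex ?dart_of_primal //.
    by move=> /dart_of_inj ->; right.
  by rewrite -opp_bdartE // => /dart_of_inj ->; left.
rewrite -sum1_card; under eq_bigl do rewrite inE.
rewrite big_mkcond /=.
transitivity (\sum_(x : bdart n) \sum_(z <- S) (target (dart_of x) == z : nat))%N.
  apply: eq_bigr => x _; case: ifP => [zS|/negP zS].
    rewrite (big_rem _ zS) /= eqxx big_seq big1 ?addn0 // => z.
    rewrite mem_rem_uniq ?fset_uniq // inE => /andP[nz _].
    by rewrite eq_sym (negPf nz).
  by rewrite big_seq big1 // => z zS'; case: eqP => // Ez; case: zS; move: zS'; rewrite -Ez.
rewrite exchange_big /=; transitivity (\sum_(z <- S) 2)%N.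
  apply: eq_big_seq => z zS; rewrite -(two z); last exact: (fsubsetP SE).
  by rewrite -sum1_card [in RHS]big_mkcond /=; apply: eq_bigr => x _; rewrite inE; case: eqP.
by rewrite big_const_seq count_predT iter_addn_0.
Qed.

Lemma loop_turn_total : \sum_(x : bdart n) bturn S x = 4 * #|` V|%:Z - 4 * #|` S|%:Z.
Proof.
have -> : \sum_(x : bdart n) bturn S x =
    \sum_(x : bdart n) (1 - 2 * ((target (dart_of x) \in S) : nat)%:Z).
  by apply: eq_bigr => x _; rewrite bturnE; case: (_ \in S).
rewrite sumrB -mulr_sumr sumr_const -[1 *+ _]mulr_natr mul1r natz.
have -> : \sum_(x : bdart n) ((target (dart_of x) \in S) : nat)%:Z = (2 * #|` S|)%N%:Z.
  rewrite -card_targets -sum1_card [in RHS]big_mkcond /= -natz natr_sum.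
  by apply: eq_bigr => x _; rewrite inE; case: (_ \in S).
have -> : #|{: bdart n}| = (#|` V| * 4)%N by rewrite card_prod card_dir -cardfE.
lia.
Qed.

Definition bd_orbit (L : {set bdart n}) : bool := [exists y in L, bd_dart y].
Definition plus_orbit (L : {set bdart n}) : bool := [exists y in L, plus S y].

Lemma plus_orbitE x : plus_orbit (porbit s x) = plus S x.
Proof.
apply/existsP/idP => [[y /andP[/(plus_porbit (SE := SE)) <-]]|px] //.
by exists x; rewrite porbit_id.
Qed.

Lemma card_plus_orbits :
  #|[set L in porbits s | plus_orbit L]%SET| = (k_wired V S + k_bd V S)%N.
Proof.
have -> : [set L in porbits s | plus_orbit L]%SET = (porbit s @: [set x | plus S x]%SET).
  apply/setP => L; rewrite finset.in_set; apply/andP/imsetP => [[/imsetP[x _ ->]]|[x]].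
    by rewrite plus_orbitE => px; exists x; rewrite // finset.in_set.
  by rewrite finset.in_set => px ->; rewrite plus_orbitE px imset_f.
rewrite card_plus k_wiredE /k_bd /n_clusters.
rewrite -(cardsID [set C | @inner V C]%SET); congr (_ + _)%N; apply: eq_card => C.
  by rewrite !finset.in_set.
by rewrite !finset.in_set andbC.
Qed.

Lemma card_bd_orbits : #|[set L in porbits s | bd_orbit L]%SET| = k_bd V S.
Proof.
rewrite -(card_bd SE); apply: eq_card => L; rewrite finset.in_set.
apply/andP/imsetP => [[/imsetP[x _ ->] b]|[x]].
  by exists x; rewrite // finset.in_set.
by rewrite finset.in_set => bx ->; rewrite imset_f.
Qed.

(* Euler's formula, as the total number of turns is 4 for each loop with sign
   plus, of which there is one per cluster, and - 4 for each other loop. *)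
Lemma euler : (#|porbits s| + #|` V|)%N =
  (2 * (k_wired V S + k_bd V S) + #|` S|)%N.
Proof.
have := loop_turn_total.
rewrite (partition_big (porbit s) (mem (porbits s))) /=; last by move=> x _; exact: imset_f.
rewrite (eq_bigr (fun L => if plus_orbit L then 4 else - 4)); last first.
  move=> _ /imsetP[x _ ->]; rewrite plus_orbitE -(loop_turn SE x).
  by apply: eq_bigl => y; rewrite eq_porbit_mem.
rewrite (bigID plus_orbit) /= (eq_bigr (fun=> 4)) => [|L /andP[_ ->] //].
rewrite [X in _ + X](eq_bigr (fun=> - 4)) => [|L /andP[_ /negPf-> //]].
rewrite !sumr_const mulNrn -![4 *+ _]mulr_natr !natz.
have -> : #|[pred L in porbits s | plus_orbit L]| = (k_wired V S + k_bd V S)%N.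
  by rewrite -card_plus_orbits; apply: eq_card => L; rewrite finset.in_set.
have := cardID [pred L | plus_orbit L] (mem (porbits s)).
rewrite (_ : #|[predI _ & _]| = (k_wired V S + k_bd V S)%N); last first.
  rewrite -card_plus_orbits; apply: eq_card => L; rewrite finset.in_set !inE.
  by rewrite andbC.
have <- : #|[pred L in porbits s | ~~ plus_orbit L]| = #|[predD mem (porbits s) & [pred L | plus_orbit L]]|.
  by apply: eq_card => L; rewrite !inE andbC.
move: #|[pred L in porbits s | ~~ plus_orbit L]| => m Ec Et.
have {}Et : 4 * (k_wired V S + k_bd V S)%N%:Z - 4 * m%:Z =
  4 * #|` V|%:Z - 4 * #|` S|%:Z by exact: Et.
rewrite -Ec; move: Et; move: (k_wired V S) (k_bd V S) #|` V| #|` S|.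
by clear; move=> a b c d; lia.
Qed.

(** The sum factorises over the loops, whose rotations are 4 or - 4. A free loop contributes both
    exponentials; a loop through a boundary dart has sign plus and must be run forwards, which
    leaves [expR lam]. *)
Lemma sum_rot_weight lam :
  \sum_(t | admissible S t) rot_weight lam S t =
  expR lam ^+ k_bd V S *
  (expR lam + expR (- lam)) ^+ (#|porbits s| - k_bd V S).
Proof.
pose phi (x : bdart n) (o : bool) : R :=
  if bd_dart x ==> o then expR (lam / 4 * (bturn S x * sgb o)%:~R) else 0.
transitivity (\sum_(t : {ffun bdart n -> bool} | [forall x, t (s x) == t x])
    \prod_x phi x (t x)).
  rewrite [RHS](bigID (@bd_ok n)) /= [X in _ = _ + X]big1 ?addr0; last first.
    move=> t /andP[_ /forallPn[x nx]].
    by rewrite (bigD1 x) //= /phi (negPf nx) mul0r.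
  apply: eq_big => [t|t /andP[_ /forallP bt]].
    rewrite /admissible /coh; congr (_ && _).
    by apply: eq_forallb => x; rewrite permE.
  rewrite /rot_weight /rotation rmorph_sum mulr_sumr expR_sum.
  by apply: eq_bigr => x _; rewrite /phi bt.
rewrite sum_invariant (eq_bigr (fun L => if bd_orbit L then expR lam
    else expR lam + expR (- lam))); last first.
  move=> _ /imsetP[x _ ->]; rewrite big_bool /=.
  have E1 o : ~~ bd_orbit (porbit s x) || o -> \prod_(y in porbit s x) phi y o =
      expR (lam / 4 * ((if plus S x then 4 else - 4) * sgb o)%:~R).
    move=> ok; rewrite -(loop_turn SE x) mulr_suml rmorph_sum mulr_sumr expR_sum.
    apply: eq_bigr => y yx; rewrite /phi; case: o ok => /=; rewrite ?implybT // orbF.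
    case: (boolP (bd_dart y)) => //= by_ /negP[].
    by apply/existsP; exists y; rewrite yx.
  rewrite E1 ?orbT //; have l4 : lam / 4 * 4 = lam by rewrite divfK.
  have [bx|bx] := boolP (bd_orbit (porbit s x)).
    have pl : plus S x = true := @bd_loop_plus _ _ SE x bx.
    rewrite pl.
    rewrite [X in _ + X](_ : _ = 0) ?addr0 /sgb ?mulr1 ?l4 //.
    case/existsP: bx => y /andP[yx by_]; rewrite (bigD1 y) //=.
    by rewrite /phi by_ /= mul0r.
  rewrite E1 ?bx // /sgb; case: (plus S x); rewrite ?mulr1 ?mulrN1 ?opprK ?rmorphN ?mulrN ?l4 //.
  by rewrite addrC.
rewrite (bigID bd_orbit) /= (eq_bigr (fun=> expR lam)) => [|L /andP[_ ->] //].
rewrite [X in _ * X](eq_bigr (fun=> expR lam + expR (- lam))) => [|L /andP[_ /negPf-> //]].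
rewrite !prodr_const; congr (_ ^+ _ * _ ^+ _).
  by rewrite -card_bd_orbits; apply: eq_card => L; rewrite finset.in_set.
rewrite -(cardID [pred L | bd_orbit L] (mem (porbits s))) -card_bd_orbits.
rewrite (_ : #|[predI _ & _]| = #|[set L in porbits s | bd_orbit L]%SET|); last first.
  by apply: eq_card => L; rewrite finset.in_set !inE andbC.
by rewrite addKn; apply: eq_card => L; rewrite !inE andbC.
Qed.

(** By Euler's formula, [x] to the number of loops is a constant times [x] to the number of open
    edges and [x ^+ 2] to the number of clusters. A boundary cluster has a loop of weight [expR lam]
    in place of [x], so that its weight becomes [x * expR lam]. *)
Lemma partition_fk lam : let x := expR lam + expR (- lam) in
  x ^+ #|` V| * \sum_(t | admissible S t) rot_weight lam S t =
  fk_weight x (x ^+ 2) V (x * expR lam) S.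
Proof.
cbv zeta; rewrite sum_rot_weight /fk_weight.
have le : (k_bd V S <= #|porbits s|)%N.
  rewrite -card_bd_orbits; apply: subset_leq_card; apply/fintype.subsetP => L.
  by rewrite finset.in_set => /andP[].
have := euler; set x := (expR lam + _); move=> eul.
rewrite mulrCA -exprD -[x ^+ 2 ^+ _]exprM exprMn [RHS]mulrA [RHS]mulrC; congr (_ * _).
rewrite -!exprD; congr (_ ^+ _); lia.
Qed.

Definition flip_loop x t : {ffun bdart n -> bool} :=
  [ffun y => t y (+) (y \in porbit s x)].

Lemma flip_loopK x : involutive (flip_loop x).
Proof. by move=> t; apply/ffunP => y; rewrite !ffunE -addbA addbb addbF. Qed.

Lemma admissible_const x t y : admissible S t -> y \in porbit s x -> t y = t x.
Proof.
case/andP => /forallP ti _ /porbitP[i ->]; elim: i => [|i IHi].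
  by rewrite expg0 perm1.
by rewrite expgSr permM permE (eqP (ti _)).
Qed.

Lemma admissible_flip x t : ~~ bd_orbit (porbit s x) -> admissible S t ->
  admissible S (flip_loop x t).
Proof.
move=> nbx /andP[/forallP ti /forallP bt]; apply/andP; split; apply/forallP => y.
  rewrite !ffunE (eqP (ti y)); apply/eqP; congr (_ (+) _).
  rewrite -(permE (@next_bdart_inj n S SE)) -/s -!eq_porbit_mem; congr (_ == _).
  by apply/eqP; rewrite eq_porbit_mem (mem_porbit s 1 y).
rewrite ffunE; apply/implyP => by_; have := bt y; rewrite by_ /= => ->.
rewrite (_ : _ \in _ = false) //; apply/negP => yx; case/negP: nbx.
by apply/existsP; exists y; rewrite yx.
Qed.

Lemma rotation_flip_loop x t : admissible S t ->
  rotation S (flip_loop x t) =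
  rotation S t - 2 * sgb (t x) * (if plus S x then 4 else - 4).
Proof.
move=> at_; rewrite -(loop_turn SE x) /rotation mulr_sumr.
rewrite [X in _ = _ - X]big_mkcond -sumrB; apply: eq_bigr => y _; rewrite ffunE.
case: ifP => yx; last by rewrite addbF subr0.
by rewrite addbT (admissible_const at_ yx); case: (t x); rewrite /sgb /=; ring.
Qed.

(** Reversing the loop of [x] preserves [c] and, from true to false, multiplies the weight by
    [expR (- (2 * ep))], where [ep] is [lam] or [- lam] according to the sign of the loop. So both
    values have masses in the ratio of [expR ep] to [expR (- ep)]. *)
Lemma sum_rot_weight_loop lam x (o : bool) (c : pred {ffun bdart n -> bool}) :
  ~~ bd_orbit (porbit s x) -> (forall t, c (flip_loop x t) = c t) ->
  \sum_(t | admissible S t && c t && (t x == o)) rot_weight lam S t =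
  orientation_prob lam (o == plus S x) *
  \sum_(t | admissible S t && c t) rot_weight lam S t.
Proof.
move=> nbx cflip.
pose A o := \sum_(t | admissible S t && c t && (t x == o)) rot_weight lam S t.
pose ep : R := if plus S x then lam else - lam.
have flipE : A false = A true * expR (- (2 * ep)).
  rewrite /A (reindex_inj (inv_inj (flip_loopK x))) /= mulr_suml.
  apply: eq_big => t.
    rewrite cflip ffunE porbit_id addbT.
    have -> : admissible S (flip_loop x t) = admissible S t.
      by apply/idP/idP => /(admissible_flip nbx); rewrite ?flip_loopK.
    by case: (t x).
  case/andP=> /andP[+ _]; rewrite ffunE porbit_id addbT => af tx.
  have at_ : admissible S t by have := admissible_flip nbx af; rewrite flip_loopK.
  have {}tx : t x = true by move: tx; case: (t x).
  rewrite /rot_weight rotation_flip_loop // tx -expRD; congr expR.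
  by rewrite /ep /sgb mulr1; case: (plus S x); rewrite rmorphB rmorphM /=; field.
have total : \sum_(t | admissible S t && c t) rot_weight lam S t = A true + A false.
  rewrite (bigID (fun t : {ffun bdart n -> bool} => t x)) /=; congr (_ + _).
    by apply: eq_bigl => t; rewrite eqb_id.
  by apply: eq_bigl => t; rewrite eqbF_neg.
have h1 : expR ep != 0 by rewrite gt_eqF // expR_gt0.
have h2 : expR lam + expR (- lam) != 0 by rewrite gt_eqF // addr_gt0 // expR_gt0.
have hs : expR lam + expR (- lam) = expR ep + expR (- ep).
  by rewrite /ep; case: (plus S x); rewrite ?opprK // addrC.
have Etrue : A true = expR ep / (expR lam + expR (- lam)) * (A true + A false).
  apply: (mulIf h2); rewrite mulrAC divfK // flipE hs.
  have -> : - (2 * ep) = - ep - ep by ring.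
  rewrite expRD expRN; field; exact: h1.
have Efalse : A false = expR (- ep) / (expR lam + expR (- lam)) * (A true + A false).
  apply: (mulIf h2); rewrite mulrAC divfK // flipE hs.
  have -> : - (2 * ep) = - ep - ep by ring.
  rewrite expRD expRN; field; exact: h1.
rewrite total -/(A o) /orientation_prob; case: o.
  by rewrite {1}Etrue /ep; case: (plus S x).
by rewrite {1}Efalse /ep; case: (plus S x); rewrite ?opprK.
Qed.

End PartitionFunction.

(** * Symmetry of the law of the orientation *)

Section Marginal.
Variables (R : realType) (n : nat).
Local Notation E := (fin_edges (box n)).

Definition marginal (lam : R) (t : {ffun bdart n -> bool}) : R :=
  \sum_(A <- fpowerset E) (if admissible A t then rot_weight lam A t else 0).

(** The sum is reindexed by toggling at the flippable vertices of [t], which turns the rotation into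
    its negative up to a constant. The resulting factor does not depend on [t] and cancels in
    [nu]. *)
Lemma marginal_sym (lam : R) (t : {ffun bdart n -> bool}) :
  marginal lam t = expR (lam / 2 * (n_bd n)%:R) * marginal (- lam) t.
Proof.
rewrite /marginal mulr_sumr.
have [bt|nbt] := boolP (bd_ok t); last first.
  by rewrite !big1 // => A _; rewrite /admissible (negPf nbt) andbF // mulr0.
pose F A := if admissible A t then rot_weight lam A t else 0.
have -> : \sum_(A <- fpowerset E) (if admissible A t then rot_weight lam A t else 0) =
    \sum_(A <- fpowerset E) F (symdiff A (flippable t)).
  rewrite -(big_map (fun A => symdiff A (flippable t)) xpredT F).
  apply: perm_big; apply: uniq_perm; first exact: fset_uniq.
    rewrite map_inj_uniq ?fset_uniq //; exact: inv_inj (symdiffK _).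
  move=> A; rewrite fpowersetE; apply/idP/mapP => [AE|[B + ->]].
    exists (symdiff A (flippable t)); last by rewrite symdiffK.
    by rewrite fpowersetE symdiff_sub.
  by rewrite fpowersetE; exact: symdiff_sub.
rewrite big_seq [RHS]big_seq; apply: eq_bigr => A; rewrite fpowersetE => AE.
have cE : coh (symdiff A (flippable t)) t = coh A t.
  apply/idP/idP => [/(coh_flip (symdiff_sub t AE))|/(coh_flip AE) //].
  by rewrite symdiffK.
rewrite /F /admissible cE bt andbT; case: ifP => _; last by rewrite mulr0.
rewrite /rot_weight rotation_flip // -expRD; congr expR.
by rewrite rmorphB rmorphM /= -pmulrn; field.
Qed.

End Marginal.

(** * Local events *)

Local Open Scope fset_scope.
Local Open Scope classical_set_scope.
Local Open Scope ring_scope.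

Section Cylinders.
Variable I : choiceType.
Implicit Types (W : {fset I}) (w : I -> bool).

Lemma measurable_coord (z : I) (b : bool) : measurable [set w : bfield I | w z = b].
Proof.
have mt : measurable [set w : bfield I | w z = true].
  by apply: sub_sigma_algebra; exists z.
case: b => //; rewrite (_ : [set _ | _] = ~` [set w : bfield I | w z = true]).
  exact: measurableC.
by apply/seteqP; split=> w /=; case: (w z).
Qed.

Lemma measurable_cylinder (s : seq I) (c : I -> bool) :
  measurable [set w : bfield I | forall z, z \in s -> w z = c z].
Proof.
elim: s => [|z s IHs].
  by rewrite (_ : [set _ | _] = setT) //; apply/seteqP; split.
rewrite (_ : [set _ | _] = [set w : bfield I | w z = c z] `&`
    [set w : bfield I | forall z, z \in s -> w z = c z]).
  by apply: measurableI => //; exact: measurable_coord.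
apply/seteqP; split=> w /= => [H|[Hz Hs] y].
  by split=> [|y ys]; apply: H; rewrite inE ?eqxx ?ys ?orbT.
by rewrite inE => /orP[/eqP->|/Hs].
Qed.

Definition pattern W (pi : {fset I}) : set (bfield I) :=
  [set w | forall z, z \in W -> w z = (z \in pi)].

Lemma measurable_pattern W pi : measurable (pattern W pi).
Proof. exact: (measurable_cylinder W (fun z => z \in pi)). Qed.

Definition depends_on W (A : set (bfield I)) : Prop :=
  forall w w', (forall z, z \in W -> w z = w' z) -> A w -> A w'.

Definition indicator_of (pi : {fset I}) : bfield I := fun z => z \in pi.

Lemma depends_on_pattern W A : depends_on W A -> A =
  \big[setU/set0]_(pi <- fpowerset W | `[< A (indicator_of pi) >]) pattern W pi.
Proof.
move=> loc; apply/seteqP; split=> w.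
  move=> Aw; pose pi := [fset z in W | w z].
  have wpi z : z \in W -> w z = (z \in pi) by move=> zW; rewrite !inE zW.
  rewrite -bigcup_seq_cond; exists pi => //=.
  rewrite fpowersetE; apply/andP; split.
    by apply/fsubsetP => z; rewrite !inE => /andP[].
  by apply/asboolP; apply: loc Aw => z zW; rewrite wpi.
rewrite -bigcup_seq_cond => -[pi /= /andP[_ /asboolP Api] wpi].
by apply: loc Api => z zW; rewrite wpi.
Qed.

Lemma measurable_depends_on W A : depends_on W A -> measurable A.
Proof.
move=> /depends_on_pattern ->; apply: bigsetU_measurable => pi _.
exact: measurable_pattern.
Qed.

(** The mass of [X] is split according to the state of the window [W]; [phi] will be the identity,
    or the projection of a coupling to its configuration. *)
Lemma sum_pattern (R : realType) d (T : measurableType d) (m : probability T R)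
    (phi : T -> bfield I) (X : set T) W :
  measurable_fun setT phi -> measurable X ->
  fine (m X) = \sum_(pi <- fpowerset W) fine (m (X `&` phi @^-1` pattern W pi)).
Proof.
move=> mphi; elim/fset1U_rect: W X => [|z W zW IHW] X mX.
  rewrite fpowerset0 big_seq_fset1 (_ : _ @^-1` _ = setT) ?setIT //.
  by apply/seteqP; split.
have mpre (A : set (bfield I)) : measurable A -> measurable (phi @^-1` A).
  by move=> mA; rewrite -[_ @^-1` _]setTI; exact: mphi.
rewrite sum_fpowersetU1 // (IHW X mX) big_seq [RHS]big_seq; apply: eq_bigr => pi.
rewrite fpowersetE => piW.
have zpi : z \notin pi by apply: contra zW; exact: (fsubsetP piW).
pose Y := X `&` phi @^-1` pattern W pi.
have mY : measurable Y by apply: measurableI => //; exact: mpre (measurable_pattern _ _).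
pose Z b := phi @^-1` [set w : bfield I | w z = b].
have mZ b : measurable (Z b) by exact: mpre (measurable_coord _ _).
have E0 : X `&` phi @^-1` pattern (z |` W)%fset pi = Y `&` Z false.
  apply/seteqP; split=> y /=.
    move=> [Xy H]; split; last by rewrite /Z /= H ?(negPf zpi) // !inE eqxx.
    by split=> // t tW; apply: H; rewrite !inE tW orbT.
  move=> [[Xy H] Hz]; split=> // t; rewrite !inE => /orP[/eqP->|/H //].
  by rewrite Hz (negPf zpi).
have E1 : X `&` phi @^-1` pattern (z |` W)%fset (z |` pi)%fset = Y `&` Z true.
  apply/seteqP; split=> y /=.
    move=> [Xy H]; split; last by rewrite /Z /= H ?inE ?eqxx // !inE eqxx.
    split=> // t tW; rewrite H ?inE ?tW ?orbT //.
    by case: eqP tW zW => // -> ->.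
  move=> [[Xy H] Hz]; split=> // t; rewrite !inE => /orP[/eqP->|tW].
    by rewrite Hz eqxx.
  by rewrite (H t tW); case: eqP tW zW => // -> ->.
rewrite E0 E1 -fineD ?fin_num_measure //; try exact: measurableI.
rewrite -measureU //; try exact: measurableI; last first.
  by apply/seteqP; split=> y //= [[_ h0] [_ h1]]; rewrite /Z /= h0 in h1.
congr (fine (m _)); rewrite -setIUr -/Y; apply/seteqP; split=> y; last by case.
by move=> Yy; split=> //; rewrite /Z /=; case: (phi y z); [right|left].
Qed.

(** In the product topology, the finitely many coordinates in [W] are constant near any point. *)
Lemma depends_on_continuous (R : realType) W (A : set (bfield I)) :
  depends_on W A ->
  continuous ((fun w => (`[< A w >])%:R) : {ptws I -> bool} -> R).
Proof.
move=> loc w; apply: cvg_near_cst.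
have nearW : \forall v \near (w : {ptws I -> bool}), forall z, z \in W -> v z = w z.
  elim/fset1U_rect: W {loc} => [|z W zW IHW]; first by near=> v.
  have nz : \forall v \near (w : {ptws I -> bool}), v z = w z.
    have := @proj_continuous I (fun=> bool) z w.
    move=> /(_ [set w z]) /=; apply.
    by rewrite nbhs_principalE; apply/principal_filterP.
  near=> v; have vW : forall y, y \in W -> v y = w y by near: v; exact: IHW.
  by move=> y; rewrite !inE => /orP[/eqP->|/vW //]; near: v.
near=> v; have vW : forall z, z \in W -> v z = w z by near: v.
congr (nat_of_bool _)%:R; apply/asboolP/asboolP; apply: loc => z zW; by rewrite vW.
Unshelve. all: by end_near. Qed.

End Cylinders.

Lemma Rintegral_asbool (R : realType) (P : probability config R) (A : set config) :
  measurable A -> (\int[P]_w (`[< A w >])%:R)%R = fine (P A) :> R.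
Proof.
move=> mA; rewrite /Rintegral; congr fine.
rewrite -[A in RHS]setIT -integral_indic //; apply: eq_integral => w _.
Qed.

(** * The wired measure as a limit along boxes *)

Section Wired.
Variables (R : realType) (q : R) (P : probability config R).
Hypotheses (q_gt1 : 1 < q) (Pw : is_wired_measure (p_c q) q P).
Local Notation x := (Num.sqrt q).

Lemma sqrt_gt1 : 1 < x.
Proof. by rewrite -[1]sqrtr1 ltr_sqrt // (lt_trans ltr01). Qed.

Definition wired_prob (n : nat) (A : set config) : R :=
  fk_sum x q (box n) 1 (fun S => (`[< A (conf S) >])%:R) /
  fk_sum x q (box n) 1 (fun=> 1).

(** At [p_c q] the ratio of p to 1 - p is the square root of [q], and the powers of 1 - p add up to
    a constant. *)
Lemma rc_weight_fk (V : {fset primal}) (S : {fset vertex}) : (S `<=` fin_edges V)%fset ->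
  rc_weight (p_c q) q V S =
  (1 - p_c q) ^+ #|` fin_edges V| * fk_weight x q V 1 S.
Proof.
move=> SE; rewrite /rc_weight /fk_weight expr1n mulr1.
have x0 : 0 < x := lt_trans ltr01 sqrt_gt1.
have x1 : 1 + x != 0 by rewrite gt_eqF // addr_gt0.
have -> : 1 - p_c q = (1 + x)^-1 by rewrite /p_c; field.
have -> : p_c q = x * (1 + x)^-1 by [].
have -> : #|` fin_edges V| = (#|` S| + #|` (fin_edges V `\` S)%fset|)%N.
  by rewrite -(cardfsID S) (fsetIidPr _).
rewrite exprMn exprD; move: (x ^+ _) (_^-1 ^+ _) (_^-1 ^+ _) (q ^+ _) => a b c e.
ring.
Qed.

Lemma wired_expectationE (V : {fset primal}) (f : config -> R) :
  wired_expectation (p_c q) q V f =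
  fk_sum x q V 1 (fun S => f (conf S)) / fk_sum x q V 1 (fun=> 1).
Proof.
have x0 : 0 < x := lt_trans ltr01 sqrt_gt1.
have [c [c0 Ec]] : exists c : R, c != 0 /\ c = (1 - p_c q) ^+ #|` fin_edges V|.
  exists ((1 - p_c q) ^+ #|` fin_edges V|); split=> //.
  rewrite expf_neq0 // /p_c (_ : 1 - _ = (1 + x)^-1).
    by rewrite invr_eq0 gt_eqF // addr_gt0.
  by field; rewrite gt_eqF // addr_gt0.
have E1 : \sum_(S <- fpowerset (fin_edges V))
      rc_weight (p_c q) q V S * f (fun z => z \in S) =
    c * fk_sum x q V 1 (fun S => f (conf S)).
  rewrite /fk_sum mulr_sumr; apply: eq_big_seq => S; rewrite fpowersetE => SE.
  by rewrite rc_weight_fk // -Ec mulrA.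
have E2 : \sum_(S <- fpowerset (fin_edges V)) rc_weight (p_c q) q V S =
    c * fk_sum x q V 1 (fun=> 1).
  rewrite /fk_sum mulr_sumr; apply: eq_big_seq => S; rewrite fpowersetE => SE.
  by rewrite rc_weight_fk // -Ec mulr1.
by rewrite /wired_expectation E1 E2 invfM mulrACA mulfV // mul1r.
Qed.

(** Boxes are cofinal among the finite sets of vertices, so that the limit along the latter can be
    taken along boxes. *)
Lemma box_cvg : box n @[n --> \oo] --> (@totally primal).
Proof.
move=> A [V0 _ V0A]; have [N HN] : exists N, forall n, (N <= n)%N -> (V0 `<=` box n)%fset.
  elim/fset1U_rect: V0 {V0A} => [|f V0 _ [N HN]]; first by exists 0%N => n _; exact: fsub0set.
  exists (N + absz (val f).1 + absz (val f).2)%N => n le.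
  rewrite fsubUset fsub1set HN ?andbT; last by lia.
  by rewrite in_boxE /in_box; case: (val f) le => a b /=; lia.
by exists N => // n /= le; apply: V0A; exact: HN.
Qed.

Lemma wired_prob_cvg (W : {fset vertex}) (A : set config) : depends_on W A ->
  wired_prob n A @[n --> \oo] --> fine (P A).
Proof.
move=> loc; rewrite -Rintegral_asbool; last exact: measurable_depends_on loc.
have := cvg_comp _ _ box_cvg (Pw (depends_on_continuous (R := R) loc)).
apply: cvg_trans; apply: near_eq_cvg; near=> n.
by rewrite /= wired_expectationE.
Unshelve. all: by end_near. Qed.

End Wired.

(** * Absence of percolation *)

Definition win_vertex (r : nat) (p : 'I_(2 * r).+1 * 'I_(2 * r).+1) : vertex :=
  (p.1%:Z - r%:Z, p.2%:Z - r%:Z).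

Definition win (r : nat) : {fset vertex} :=
  [fset win_vertex p | p in [set: 'I_(2 * r).+1 * 'I_(2 * r).+1]%SET].

Lemma in_win (r : nat) (z : vertex) : (z \in win r) = in_box r z.
Proof.
apply/imfsetP/idP => [[[[i li] [j lj]] _ ->]|]; first by rewrite /in_box /=; lia.
case: z => [u v]; rewrite /in_box /= => /andP[hu hv].
have lu : (absz (u + r%:Z)%R < (2 * r).+1)%N by lia.
have lv : (absz (v + r%:Z)%R < (2 * r).+1)%N by lia.
exists (Ordinal lu, Ordinal lv); first by rewrite /= finset.in_setT.
by rewrite /win_vertex /=; congr pair; lia.
Qed.

(** Steps must start in the box, so that a path can leave it by its last step only, and [escapes]
    depends on a finite window. *)
Definition box_adj (N : nat) (w : vertex -> bool) : rel primal :=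
  fun f g => in_box N (val f) && open_adj w f g.

Definition escapes (N : nat) (u : primal) : set config :=
  [set w | exists s, path (box_adj N w) u s /\ ~~ in_box N (val (last u s))].

Lemma escapes_path (N : nat) (u : primal) (w : config) (s : seq primal) :
  path (open_adj w) u s -> ~~ in_box N (val (last u s)) -> escapes N u w.
Proof.
elim: s u => [|f s IHs] u /=; first by exists [::].
case/andP => uf pth out; have [inu|outu] := boolP (in_box N (val u)).
  have [s' [p' o']] := IHs f pth out; exists (f :: s'); split=> //=.
  by rewrite p' /box_adj inu uf.
by exists [::].
Qed.

Lemma escapes_open (N : nat) (u : primal) (w : config) : escapes N u w ->
  exists s, path (open_adj w) u s /\ ~~ in_box N (val (last u s)).
Proof.
case=> s [p o]; exists s; split=> //; apply: sub_path p => f g.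
by case/andP.
Qed.

Lemma in_box_le (M N : nat) (f : face) : (M <= N)%N -> in_box M f -> in_box N f.
Proof. by rewrite /in_box => le /andP[h1 h2]; lia. Qed.

Lemma escapes_le (M N : nat) (u : primal) : (M <= N)%N -> escapes N u `<=` escapes M u.
Proof.
move=> le w /escapes_open[s [p o]]; apply: escapes_path p _.
by apply: contra o; exact: in_box_le.
Qed.

Lemma corner_win (N : nat) (f : face) (z : vertex) :
  in_box N f -> z \in corners f -> z \in win N.+1.
Proof. by rewrite in_win in_corners /in_box; case: f z => [a b] [c d] /=; lia. Qed.

Lemma depends_on_escapes (N : nat) (u : primal) : depends_on (win N.+1) (escapes N u).
Proof.
move=> w w' ww' [s [p o]]; exists s; split=> //; apply: sub_path p => f g.
rewrite /box_adj => /andP[inf]; rewrite inf => /open_adjP[z [zf zg wz]].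
by apply/open_adjP; exists z; split=> //; rewrite -ww' // (corner_win inf zf).
Qed.

Lemma finite_box (A : set primal) : finite_set A ->
  exists N, forall f, A f -> in_box N (val f).
Proof.
move=> /finite_fsetP[B ->].
elim/fset1U_rect: B => [|f B _ [N HN]]; first by exists 0%N.
exists (N + absz (val f).1 + absz (val f).2)%N => g /=.
rewrite !inE => /orP[/eqP->|/HN]; last by apply: in_box_le; lia.
by rewrite /in_box; case: (val f) => a b /=; lia.
Qed.

Lemma percolatesE (u : primal) : percolates u = \bigcap_N escapes N u.
Proof.
apply/seteqP; split=> w.
  move=> inf N _; apply: contrapT => nesc; apply: inf.
  apply: (@sub_finite_set _ _ [set` box N]); last exact: finite_fset.
  move=> g [s [p <-]] /=; rewrite in_boxE; apply/negPn/negP => out.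
  by apply: nesc; exact: escapes_path p out.
move=> esc /finite_box[N HN]; have [s [p /negP[]]] := escapes_open (esc N I).
by apply: HN; exists s.
Qed.

Section Percolation.
Variables (R : realType) (q : R) (P : probability config R).
Hypotheses (q_gt1 : 1 < q) (Pw : is_wired_measure (p_c q) q P).
Local Notation x := (Num.sqrt q).

Let x_gt0 : 0 < x := lt_trans ltr01 (sqrt_gt1 q_gt1).
Let q_ge1 : 1 <= q := ltW q_gt1.
Let q_gt0 : 0 < q := lt_trans ltr01 q_gt1.

Lemma escapes_cvg (u : primal) :
  fine (P (escapes N u)) @[N --> \oo] --> fine (P (percolates u)).
Proof.
have mE N : measurable (escapes N u) := measurable_depends_on (@depends_on_escapes N u).
apply: fine_cvg; rewrite fineK ?fin_num_measure //; last first.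
  by rewrite percolatesE; exact: bigcapT_measurable.
rewrite percolatesE; apply: nonincreasing_cvg_mu => //.
- by rewrite ltey_eq fin_num_measure.
- exact: bigcapT_measurable.
- by move=> M N le; apply/subsetPset; exact: escapes_le.
Qed.

Lemma fk_sum_gt0 (V : {fset primal}) (k : R) : 0 < k -> 0 < fk_sum x q V k (fun=> 1).
Proof.
move=> k0; rewrite /fk_sum (big_fsetD1 fset0) /=; last by rewrite fpowersetE fsub0set.
apply: ltr_pwDl; first by rewrite mulr1 fk_weight_gt0.
by apply: sumr_ge0 => S _; rewrite mulr1 ltW // fk_weight_gt0.
Qed.

(** Finite energy: the ratio of an edge is at least the inverse of [q], and [x] exceeds 1. *)
Lemma fk_weight_open (V : {fset primal}) (S : {fset vertex}) (z : vertex) :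
  z \in fin_edges V -> fk_weight x q V 1 S <= q * fk_weight x q V 1 (z |` S)%fset.
Proof.
move=> zE; have W0 A : 0 < fk_weight x q V 1 A by rewrite fk_weight_gt0.
have [zS|zS] := boolP (z \in S).
  have -> : (z |` S)%fset = S by apply/fsetUidPr; rewrite fsub1set.
  by rewrite ler_peMl // ltW.
have [u [v [Eu Ev]]] := ends_in zE.
rewrite (fk_weight_add x q_ge1 ltr01 zS Eu Ev) mulrCA ler_peMr //; first exact: ltW.
have le := fk_ratio_ge q_ge1 S u v ltr01 q_ge1.
have h : 1 <= q * fk_ratio q 1 S u v.
  apply: (@le_trans _ _ (q * q^-1)); first by rewrite mulfV // gt_eqF.
  by rewrite ler_pM2l.
by rewrite mulrCA mulr_ege1 // ltW // sqrt_gt1.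
Qed.

(** Opening [z] costs at most a factor [q] in the weight and is at most two-to-one, whence the
    constant [q + q]. *)
Lemma wired_prob_open (n : nat) (z : vertex) (A B : set config) :
  z \in fin_edges (box n) ->
  (forall S, A (conf S) -> B (conf (z |` S)%fset)) ->
  wired_prob q n A <= (q + q) * wired_prob q n B.
Proof.
move=> zE AB; rewrite /wired_prob mulrA ler_pM2r ?invr_gt0 ?fk_sum_gt0 //.
pose G S := fk_weight x q (box n) 1 S * (`[< B (conf S) >])%:R.
have G0 S : 0 <= G S by rewrite /G mulr_ge0 // ltW // fk_weight_gt0.
apply: (@le_trans _ _ (\sum_(S <- fpowerset (fin_edges (box n))) q * G (z |` S)%fset)).
  apply: ler_sum => S _; rewrite /G mulrA.
  apply: ler_pM => //; first by rewrite ltW // fk_weight_gt0.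
    exact: fk_weight_open.
  by rewrite ler_nat; case: asboolP => // /AB ABz; case: asboolP.
rewrite -mulr_sumr mulrDl -mulrDr ler_pM2l //.
set E := fin_edges (box n) in zE *.
have EE : E = (z |` (E `\ z))%fset by rewrite fsetD1K.
have zE' : z \notin (E `\ z)%fset by rewrite !inE eqxx.
rewrite /fk_sum -/E -/(G _) EE [X in X <= _]sum_fpowersetU1 // [X in _ <= X + X]sum_fpowersetU1 //.
rewrite -big_split /=; apply: ler_sum => S _.
by rewrite fsetUA fsetUid; apply: lerD; rewrite lerDr; exact: G0.
Qed.

(** If [v] escapes, so does [u] once the edge between them is open. Finite energy bounds this in a
    box, and the bound passes to the limit first in the box and then in [N], as percolation itself
    is not local. *)
Lemma percolates_next (u v : primal) (z : vertex) : u != v ->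
  z \in corners (val u) -> z \in corners (val v) ->
  P (percolates u) = 0%E -> P (percolates v) = 0%E.
Proof.
move=> nuv zu zv Pu.
have finP (w : primal) : P (percolates w) \is a fin_num.
  rewrite fin_num_measure // percolatesE; apply: bigcapT_measurable => N.
  exact: (measurable_depends_on (@depends_on_escapes N w)).
suff : fine (P (percolates v)) <= 0.
  move=> le; rewrite -(fineK (finP v)); congr (_%:E); apply/eqP.
  by rewrite eq_le le /= fine_ge0.
have -> : 0 = (q + q) * fine (P (percolates u)) :> R by rewrite Pu mulr0.
have CP : (q + q) * fine (P (escapes N u)) @[N --> \oo] -->
    (q + q) * fine (P (percolates u)).
  by apply: cvgMl_tmp; exact: escapes_cvg.
apply: (ler_cvg_to (@escapes_cvg v) CP); apply: nearW => N.
have CW : (q + q) * wired_prob q n (escapes N u) @[n --> \oo] -->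
    (q + q) * fine (P (escapes N u)).
  by apply: cvgMl_tmp; exact: (wired_prob_cvg q_gt1 Pw (@depends_on_escapes N u)).
apply: (ler_cvg_to (wired_prob_cvg q_gt1 Pw (@depends_on_escapes N v)) CW).
have [M HM] : exists M, z \in fin_edges (box M).
  exists (absz z.1 + absz z.2).+1; rewrite fin_edgesP !in_boxE /in_box /= /end1 /end2.
  by case: z {zu zv} => a b /=; case: ifP => _ /=; lia.
near=> n; apply: (@wired_prob_open n z).
  have : (M <= n)%N by near: n; exists M.
  move: HM; rewrite !fin_edgesP !in_boxE => /andP[h1 h2] le.
  by rewrite !(in_box_le le).
move=> S /escapes_open[s [p o]]; apply: (@escapes_path _ _ _ (v :: s)) => //=.
apply/andP; split.
  by apply/open_adjP; exists z; split=> //; rewrite /conf in_fset1U eqxx.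
apply: sub_path p => f g /open_adjP[t [tf tg wt]]; apply/open_adjP; exists t.
by split=> //; move: wt; rewrite /conf in_fset1U => ->; rewrite orbT.
Unshelve. all: by end_near. Qed.

Hypothesis P0 : P (percolates origin) = 0%E.

Lemma no_percolation (u : primal) : P (percolates u) = 0%E.
Proof.
have [m] := ubnP (maxn (absz (val u).1) (absz (val u).2)).
elim: m u => // m IHm [[a b] p] /= lt.
have [E0|n0] := eqVneq ((a, b) : face) (0, 0).
  suff -> : exist _ (a, b) p = origin by [].
  by apply: val_inj; rewrite /= E0.
(* Both coordinates move by one, towards zero where possible. If one of them is zero it becomes 1,
   but then the other is even and nonzero, so that the larger absolute value still decreases. *)
pose st (c : int) : int := if 0 < c then c - 1 else c + 1.
have pp : is_primal (st a, st b).
  by move: p; rewrite /is_primal /st /=; case: ifP => _; case: ifP => _; lia.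
pose v : primal := to_primal pp.
pose z : vertex := (if 0 < a then a else a + 1, if 0 < b then b else b + 1).
apply: (@percolates_next v _ z).
- rewrite -val_eqE /= xpair_eqE /st; case: ifP => _; lia.
- by rewrite in_corners /= /st; case: ifP => _; case: ifP => _ /=; lia.
- by rewrite in_corners /=; case: ifP => _; case: ifP => _ /=; lia.
apply: IHm; rewrite /= /st.
move: n0 p; rewrite xpair_eqE /is_primal /= => n0 p.
by case: ifP => ha; case: ifP => hb; lia.
Qed.

Lemma boundary_out (n : nat) (u : box n) : u \in boundary (box n) ->
  forall N, (N < n)%N -> ~~ in_box N (val (val u)).
Proof.
rewrite inE => /asboolP[v [vV]]; rewrite /adj => /eqP h N lt.
have : (corners (val (val u)) `&` corners (val v))%fset != fset0.
  by rewrite -cardfs_gt0 h.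
case/fset0Pn => z; rewrite in_fsetI !in_corners; move: vV; rewrite in_boxE /in_box.
by case: (val (val u)) (val v) z => [a b] [c d] [e f] /=; lia.
Qed.

Lemma touches_escapes (n N : nat) (S : {fset vertex}) (u : box n) : (N < n)%N ->
  touches S u -> escapes N (val u) (conf S).
Proof.
move=> lt /touchesP[v /boundary_out/(_ N lt) out /connectP[s p Ev]].
apply: (@escapes_path _ _ _ (map val s)); last by rewrite last_map -Ev.
rewrite path_map; apply: sub_path p => f g; exact.
Qed.

Definition open_event (U : {fset vertex}) : set config :=
  [set w | forall z, z \in U -> w z = true].

Lemma depends_on_open (U : {fset vertex}) : depends_on U (open_event U).
Proof. by move=> w w' ww' wU z zU; rewrite -ww' // wU. Qed.

Lemma open_event_conf (U S : {fset vertex}) : `[< open_event U (conf S) >] = (U `<=` S)%fset.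
Proof. by apply/asboolP/fsubsetP => H z zU; have := H z zU. Qed.

Definition fk_prob (k : R) (n : nat) (U : {fset vertex}) : R :=
  fk_sum x q (box n) k (fun S => (U `<=` S)%fset%:R) / fk_sum x q (box n) k (fun=> 1).

Lemma fk_prob_le (k : R) (n : nat) (U : {fset vertex}) : 1 <= k -> k <= q ->
  fk_prob k n U <= wired_prob q n (open_event U).
Proof.
move=> k1 kq; have k0 := lt_le_trans ltr01 k1.
rewrite /fk_prob /wired_prob ler_pdivrMr ?fk_sum_gt0 // mulrAC ler_pdivlMr ?fk_sum_gt0 //.
have := fk_wired_ge (box n) x_gt0 q_ge1 U k1 kq; rewrite [X in _ <= X]mulrC.
by congr (_ <= _ * _); apply: eq_bigr => S _; rewrite open_event_conf.
Qed.

Definition escape_sum (n N : nat) (U : {fset vertex}) : R :=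
  \sum_(z <- U) (wired_prob q n (escapes N (pend1 z)) +
                 wired_prob q n (escapes N (pend2 z))).

(** [fk_wired_le] ignores the event that a boundary cluster meets [U]. Such a cluster joins an end
    of an edge of [U] to the outside of the box of size [N], which a union bound controls. *)
Lemma fk_prob_ge (k : R) (n N : nat) (U : {fset vertex}) : 0 < k -> k <= q -> (N < n)%N ->
  wired_prob q n (open_event U) <= fk_prob k n U + escape_sum n N U.
Proof.
move=> k0 kq lt.
pose good S : R := (all (fun z => ~~ edge_touches (box n) S z) U)%:R.
pose esc N u S : R := (`[< escapes N u (conf S) >])%:R.
have Z1 := fk_sum_gt0 (box n) ltr01; have Zk := fk_sum_gt0 (box n) k0.
have h1 : fk_sum x q (box n) 1 (fun S => (U `<=` S)%fset%:R * good S) /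
    fk_sum x q (box n) 1 (fun=> 1) <= fk_prob k n U.
  rewrite /fk_prob ler_pdivrMr // mulrAC ler_pdivlMr //.
  by rewrite [X in _ <= X]mulrC; exact: fk_wired_le.
apply: le_trans (lerD h1 (lexx _)).
have -> : escape_sum n N U = (fk_sum x q (box n) 1 (fun S => \sum_(z <- U)
    (esc N (pend1 z) S + esc N (pend2 z) S))) / fk_sum x q (box n) 1 (fun=> 1).
  rewrite /escape_sum /wired_prob; under eq_bigr do rewrite -mulrDl.
  rewrite -mulr_suml; congr (_ / _); rewrite /fk_sum.
  under [RHS]eq_bigr do rewrite mulr_sumr.
  rewrite [RHS]exchange_big /=; apply: eq_bigr => z _.
  by rewrite -big_split /=; apply: eq_bigr => S _; rewrite mulrDr.
rewrite /wired_prob -mulrDl ler_pM2r ?invr_gt0 // /fk_sum -big_split /=.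
apply: ler_sum => S _; rewrite -mulrDr ler_wpM2l //.
  by rewrite ltW // fk_weight_gt0.
rewrite open_event_conf /good.
have sum0 : 0 <= \sum_(z <- U) (esc N (pend1 z) S + esc N (pend2 z) S).
  by apply: sumr_ge0 => z _; rewrite addr_ge0 // ler0n.
have [gd|/allPn[z zU]] := boolP (all _ _); first by rewrite mulr1 lerDl.
rewrite negbK => /existsP[u /andP[zu tu]].
rewrite mulr0 add0r (big_rem _ zU) /=.
apply: (@le_trans _ _ 1); first by case: (U `<=` S)%fset; rewrite ?ler01 ?lexx.
have sum1 : 0 <= \sum_(y <- rem z U) (esc N (pend1 y) S + esc N (pend2 y) S).
  by apply: sumr_ge0 => y _; rewrite addr_ge0 // ler0n.
apply: ler_wpDr => //; have eu := touches_escapes lt tu.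
move: zu; rewrite corner_ends => /orP[]/eqP Eu; rewrite Eu in eu.
  by rewrite /esc; case: asboolP => // _; rewrite lerDl ler0n.
by rewrite addrC /esc; case: asboolP => // _; rewrite lerDl ler0n.
Qed.

Lemma cvg_sum_seq (T : Type) (s : seq T) (f : T -> nat -> R) (l : T -> R) :
  (forall z, f z n @[n --> \oo] --> l z) ->
  \sum_(z <- s) f z n @[n --> \oo] --> \sum_(z <- s) l z.
Proof.
move=> H; elim: s => [|z s IHs].
  by rewrite big_nil; under eq_cvg do rewrite big_nil; exact: cvg_cst.
by rewrite big_cons; under eq_cvg do rewrite big_cons; exact: cvgD.
Qed.

Lemma fk_prob_cvg (k : R) (U : {fset vertex}) : 1 <= k -> k <= q ->
  fk_prob k n U @[n --> \oo] --> fine (P (open_event U)).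
Proof.
move=> k1 kq; have k0 := lt_le_trans ltr01 k1.
have wc := wired_prob_cvg q_gt1 Pw (@depends_on_open U).
have ec N : escape_sum n N U @[n --> \oo] -->
    \sum_(z <- U) (fine (P (escapes N (pend1 z))) + fine (P (escapes N (pend2 z)))).
  apply: cvg_sum_seq => z; apply: cvgD; apply: wired_prob_cvg => //;
  exact: depends_on_escapes.
have e0 : \sum_(z <- U) (fine (P (escapes N (pend1 z))) + fine (P (escapes N (pend2 z))))
    @[N --> \oo] --> 0.
  have E : \sum_(z <- U) (fine (P (percolates (pend1 z))) +
      fine (P (percolates (pend2 z)))) = 0.
    by rewrite big1 // => z _; rewrite !no_percolation // addr0.
  rewrite -[X in _ --> X]E.
  by apply: cvg_sum_seq => z; apply: cvgD; exact: escapes_cvg.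
apply/cvgrPdist_le => e e_gt0.
have e2 : 0 < e / 2 by rewrite divr_gt0.
have e4 : 0 < e / 2 / 2 by rewrite divr_gt0.
(* [N] is fixed first, by the escape probabilities in infinite volume; their counterparts in a large
   box are close to them. *)
have [N HN] : exists N, \sum_(z <- U) (fine (P (escapes N (pend1 z))) +
    fine (P (escapes N (pend2 z)))) < e / 2.
  have /cvgrPdist_lt/(_ _ e2)[N _ /(_ N (leqnn N)) /=] := e0.
  rewrite sub0r normrN => lt; exists N; apply: le_lt_trans lt; exact: ler_norm.
near=> n.
have Nn : (N < n)%N by near: n; exists N.+1.
have up := fk_prob_le n U k1 kq; have lo := fk_prob_ge U k0 kq Nn.
have w1 : `|fine (P (open_event U)) - wired_prob q n (open_event U)| <= e / 2 / 2.
  by near: n; move/cvgrPdist_le: wc; apply.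
have w2 : escape_sum n N U <= e / 2 + e / 2 / 2.
  near: n; apply: (cvgr_le _ (ec N)); apply: lt_trans HN _.
  by rewrite ltrDl.
move: w1; rewrite !ler_distl => /andP[w3 w4]; apply/andP; split; lra.
Unshelve. all: by end_near. Qed.

End Percolation.

(** * Local determination of loops *)

Section Representatives.
Variable T : eqType.
Implicit Types (same : rel T) (cs : seq (T * bool)).

(** The last constraint on each loop is kept. Constraints on the same loop repeat or contradict each
    other, and [consistent] tells which. *)
Fixpoint reps same cs : seq (T * bool) :=
  if cs is c :: cs' then
    if has (fun d => same d.1 c.1) cs' then reps same cs' else c :: reps same cs'
  else [::].

Fixpoint consistent same cs : bool :=
  if cs is c :: cs' then
    all (fun d => same d.1 c.1 ==> (d.2 == c.2)) cs' && consistent same cs'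
  else true.

Lemma reps_sub same cs : {subset reps same cs <= cs}.
Proof.
elim: cs => //= c cs IHcs d; rewrite inE; case: ifP => _; rewrite ?inE.
  by move=> /IHcs ->; rewrite orbT.
by case/orP => [->//|/IHcs ->]; rewrite orbT.
Qed.

Lemma reps_pairwise same cs : pairwise (fun c d => ~~ same d.1 c.1) (reps same cs).
Proof.
elim: cs => //= c cs IHcs; case: ifP => //= /negbT/hasPn nc.
by rewrite IHcs andbT; apply/allP => d /reps_sub/nc.
Qed.

Lemma all_reps same (f : T -> bool) cs :
  (forall c d, c \in cs -> d \in cs -> same c.1 d.1 -> f c.1 = f d.1) ->
  all (fun c => f c.1 == c.2) cs =
  consistent same cs && all (fun c => f c.1 == c.2) (reps same cs).
Proof.
elim: cs => //= c cs IHcs H; rewrite -andbA.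
have {}IHcs := IHcs (fun d d' dc d'c =>
  H d d' (mem_behead (s := c :: cs) dc) (mem_behead (s := c :: cs) d'c)).
have Hc d : d \in cs -> same d.1 c.1 -> f d.1 = f c.1.
  by move=> dcs; apply: H; rewrite inE ?eqxx ?dcs ?orbT.
case: ifPn => [/hasP[d dcs sdc]|/hasPn ns].
  rewrite -IHcs; have [/allP A|] := boolP (all _ cs); rewrite ?andbF // !andbT.
  have fE d' : d' \in cs -> same d'.1 c.1 -> d'.2 = f c.1.
    by move=> d'cs sd'; rewrite -(eqP (A _ d'cs)) Hc.
  apply/idP/allP => [/eqP fc d' d'cs|/(_ _ dcs)].
    by apply/implyP => sd'; rewrite (fE _ d'cs sd') fc.
  by rewrite sdc (fE _ dcs sdc).
have -> : all (fun d => same d.1 c.1 ==> (d.2 == c.2)) cs.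
  by apply/allP => d /ns /negPf ->.
by rewrite /= IHcs andbCA.
Qed.

Lemma reps_eq same same' cs : (forall c, c \in cs -> same c.1 =1 same' c.1) ->
  reps same cs = reps same' cs.
Proof.
elim: cs => //= c cs IHcs H; rewrite IHcs; last first.
  by move=> d dcs; apply: H; rewrite inE dcs orbT.
congr (if _ then _ else _); apply: eq_in_has => d dcs; apply: H.
by rewrite inE dcs orbT.
Qed.

Lemma consistent_eq same same' cs : (forall c, c \in cs -> same c.1 =1 same' c.1) ->
  consistent same cs = consistent same' cs.
Proof.
elim: cs => //= c cs IHcs H; rewrite IHcs; last first.
  by move=> d dcs; apply: H; rewrite inE dcs orbT.
by congr (_ && _); apply: eq_in_all => d dcs; rewrite H // inE dcs orbT.
Qed.

End Representatives.

Definition same_loop (w : config) (a b : dart) : bool :=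
  `[< exists k, iter k (next_dart w) a = b >].

Lemma same_loop_sym (w : config) (a b : dart) : periodic w a ->
  same_loop w a b -> same_loop w b a.
Proof.
move=> [n [n_gt0 per]] /asboolP[k <-]; apply/asboolP; exists (n * k - k)%N.
rewrite -iterD subnK ?leq_pmull //; elim: k => [|k IHk]; first by rewrite muln0.
by rewrite mulnS iterD IHk.
Qed.

Definition short (N : nat) (w : config) (a : dart) : Prop :=
  exists n, (0 < n <= N)%N /\ iter n (next_dart w) a = a.

Lemma short_periodic N w a : short N w a -> periodic w a.
Proof. by case=> n [/andP[n0 _] per]; exists n. Qed.

Lemma short_le M N w a : (M <= N)%N -> short M w a -> short N w a.
Proof.
by move=> le [n [/andP[n0 nM] per]]; exists n; split=> //; rewrite n0 (leq_trans nM).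
Qed.

Lemma in_box_iter (r : nat) (w : config) (a : dart) (k : nat) :
  in_box r (left_face a) -> in_box (r + k) (left_face (iter k (next_dart w) a)).
Proof.
move=> inr; elim: k => [|k]; first by rewrite addn0.
rewrite iterS; move: (iter k _ a) => b; rewrite next_dartE.
case: ifP => _; first by rewrite left_face_turn_left; apply: in_box_le; lia.
by rewrite /in_box; case: b => [[x y] []] /=; lia.
Qed.

Lemma iter_agree (r N : nat) (w w' : config) (a : dart) (k : nat) :
  in_box r (left_face a) -> (forall z, z \in win (r + N).+1 -> w z = w' z) ->
  (k <= N)%N -> iter k (next_dart w) a = iter k (next_dart w') a.
Proof.
move=> inr ww'; elim: k => //= k IHk kN; rewrite -IHk 1?ltnW //.
rewrite !next_dartE /turns_left ww' //.
apply: (corner_win (f := left_face (iter k (next_dart w) a))); last exact: corner_target.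
by apply: in_box_le (in_box_iter w k inr); lia.
Qed.

(** [N] steps do not leave the window, so that both configurations share a full cycle and therefore
    all iterates. *)
Lemma short_agree (r N : nat) (w w' : config) (a : dart) :
  in_box r (left_face a) -> (forall z, z \in win (r + N).+1 -> w z = w' z) ->
  short N w a -> short N w' a /\
  forall k, iter k (next_dart w) a = iter k (next_dart w') a.
Proof.
move=> inr ww' [n [/andP[n0 nN] per]].
have agr k : (k <= N)%N -> iter k (next_dart w) a = iter k (next_dart w') a.
  exact: iter_agree inr ww'.
have per' : iter n (next_dart w') a = a by rewrite -agr.
split; first by exists n; rewrite n0 nN.
move=> k; rewrite (divn_eq k n) addnC !iterD.
have mulp v : iter n (next_dart v) a = a -> iter (k %/ n * n) (next_dart v) a = a.
  by move=> pv; elim: (_ %/ _)%N => //= m IHm; rewrite mulSn iterD IHm.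
by rewrite !mulp // agr // ltnW // (leq_trans (ltn_pmod k n0)).
Qed.

Lemma next_open_adj (w : config) (a : dart) (f g : primal) :
  val f = left_face a -> val g = left_face (next_dart w a) ->
  f = g \/ open_adj w f g.
Proof.
move=> Ef Eg; rewrite next_dartE in Eg; have [tl|tr] := boolP (turns_left w a).
  by left; apply: val_inj; rewrite Ef Eg tl left_face_turn_left.
right; apply/open_adjP; exists (target a); rewrite Ef Eg corner_target (negPf tr).
split=> //; first exact: (corner_start (target a, right_of a.2)).
by move: tr; rewrite /turns_left -Ef (valP f); case: (w (target a)).
Qed.

(** The left faces along the loop belong to one cluster. If this were finite, two iterates would
    coincide, and injectivity of [next_dart] would make the dart periodic. *)
Lemma nonperiodic_percolates (w : config) (a : dart) (u : primal) :
  val u = left_face a -> ~ periodic w a -> percolates u w.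
Proof.
move=> Eu np /finite_box[N HN].
have pk k : is_primal (left_face (iter k (next_dart w) a)).
  by rewrite primal_iter -Eu; exact: valP.
have clk k : open_cluster w u (to_primal (pk k)).
  elim: k => [|k [s [ps Es]]]; first by exists [::]; split=> //; exact: val_inj.
  have [Ek|ok] := @next_open_adj w (iter k (next_dart w) a) (to_primal (pk k))
    (to_primal (pk k.+1)) erefl erefl.
    by exists s; rewrite Es.
  by exists (rcons s (to_primal (pk k.+1))); rewrite rcons_path ps Es last_rcons.
have ex k : exists x : bdart N, dart_of x = iter k (next_dart w) a.
  by apply: dart_ofP => //; exact: HN _ (clk k).
have [x Ex] := choice ex.
have inj : injective (fun i : 'I_(#|{: bdart N}|.+1) => x i).
  move=> i j /(congr1 (@dart_of N)) Exij; apply: val_inj; move: Exij; rewrite !Ex.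
  case: i j => [i _] [j _] /=.
  wlog ij : i j / (i <= j)%N.
    by move=> H; case/orP: (leq_total i j) => le E; [exact: H|symmetry; exact: H].
  rewrite -(subnK ij) addnC iterD => /iter_next_inj Ea.
  have [->|n0] := posnP (j - i)%N; first by rewrite addn0.
  by case: np; exists (j - i)%N; rewrite -Ea.
by have := leq_card _ inj; rewrite card_ord ltnn.
Qed.

(* The conditional probability, given w, that for all (a, o) in cs the dart a is
   oriented forwards if o = true and backwards if o = false. *)
Definition gfac (R : realType) (lam : R) (cs : seq (dart * bool)) (w : config) : R :=
  (consistent (same_loop w) cs)%:R *
  \prod_(c <- reps (same_loop w) cs) orientation_prob lam (c.2 == acw w c.1).

Lemma acw_eq (w w' : config) (a : dart) :
  (forall k, iter k (next_dart w) a = iter k (next_dart w') a) -> acw w a = acw w' a.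
Proof.
move=> ww'; have areaE n : signed_area w a n = signed_area w' a n.
  by apply: eq_bigr => i _; rewrite ww'.
apply/asboolP/asboolP => -[n [n0 per ar]]; exists n; split=> //.
- by rewrite -ww'.
- by rewrite -areaE.
- by rewrite ww'.
- by rewrite areaE.
Qed.

Lemma gfac_eq (R : realType) (lam : R) (cs : seq (dart * bool)) (w w' : config) :
  (forall c, c \in cs -> forall k, iter k (next_dart w) c.1 = iter k (next_dart w') c.1) ->
  gfac lam cs w = gfac lam cs w'.
Proof.
move=> ww'; have sE c : c \in cs -> same_loop w c.1 =1 same_loop w' c.1.
  move=> ccs b; apply/asboolP/asboolP => -[k Ek]; exists k;
  by rewrite -Ek (ww' _ ccs).
rewrite /gfac (consistent_eq sE) (reps_eq sE); congr (_ * _).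
apply: eq_big_seq => c /reps_sub ccs; congr (orientation_prob _ (_ == _)).
exact: acw_eq (ww' _ ccs).
Qed.

Definition tval (n : nat) (t : {ffun bdart n -> bool}) (a : dart) : bool :=
  [exists x, (dart_of x == a) && t x].

Lemma tval_dart_of (n : nat) (t : {ffun bdart n -> bool}) (x : bdart n) :
  tval t (dart_of x) = t x.
Proof.
apply/existsP/idP => [[y /andP[/eqP/dart_of_inj -> //]]|tx].
by exists x; rewrite eqxx.
Qed.

Definition all_short (N : nat) (cs : seq (dart * bool)) : set config :=
  [set w | forall c, c \in cs -> short N w c.1].

(** [gfac] is not local, since loops may be long. [gshort] is local and bounds the conditional
    probability from below; adding [ilong] gives a local upper bound. *)
Definition gshort (R : realType) (lam : R) (N : nat) (cs : seq (dart * bool))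
    (w : config) : R :=
  if `[< all_short N cs w >] then gfac lam cs w else 0.

Definition ilong (R : realType) (N : nat) (cs : seq (dart * bool)) (w : config) : R :=
  (`[< ~ all_short N cs w >])%:R.

Section FiniteModel.
Variables (R : realType) (n : nat) (S : {fset vertex}).
Local Notation E := (fin_edges (box n)).
Hypothesis SE : (S `<=` E)%fset.
Local Notation s := (loop_perm SE).
Local Notation w := (conf S).
Implicit Types (lam : R) (t : {ffun bdart n -> bool}) (cs rs : seq (dart * bool)).

Definition agrees cs t : bool := all (fun c => tval t c.1 == c.2) cs.

Lemma same_loop_porbit (x y : bdart n) :
  same_loop w (dart_of x) (dart_of y) -> y \in porbit s x.
Proof.
by move=> /asboolP[k]; rewrite -(dart_of_iter SE) => /dart_of_inj <-; exact: mem_porbit.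
Qed.

Lemma porbit_same_loop (x y : bdart n) : y \in porbit s x ->
  same_loop w (dart_of x) (dart_of y).
Proof. by case/porbitP => k ->; apply/asboolP; exists k; rewrite dart_of_iter. Qed.

Definition inner_darts cs : Prop := forall c, c \in cs ->
  exists x, dart_of x = c.1 /\ ~~ bd_orbit (porbit s x).

(** As the loops are distinct, reversing the first leaves the other constraints unchanged, so that
    [sum_rot_weight_loop] applies to one loop after the other. *)
Lemma sum_rot_weight_reps lam rs : inner_darts rs ->
  pairwise (fun c d => ~~ same_loop w d.1 c.1) rs ->
  \sum_(t : {ffun bdart n -> bool} | admissible S t && agrees rs t) rot_weight lam S t =
  \prod_(c <- rs) orientation_prob lam (c.2 == acw w c.1) *
  \sum_(t : {ffun bdart n -> bool} | admissible S t) rot_weight lam S t.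
Proof.
elim: rs => [|c rs IHrs] inn /=.
  by move=> _; rewrite big_nil mul1r; apply: eq_bigl => t; rewrite andbT.
case/andP=> /allP cd pw; rewrite big_cons -mulrA -IHrs //; last first.
  by move=> d drs; apply: inn; rewrite inE drs orbT.
have [x [Ex nx]] := inn c (mem_head _ _).
rewrite (_ : acw w c.1 = plus S x); last by rewrite /plus Ex.
rewrite -(sum_rot_weight_loop _ _ nx).
  by apply: eq_bigl => t; rewrite /agrees /= -Ex tval_dart_of; case: (t x == _);
     rewrite ?andbT ?andbF.
move=> t; apply: eq_in_all => d drs.
have [y [Ey _]] := inn d (mem_behead (s := c :: rs) drs).
rewrite -Ey !tval_dart_of ffunE (negPf (_ : y \notin porbit s x)) ?addbF //.
apply: contra (cd _ drs) => yx; rewrite -Ey -Ex porbit_same_loop //.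
by rewrite porbit_sym.
Qed.

Lemma sum_rot_weight_agrees lam cs : inner_darts cs ->
  \sum_(t : {ffun bdart n -> bool} | admissible S t && agrees cs t) rot_weight lam S t =
  gfac lam cs w * \sum_(t : {ffun bdart n -> bool} | admissible S t) rot_weight lam S t.
Proof.
move=> inn; rewrite /gfac -mulrA -sum_rot_weight_reps; last first.
- exact: reps_pairwise.
- by move=> c /reps_sub/inn.
have allE t : admissible S t -> agrees cs t =
    consistent (same_loop w) cs && agrees (reps (same_loop w) cs) t.
  move=> adm; apply: all_reps => c d /inn[x [<- _]] /inn[y [<- _]].
  by move=> /same_loop_porbit yx; rewrite !tval_dart_of (admissible_const adm yx).
case: (consistent _ _) allE => allE; last first.
  rewrite mul0r big_pred0 // => t; apply/negP => /andP[/allE ->]; by [].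
by rewrite mul1r; apply: eq_bigl => t; apply: andb_id2l => /allE.
Qed.

(** Along the loop left faces stay within [r + N]; one more unit contains the targets, and a second
    one the ends of the edges through them. *)
Lemma short_inner (r N : nat) (x : bdart n) : ((r + N).+2 <= n)%N ->
  in_box r (left_face (dart_of x)) -> short N w (dart_of x) ->
  ~~ bd_orbit (porbit s x).
Proof.
move=> le inr [m [/andP[m0 mN] per]]; apply/existsP => -[y /andP[/porbitP[k ->]]].
rewrite /bd_dart dart_of_iter => /negP; apply.
have -> : iter k (next_dart w) (dart_of x) = iter (k %% m) (next_dart w) (dart_of x).
  rewrite {1}(divn_eq k m) addnC iterD; congr iter.
  by elim: (k %/ m)%N => //= j IHj; rewrite mulSn iterD IHj.
have := in_box_iter w (k %% m) inr; set a := iter _ _ _ => ina.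
have {}ina : in_box (r + N) (left_face a).
  by apply: in_box_le ina; rewrite leq_add2l ltnW // (leq_trans (ltn_pmod k m0)).
have := corner_target a; rewrite fin_edgesP !in_boxE /pend1 /pend2 /=.
move: ina; rewrite in_corners /in_box /end1 /end2.
case: (left_face a) (target a) => [c d] [e f] /=.
by case: ifP => _ /=; lia.
Qed.

Lemma rot_weight_bounds lam cs (r N : nat) : ((r + N).+2 <= n)%N ->
  (forall c, c \in cs -> is_primal (left_face c.1)) ->
  (forall c, c \in cs -> in_box r (left_face c.1)) ->
  (\sum_(t : {ffun bdart n -> bool} | admissible S t) rot_weight lam S t) * gshort lam N cs w
    <= \sum_(t : {ffun bdart n -> bool} | admissible S t && agrees cs t) rot_weight lam S t
    <= (\sum_(t : {ffun bdart n -> bool} | admissible S t) rot_weight lam S t) *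
         (gshort lam N cs w + ilong R N cs w).
Proof.
move=> le pcs incs; set Z := \sum_(t | _) _; set A := \sum_(t | _) _.
rewrite /gshort /ilong asbool_neg.
case: asboolP => sh /=; last first.
  rewrite mulr0 add0r mulr1 sumr_ge0 /=; last by move=> t _; exact: expR_ge0.
  rewrite /A /Z [X in _ <= X](bigID (agrees cs)) /= lerDl.
  by apply: sumr_ge0 => t _; exact: expR_ge0.
rewrite addr0 mulrC /A sum_rot_weight_agrees ?lexx //.
move=> c ccs; have [|x Ex] := @dart_ofP n c.1 (pcs _ ccs).
  by apply: in_box_le (incs _ ccs); lia.
by exists x; split=> //; apply: short_inner le _ _; rewrite Ex; [exact: incs|exact: sh].
Qed.

End FiniteModel.

(** * The orientation law of the box as an average over configurations *)

Section Means.
Variables (R : realType) (q : R).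
Local Notation x := (Num.sqrt q).

Definition fk_mean (k : R) (n : nat) (f : config -> R) : R :=
  fk_sum x q (box n) k (fun S => f (conf S)) / fk_sum x q (box n) k (fun=> 1).

Definition nu (lam : R) (n : nat) (cs : seq (dart * bool)) : R :=
  (\sum_(t : {ffun bdart n -> bool} | agrees cs t) marginal lam t) /
  (\sum_(t : {ffun bdart n -> bool}) marginal lam t).

Lemma nu_sym (lam : R) (n : nat) (cs : seq (dart * bool)) : nu lam n cs = nu (- lam) n cs.
Proof.
rewrite /nu; under eq_bigr do rewrite marginal_sym.
under [in X in _ / X]eq_bigr do rewrite marginal_sym.
by rewrite -!mulr_sumr -mulf_div divff ?mul1r // gt_eqF // expR_gt0.
Qed.

Hypothesis q_gt1 : 1 < q.

Lemma sum_marginal (lam : R) (n : nat) (c : pred {ffun bdart n -> bool}) :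
  \sum_(t | c t) marginal lam t =
  \sum_(A <- fpowerset (fin_edges (box n)))
    \sum_(t : {ffun bdart n -> bool} | admissible A t && c t) rot_weight lam A t.
Proof.
rewrite /marginal exchange_big /=; apply: eq_bigr => A _.
by rewrite -big_mkcondr; apply: eq_bigl => t; rewrite andbC.
Qed.

(** By [partition_fk] the configuration has the random-cluster law with boundary weight
    [x * expR lam], over which the bounds of [rot_weight_bounds] are averaged. *)
Lemma nu_bounds (lam : R) (n r N : nat) (cs : seq (dart * bool)) :
  expR lam + expR (- lam) = x -> ((r + N).+2 <= n)%N ->
  (forall c, c \in cs -> is_primal (left_face c.1)) ->
  (forall c, c \in cs -> in_box r (left_face c.1)) ->
  fk_mean (x * expR lam) n (gshort lam N cs) <= nu lam n cs <=
  fk_mean (x * expR lam) n (gshort lam N cs) + fk_mean (x * expR lam) n (ilong R N cs).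
Proof.
move=> Ex le pcs incs; set k := x * expR lam.
have x0 : 0 < x by apply: lt_trans (sqrt_gt1 q_gt1); exact: ltr01.
have q0 : 0 <= q by apply: le_trans (ltW q_gt1); exact: ler01.
pose X := x ^+ #|` box n|; have X0 : 0 < X by rewrite exprn_gt0.
pose Z A := \sum_(t : {ffun bdart n -> bool} | admissible A t) rot_weight lam A t.
have WE A : (A `<=` fin_edges (box n))%fset -> fk_weight x q (box n) k A = X * Z A.
  by move=> AE; have := partition_fk AE lam; rewrite /= Ex sqr_sqrtr.
have Ef (f : config -> R) : fk_sum x q (box n) k (fun S => f (conf S)) =
    X * \sum_(A <- fpowerset (fin_edges (box n))) Z A * f (conf A).
  rewrite mulr_sumr /fk_sum; apply: eq_big_seq => A; rewrite fpowersetE => /WE ->.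
  by rewrite mulrA.
have total : \sum_(t : {ffun bdart n -> bool}) marginal lam t =
    \sum_(A <- fpowerset (fin_edges (box n))) Z A * 1.
  rewrite sum_marginal; apply: eq_bigr => A _; rewrite mulr1.
  by apply: eq_bigl => t; rewrite andbT.
have D0 : 0 < \sum_(A <- fpowerset (fin_edges (box n))) Z A * 1.
  rewrite -(pmulr_rgt0 _ X0) -(Ef (fun=> 1)) fk_sum_gt0 // /k.
  by rewrite mulr_gt0 // expR_gt0.
have mE (f : config -> R) : fk_mean k n f =
    (\sum_(A <- fpowerset (fin_edges (box n))) Z A * f (conf A)) /
    (\sum_(A <- fpowerset (fin_edges (box n))) Z A * 1).
  by rewrite /fk_mean (Ef f) (Ef (fun=> 1)) -mulf_div divff ?mul1r // gt_eqF.
rewrite !mE /nu total -mulrDl !ler_pM2r ?invr_gt0 // sum_marginal -big_split /=.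
rewrite !big_seq; apply/andP; split; apply: ler_sum => A; rewrite fpowersetE => AE;
  have /andP[h1 h2] := rot_weight_bounds AE lam le pcs incs => //.
by rewrite -mulrDr.
Qed.

End Means.

(** * Infinite volume *)

Definition local_on (R : Type) (W : {fset vertex}) (f : config -> R) : Prop :=
  forall w w', (forall z, z \in W -> w z = w' z) -> f w = f w'.

Definition upd (z : vertex) (b : bool) (w : config) : config :=
  fun y => if y == z then b else w y.

Lemma darts_in_box (cs : seq (dart * bool)) :
  exists r, forall c, c \in cs -> in_box r (left_face c.1).
Proof.
elim: cs => [|c cs [r Hr]]; first by exists 0%N.
exists (r + absz (left_face c.1).1 + absz (left_face c.1).2)%N => d.
rewrite inE => /orP[/eqP->|/Hr]; last by apply: in_box_le; lia.
by rewrite /in_box; case: (left_face _) => a b /=; lia.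
Qed.

Section AllShort.
Variables (r N : nat) (cs : seq (dart * bool)).
Hypothesis cs_box : forall c, c \in cs -> in_box r (left_face c.1).
Local Notation W := (win (r + N).+1).

Lemma depends_on_all_short : depends_on W (all_short N cs).
Proof. by move=> w w' ww' sh c ccs; have [] := short_agree (cs_box ccs) ww' (sh c ccs). Qed.

Lemma depends_on_long : depends_on W (~` all_short N cs).
Proof.
move=> w w' ww' sh /(depends_on_all_short _) sh'; apply: sh; apply: sh' => z /ww'.
by move=> ->.
Qed.

Lemma local_gshort (R : realType) (lam : R) : local_on W (gshort lam N cs).
Proof.
move=> w w' ww'; rewrite /gshort; case: asboolP => sh.
  rewrite ifT; last by apply/asboolP; exact: depends_on_all_short sh.
  by apply: gfac_eq => c ccs; have [] := short_agree (cs_box ccs) ww' (sh c ccs).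
by rewrite ifF //; apply/asboolP => sh'; apply: (depends_on_long ww' sh).
Qed.

Lemma local_ilong (R : realType) : local_on W (ilong R N cs).
Proof.
move=> w w' ww'; rewrite /ilong; congr (nat_of_bool _)%:R.
apply/asboolP/asboolP; apply: depends_on_long => // z zW; by rewrite ww'.
Qed.

End AllShort.

Section PatternMean.
Variables (R : realType) (q : R) (P : probability config R).

Definition pmean (W : {fset vertex}) (f : config -> R) : R :=
  \sum_(pi <- fpowerset W) fine (P (pattern W pi)) * f (indicator_of pi).

Lemma pmean_event (W : {fset vertex}) (A : set config) : depends_on W A ->
  pmean W (fun w => (`[< A w >])%:R) = fine (P A).
Proof.
move=> loc; rewrite (sum_pattern P (phi := id) W _ (measurable_depends_on loc)) //.
apply: eq_bigr => pi _; case: asboolP => Api; last first.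
  rewrite mulr0 (_ : _ `&` _ = set0) ?measure0 //; apply/seteqP; split=> // w [Aw wpi].
  by apply: Api; apply: loc Aw => z /wpi.
rewrite mulr1 (_ : _ `&` _ = pattern W pi) //; apply/seteqP; split=> w; first by case.
by move=> wpi; split=> //; apply: loc Api => z /wpi.
Qed.

Lemma pmeanD (W : {fset vertex}) (f g : config -> R) :
  pmean W (fun w => f w + g w) = pmean W f + pmean W g.
Proof. by rewrite /pmean -big_split /=; apply: eq_bigr => pi _; rewrite mulrDr. Qed.

Lemma pmeanZ (W : {fset vertex}) (c : R) (f : config -> R) :
  pmean W (fun w => c * f w) = c * pmean W f.
Proof. by rewrite /pmean mulr_sumr; apply: eq_bigr => pi _; rewrite mulrCA. Qed.

Lemma fk_meanD (k : R) (n : nat) (f g : config -> R) :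
  fk_mean q k n (fun w => f w + g w) = fk_mean q k n f + fk_mean q k n g.
Proof.
rewrite /fk_mean -mulrDl; congr (_ / _).
by rewrite /fk_sum -big_split /=; apply: eq_bigr => pi _; rewrite mulrDr.
Qed.

Lemma fk_meanZ (k c : R) (n : nat) (f : config -> R) :
  fk_mean q k n (fun w => c * f w) = c * fk_mean q k n f.
Proof.
rewrite /fk_mean mulrA; congr (_ / _).
by rewrite /fk_sum mulr_sumr; apply: eq_bigr => pi _; rewrite mulrCA.
Qed.

Lemma open_eventU (z : vertex) (U : {fset vertex}) (w : config) :
  (`[< open_event (z |` U)%fset w >])%:R = (`[< open_event U w >])%:R * (w z)%:R :> R.
Proof.
rewrite -natrM mulnb; congr (nat_of_bool _)%:R.
apply/asboolP/andP => [H|[/asboolP H wz] y].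
  split; last by apply: H; rewrite !inE eqxx.
  by apply/asboolP => y yU; apply: H; rewrite !inE yU orbT.
by rewrite !inE => /orP[/eqP-> //|/H].
Qed.

Hypotheses (q_gt1 : 1 < q) (Pw : is_wired_measure (p_c q) q P).
Hypothesis P0 : P (percolates origin) = 0%E.

(** Events that given edges are open determine the means of local functions: the induction frees [g]
    from one coordinate [z] at a time, writing it as [g0 w + (w z)%:R * g1 w] and moving the
    coordinate into the open event. *)
Lemma fk_mean_cvg (k : R) (W : {fset vertex}) (f : config -> R) :
  1 <= k -> k <= q -> local_on W f -> fk_mean q k n f @[n --> \oo] --> pmean W f.
Proof.
move=> k1 kq floc.
suff H Z : (Z `<=` W)%fset -> forall g, local_on Z g -> forall U, (U `<=` W)%fset ->
    fk_mean q k n (fun w => (`[< open_event U w >])%:R * g w) @[n --> \oo] -->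
    pmean W (fun w => (`[< open_event U w >])%:R * g w).
  have E : (fun w => (`[< open_event fset0 w >])%:R * f w) = f.
    apply: funext => w; rewrite (_ : `[< _ >] = true) ?mul1r //.
    by apply/asboolP.
  by have := H W (fsubset_refl W) f floc fset0 (fsub0set W); rewrite E.
elim/fset1U_rect: Z => [|z Z zZ IHZ] ZW g gloc U UW.
  have E : (fun w => (`[< open_event U w >])%:R * g w) =
           (fun w => g (fun=> false) * (`[< open_event U w >])%:R).
    by apply: funext => w; rewrite mulrC (gloc w (fun=> false)).
  rewrite E pmeanZ; under eq_cvg do rewrite fk_meanZ.
  apply: cvgMl_tmp; rewrite pmean_event; last first.
    by move=> w w' ww' wU y yU; rewrite -ww' ?wU // (fsubsetP UW).
  have E' : (fun n => fk_mean q k n (fun w => (`[< open_event U w >])%:R)) =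
            (fun n => fk_prob q k n U).
    apply: funext => n; rewrite /fk_prob /fk_mean; congr (_ / _).
    by apply: eq_bigr => S _; rewrite open_event_conf.
  by rewrite E'; exact: fk_prob_cvg.
have ZW' : (Z `<=` W)%fset by apply: fsubset_trans ZW; exact: fsubsetUr.
have zU : (z |` U `<=` W)%fset.
  by rewrite fsubUset UW andbT; apply: fsubset_trans ZW; exact: fsubsetUl.
pose g0 w := g (upd z false w); pose g1 w := g (upd z true w) - g (upd z false w).
have uloc b : local_on Z (fun w => g (upd z b w)).
  move=> w w' ww'; apply: gloc => y; rewrite !inE /upd.
  by case: eqP => //= _ /ww'.
have E : (fun w => (`[< open_event U w >])%:R * g w) =
    (fun w => (`[< open_event U w >])%:R * g0 w +
              (`[< open_event (z |` U)%fset w >])%:R * g1 w).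
  apply: funext => w; rewrite open_eventU -mulrA -mulrDr; congr (_ * _).
  rewrite /g0 /g1 (gloc w (upd z (w z) w)); last first.
    by move=> y _; rewrite /upd; case: eqP => [->|].
  by case: (w z); rewrite ?mul1r ?mul0r ?addr0 // addrC subrK.
rewrite E pmeanD; under eq_cvg do rewrite fk_meanD.
apply: cvgD; apply: IHZ => //; first exact: uloc.
by move=> w w' ww'; rewrite /g1 (uloc true w w' ww') (uloc false w w' ww').
Qed.

(** If the darts of [cs] are not all on short loops for any [N], one of them is on an infinite loop
    and has an infinite cluster on its left. *)
Lemma long_null (cs : seq (dart * bool)) :
  (forall c, c \in cs -> is_primal (left_face c.1)) ->
  P (\bigcap_N ~` all_short N cs) = 0%E.
Proof.
move=> pcs; have [r Hr] := darts_in_box cs.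
have mI : measurable (\bigcap_N ~` all_short N cs).
  by apply: bigcapT_measurable => N; exact: measurable_depends_on (depends_on_long Hr).
have mp u : measurable (percolates u).
  rewrite percolatesE; apply: bigcapT_measurable => N.
  exact: (measurable_depends_on (@depends_on_escapes N u)).
pose B := \big[setU/set0]_(c <- cs) percolates (insubd origin (left_face c.1)).
have mB : measurable B by apply: bigsetU_measurable.
apply: (@subset_measure0 _ _ _ P _ B) => //; last first.
  rewrite /B; elim: (cs) => [|c s IHs]; first by rewrite big_nil measure0.
  rewrite big_cons; apply: etrans (no_percolation q_gt1 Pw P0 _).
  by apply: measureU0 => //; exact: bigsetU_measurable.
move=> w lw; rewrite /B -bigcup_seq; apply: contrapT => nw.
have per c : c \in cs -> periodic w c.1.
  move=> ccs; apply: contrapT => np; apply: nw; exists c => //=.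
  by apply: nonperiodic_percolates np; rewrite val_insubd pcs.
have [N sh] : exists N, all_short N cs w.
  elim: (cs) per => [|c s IHs] per; first by exists 0%N.
  have [|N sh] := IHs; first by move=> d ds; apply: per; rewrite inE ds orbT.
  have [m [m0 pm]] := per c (mem_head _ _); exists (m + N)%N => d.
  rewrite inE => /orP[/eqP->|/sh]; last by apply: short_le; exact: leq_addl.
  by exists m; rewrite m0 leq_addr.
exact: lw N I sh.
Qed.

Lemma long_cvg (cs : seq (dart * bool)) (r : nat) :
  (forall c, c \in cs -> is_primal (left_face c.1)) ->
  (forall c, c \in cs -> in_box r (left_face c.1)) ->
  pmean (win (r + N).+1) (ilong R N cs) @[N --> \oo] --> 0.
Proof.
move=> pcs Hr; have mE N := measurable_depends_on (@depends_on_long r N cs Hr).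
have E0 : fine (P (\bigcap_N ~` all_short N cs)) = 0 by rewrite long_null.
apply: cvg_trans (_ : _ --> fine (P (\bigcap_N ~` all_short N cs))) _; last by rewrite E0.
under eq_cvg do rewrite (pmean_event (depends_on_long Hr)).
apply: fine_cvg; rewrite fineK ?fin_num_measure //; last exact: bigcapT_measurable.
apply: nonincreasing_cvg_mu => //.
- by rewrite ltey_eq fin_num_measure.
- exact: bigcapT_measurable.
move=> M N le; apply/subsetPset => w /= lw sh; apply: lw => c ccs.
exact: short_le le (sh c ccs).
Qed.

End PatternMean.

(** * Cylinders under the infinite-volume coupling *)

Definition cylinder (cs : seq (dart * bool)) : set orientation :=
  [set s | all (fun c => along s c.1 == c.2) cs].

Lemma measurable_cyl (cs : seq (dart * bool)) : measurable (cylinder cs).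
Proof.
apply: (@measurable_depends_on _ [fset edge_of c.1 | c in cs]%fset) => s s' ss'.
move=> /allP sc; apply/allP => c ccs; rewrite -(eqP (sc c ccs)) /along /oriented.
by rewrite ss' //; apply/imfsetP; exists c.
Qed.

Lemma measure_ae_eq d (T : measurableType d) (R : realType)
    (m : {measure set T -> \bar R}) (Q : T -> Prop) (X Y : set T) :
  {ae m, forall x, Q x} -> measurable X -> measurable Y ->
  (forall x, Q x -> X x <-> Y x) -> m X = m Y.
Proof.
move=> [N [mN N0 QN]] mX mY XY.
have le A B : measurable A -> measurable B -> (forall x, Q x -> A x -> B x) ->
    (m A <= m B)%E.
  move=> mA mB AB; rewrite -(measureU0 mB mN N0); apply: le_measure.
  - by rewrite inE.
  - by rewrite inE; exact: measurableU.
  move=> x Ax; have [Qx|nQx] := pselect (Q x); first by left; exact: AB.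
  by right; exact: QN.
by apply/eqP; rewrite eq_le !le // => x /XY[].
Qed.

Section Coupling.
Variables (R : realType) (lam : R) (P : probability config R).
Variables (J : probability (config * orientation)%type R).
Hypothesis cpl : is_loop_coupling lam P J.

Let mfst (A : set config) : measurable A ->
  measurable (fst @^-1` A : set (config * orientation)%type).
Proof. by move=> mA; rewrite -[_ @^-1` _]setTI; exact: measurable_fst. Qed.

Let msnd (B : set orientation) : measurable B ->
  measurable (snd @^-1` B : set (config * orientation)%type).
Proof. by move=> mB; rewrite -[_ @^-1` _]setTI; exact: measurable_snd. Qed.

(** [w0] is a reference configuration: on [A] the loops in question are those of [w0], so that
    prescribing the values of [along] amounts to prescribing the senses of distinct loops. *)
Lemma coupling_distinct (w0 : config) (A : set config) (rs : seq (dart * bool)) :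
  measurable A -> (forall c, c \in rs -> is_primal (left_face c.1)) ->
  (forall w, A w -> forall c, c \in rs -> periodic w c.1) ->
  (forall w, A w -> forall c, c \in rs -> forall k,
     iter k (next_dart w) c.1 = iter k (next_dart w0) c.1) ->
  pairwise (fun c d => ~~ same_loop w0 d.1 c.1) rs ->
  J (snd @^-1` cylinder rs `&` fst @^-1` A) =
  (P A * (\prod_(c <- rs) orientation_prob lam (c.2 == acw w0 c.1))%:E)%E.
Proof.
move=> mA prs per agr pw; have [_ _ ind] := cpl.
pose c (i : 'I_(size rs)) := tnth (in_tuple rs) i.
have crs i : c i \in rs by rewrite /c mem_tnth.
have pc i : primal_dart (edge_of (c i).1) = (c i).1.
  by apply: primal_dart_edge_of; exact: prs.
have sE w i b : A w -> same_loop w (c i).1 b = same_loop w0 (c i).1 b.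
  move=> Aw; apply/asboolP/asboolP => -[k Ek]; exists k; rewrite -Ek;
  by rewrite (agr w Aw _ (crs i)).
rewrite big_tnth -(ind _ (fun i => edge_of (c i).1) (fun i => (c i).2 == acw w0 (c i).1)) //.
- congr (J _); apply/seteqP; split=> -[w s] /=.
    move=> [/allP al Aw]; split=> // i.
    have pi : periodic w (primal_dart (edge_of (c i).1)) by rewrite pc; exact: per.
    apply/(loop_orientedE _ _ pi); rewrite pc (eqP (al _ (crs i))).
    rewrite (acw_eq (agr w Aw _ (crs i))).
    by case: (c i).2; case: (acw _ _).
  move=> [Aw lo]; split=> //; apply/allP => c0 /seq_tnthP[i Ei]; rewrite Ei -/(c i).
  have pi : periodic w (primal_dart (edge_of (c i).1)) by rewrite pc; exact: per.
  have /(loop_orientedE _ _ pi) := lo i; rewrite pc => ->.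
  rewrite (acw_eq (agr w Aw _ (crs i))).
  by case: (c i).2; case: (acw _ _).
- by move=> w Aw i; apply/finite_loopE; rewrite pc; exact: per.
- move=> w Aw i j nij; have pi : periodic w (primal_dart (edge_of (c i).1)).
    by rewrite pc; exact: per.
  rewrite (loopP _ pi) !pc => ex; have sij : same_loop w (c i).1 (c j).1 by apply/asboolP.
  have pwE (i' j' : 'I_(size rs)) : (i' < j')%N -> ~~ same_loop w0 (c j').1 (c i').1.
    have /(pairwiseP (c i)) := pw; move: (c i) => c0 H lt.
    have := H i' j' (ltn_ord i') (ltn_ord j') lt.
    by rewrite /c !(tnth_nth c0).
  have [lt|gt|/val_inj eq] := ltngtP i j.
  + have := pwE _ _ lt; rewrite -(sE w) // => /negP; apply.
    by apply: same_loop_sym sij; exact: per.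
  + by have := pwE _ _ gt; rewrite -(sE w) // sij.
  + by rewrite eq eqxx in nij.
Qed.

(** By coherence, several darts on one loop either repeat a constraint, and one representative
    suffices, or contradict each other, and both sides are 0. *)
Lemma coupling_cylinder (w0 : config) (A : set config) (cs : seq (dart * bool)) :
  measurable A -> (forall c, c \in cs -> is_primal (left_face c.1)) ->
  (forall w, A w -> forall c, c \in cs -> periodic w c.1) ->
  (forall w, A w -> forall c, c \in cs -> forall k,
     iter k (next_dart w) c.1 = iter k (next_dart w0) c.1) ->
  J (snd @^-1` cylinder cs `&` fst @^-1` A) = (P A * (gfac lam cs w0)%:E)%E.
Proof.
move=> mA pcs per agr; have [_ aec _] := cpl.
set rs := reps (same_loop w0) cs.
have rcs := @reps_sub _ (same_loop w0) cs.
have mC B : measurable (snd @^-1` cylinder B `&` fst @^-1` A).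
  by apply: measurableI; [exact: msnd (measurable_cyl _)|exact: mfst].
have allE (w : config) (s : orientation) : coherent w s -> A w -> cylinder cs s <->
    consistent (same_loop w0) cs && all (fun c => along s c.1 == c.2) rs.
  move=> coh Aw; rewrite /cylinder /= -(@all_reps _ _ (along s)) //.
  move=> c d ccs dcs /asboolP[k]; rewrite -(agr w Aw c ccs) => <-.
  by rewrite along_iter //; [exact: pcs|exact: per].
rewrite /gfac; case: (consistent _ _) allE => allE; last first.
  rewrite mul0r mule0 -(measure0 J); apply: (measure_ae_eq aec) => // -[w s] /= coh.
  by split=> // -[/(allE _ _ coh)]; move=> H Aw; have := H Aw.
rewrite mul1r -(@coupling_distinct w0) //; last exact: reps_pairwise.
- apply: (measure_ae_eq aec) => // -[w s] /= coh.
  by split=> -[sc Aw]; split=> //; [exact/(allE w s coh Aw)|exact/(allE w s coh Aw)].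
- by move=> c /rcs/pcs.
- by move=> w Aw c /rcs; exact: per.
- by move=> w Aw c /rcs; exact: agr.
Qed.

(** The counterpart of [nu_bounds] in infinite volume, proved for each state of the window: it
    decides whether the loops are short and, if so, determines them. *)
Lemma law_bounds (mu : probability orientation R) (r N : nat) (cs : seq (dart * bool)) :
  (forall B : set orientation, measurable B -> mu B = J (snd @^-1` B)) ->
  (forall c, c \in cs -> is_primal (left_face c.1)) ->
  (forall c, c \in cs -> in_box r (left_face c.1)) ->
  pmean P (win (r + N).+1) (gshort lam N cs) <= fine (mu (cylinder cs)) <=
  pmean P (win (r + N).+1) (gshort lam N cs) + pmean P (win (r + N).+1) (ilong R N cs).
Proof.
move=> muJ pcs Hr; have [fstJ _ _] := cpl.
rewrite muJ; last exact: measurable_cyl.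
have mC := msnd (measurable_cyl cs).
rewrite (sum_pattern J (win (r + N).+1) measurable_fst mC) -pmeanD /pmean.
suff H pi : let X := fine (J (snd @^-1` cylinder cs `&` fst @^-1` pattern (win (r + N).+1) pi)) in
    let Y := fine (P (pattern (win (r + N).+1) pi)) in
    Y * gshort lam N cs (indicator_of pi) <= X /\
    X <= Y * (gshort lam N cs (indicator_of pi) + ilong R N cs (indicator_of pi)).
  by apply/andP; split; apply: ler_sum => pi _; have [] := H pi.
move=> X Y; have mp := measurable_pattern (win (r + N).+1) pi.
rewrite /gshort /ilong asbool_neg; case: asboolP => sh /=.
  rewrite addr0; suff -> : X = Y * gfac lam cs (indicator_of pi) by split.
  have agr (w : config) : pattern (win (r + N).+1) pi w -> forall c, c \in cs ->
      short N w c.1 /\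
      forall k, iter k (next_dart (indicator_of pi)) c.1 = iter k (next_dart w) c.1.
    by move=> wpi c ccs; apply: short_agree (Hr c ccs) _ (sh c ccs) => z /wpi.
  rewrite /X (@coupling_cylinder (indicator_of pi)) ?fineM ?fin_num_measure //.
    by move=> w wpi c ccs; have [/short_periodic] := agr w wpi c ccs.
  by move=> w wpi c ccs k; have [_ ->] := agr w wpi c ccs.
rewrite mulr0 add0r mulr1; split; first exact: fine_ge0.
rewrite /Y -fstJ // /X; apply: fine_le; rewrite ?fin_num_measure //.
- by apply: measurableI => //; exact: mfst.
- exact: mfst.
apply: le_measure; rewrite ?inE; last exact: subIsetr.
- by apply: measurableI => //; exact: mfst.
- exact: mfst.
Qed.

End Coupling.

(** * Convergence of the orientation laws and conclusion *)

Section Law.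
Variables (R : realType) (q : R) (P : probability config R).
Hypotheses (q_gt1 : 1 < q) (Pw : is_wired_measure (p_c q) q P).
Hypothesis P0 : P (percolates origin) = 0%E.

Lemma nu_cvg (lam : R) (mu : probability orientation R) (cs : seq (dart * bool)) :
  expR lam + expR (- lam) = Num.sqrt q -> is_orientation_law lam P mu ->
  (forall c, c \in cs -> is_primal (left_face c.1)) ->
  nu lam n cs @[n --> \oo] --> fine (mu (cylinder cs)).
Proof.
move=> Ex [J cpl muJ] pcs.
have [r Hr] := darts_in_box cs.
have x0 : 0 < Num.sqrt q := lt_trans ltr01 (sqrt_gt1 q_gt1).
have e0 := expR_gt0 lam; have e0' := expR_gt0 (- lam).
have ee : expR lam * expR (- lam) = 1 by rewrite expRN divff // gt_eqF.
(* The boundary weight equals [1 + expR lam ^+ 2], and [q] exceeds it by [1 + expR (- lam) ^+ 2];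
   this holds for either sign of [lam]. *)
have k1 : 1 <= Num.sqrt q * expR lam.
  by rewrite -Ex mulrDl [expR (- lam) * _]mulrC ee lerDr ltW // mulr_gt0.
have kq : Num.sqrt q * expR lam <= q.
  rewrite -[X in _ <= X]sqr_sqrtr; last by apply: le_trans (ltW q_gt1); exact: ler01.
  by rewrite expr2 ler_pM2l // -Ex lerDl ltW.
have lc := long_cvg q_gt1 Pw P0 pcs Hr.
apply/cvgrPdist_le => e e_gt0.
have e2 : 0 < e / 2 by rewrite divr_gt0.
have e4 : 0 < e / 2 / 2 by rewrite divr_gt0.
(* [N] is chosen before [n], so that long loops are unlikely in infinite volume; the bounds for the
   box and for the limit then involve the same local functions. *)
have [N HN] : exists N, pmean P (win (r + N).+1) (ilong R N cs) < e / 2.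
  have /cvgrPdist_lt/(_ _ e2)[N _ /(_ N (leqnn N)) /=] := lc.
  rewrite sub0r normrN => lt; exists N; apply: le_lt_trans lt; exact: ler_norm.
have /andP[lo up] := law_bounds cpl N muJ pcs Hr.
have c1 := fk_mean_cvg q_gt1 Pw P0 k1 kq (local_gshort (N := N) Hr lam).
have c2 := fk_mean_cvg q_gt1 Pw P0 k1 kq (local_ilong (N := N) Hr R).
near=> n.
have le : ((r + N).+2 <= n)%N by near: n; exists (r + N).+2.
have /andP[lo' up'] := nu_bounds q_gt1 Ex le pcs Hr.
have w1 : `|pmean P (win (r + N).+1) (gshort lam N cs) -
    fk_mean q (Num.sqrt q * expR lam) n (gshort lam N cs)| <= e / 2 / 2.
  by near: n; move/cvgrPdist_le: c1; apply.
have w2 : `|pmean P (win (r + N).+1) (ilong R N cs) -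
    fk_mean q (Num.sqrt q * expR lam) n (ilong R N cs)| <= e / 2 / 2.
  by near: n; move/cvgrPdist_le: c2; apply.
move: w1 w2 lo up lo' up' HN.
move: (pmean _ _ _) (pmean _ _ _) (fk_mean _ _ _ _) (fk_mean _ _ _ _) => a b c d.
move: (fine _) (nu _ _ _) => m v.
rewrite !ler_distl => /andP[w1 w1'] /andP[w2 w2'] h1 h2 h3 h4 h5.
by apply/andP; split; lra.
Unshelve. all: by end_near. Qed.

End Law.

(** Cylinders are closed under intersection and generate the sigma-algebra, the orientation of an
    edge being encoded by its primal dart. *)
Lemma orientation_unique (R : realType) (mu mu' : probability orientation R) :
  (forall cs, (forall c, c \in cs -> is_primal (left_face c.1)) ->
    mu (cylinder cs) = mu' (cylinder cs)) ->
  forall B : set orientation, measurable B -> mu B = mu' B.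
Proof.
move=> H B mB.
pose prim (cs : seq (dart * bool)) := all (fun c => is_primal (left_face c.1)) cs.
pose G := [set A | exists2 cs, prim cs & A = cylinder cs].
have cyl0 : cylinder [::] = setT by apply/seteqP; split.
apply: (@measure_unique _ _ orientation G (fun=> setT)) => //.
- apply/seteqP; split; last first.
    apply: smallest_sub; first exact: sigma_algebra_measurable.
    by move=> A [cs _ ->]; exact: measurable_cyl.
  apply: smallest_sub; first exact: smallest_sigma_algebra.
  move=> A [e ->]; apply: sub_sigma_algebra.
  exists [:: (primal_dart e, is_primal (left_face (forward e)))].
    by rewrite /prim /= primal_primal_dart.
  apply/seteqP; split=> s; rewrite /cylinder /= alongE andbT.
    by move=> ->.
  by case: (s e); case: (is_primal _).
- move=> A A' [cs p ->] [cs' p' ->]; exists (cs ++ cs'); first by rewrite /prim all_cat; apply/andP.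
  apply/seteqP; split=> s; rewrite /cylinder /= all_cat; first by case=> -> ->.
  by move=> /andP[].
- by move=> _; exists [::].
- by apply/seteqP; split=> // s _; exists 0%N.
- by move=> A [cs /allP p ->]; exact: H.
- by move=> _; rewrite ltey_eq fin_num_measure.
Qed.

Theorem theorem2 (R : realType) (q lam : R) (P : probability config R)
    (mu mu' : probability orientation R) :
  4 < q ->
  is_wired_measure (p_c q) q P ->
  P (percolates origin) = 0%E ->
  0 < lam ->
  expR lam + expR (- lam) = Num.sqrt q ->
  is_orientation_law lam P mu ->
  is_orientation_law (- lam) P mu' ->
  forall B : set orientation, measurable B -> mu B = mu' B.
Proof.
move=> q4 Pw P0 _ Ex muP muP'; have q1 : 1 < q by apply: lt_trans q4; rewrite ltr1n.
apply: orientation_unique => cs pcs.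
rewrite -[LHS]fineK ?fin_num_measure //; last exact: measurable_cyl.
rewrite -[RHS]fineK ?fin_num_measure //; last exact: measurable_cyl.
congr (_%:E); have Ex' : expR (- lam) + expR (- - lam) = Num.sqrt q by rewrite opprK addrC.
(* By [nu_sym] one and the same sequence converges to both values. *)
have c := nu_cvg q1 Pw P0 Ex muP pcs; have := nu_cvg q1 Pw P0 Ex' muP' pcs.
under eq_cvg do rewrite -nu_sym.
by move=> c'; apply: (cvg_unique _ c c').
Qed.
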